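(* Let $h\in C^\infty(\mathscr C)$ be a real-valued smooth function on the cylinder $\mathscr C$. Then there is a smooth family of holomorphic disks $\{\mathcal D_{x}\}$ on $(\mathscr T,\mathscr P_h)$ parametrized by $x=(s,t,z)\in M=\mathbb R\times\mathbb R^{1,2}\cong\mathbb C^2$ such that, moreover, if $\partial_t Rh<1$ everywhere on $\mathbb R^{1,2}$, then this family induces a self-dual conformal structure of signature $(--++)$ on $M$, i.e. there is a unique smooth self-dual conformal structure on $M$ for which, for every $p\in\mathscr P_h$, the set $\{x\in M : p\in\partial\mathcal D_x\}$ is a $\beta$-surface; and this conformal structure is represented by the metric $$g_{(V,A)}=-V^{-1}(ds+A)^2+V\,\underline g ,\qquad \underline g=-dt^2+dx_1^2+dx_2^2,$$ where the function $V\in C^\infty(\mathbb R^{1,2})$ and the 1-form $A\in\Omega^1(\mathbb R^{1,2})$ are $$V=1-\partial_t Rh,\qquad A=\check *\,\check d\,Rh .$$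
   Context: Cylinder and transform: $\mathscr C=\{(e^{i\theta},v)\in S^1\times\mathbb R\}$. Coordinates on $\mathbb R^{1,2}=\mathbb R\times\mathbb R^2=\mathbb R\times\mathbb C$ are $(t,x_1,x_2)$, or $(t,z)$ with $z=x_1+ix_2$. The transform $R:C^\infty(\mathscr C)\to C^\infty(\mathbb R^{1,2})$ is $Rh(t,z)=\frac1{2\pi}\int_0^{2\pi}h\bigl(e^{i\theta},t+\mathrm{Re}(ze^{-i\theta})\bigr)d\theta$. For a function $u$ on $\mathbb R^{1,2}$, $\check d u=\frac{\partial u}{\partial x_1}dx_1+\frac{\partial u}{\partial x_2}dx_2$, and $\check *dx_1=dx_2$, $\check *dx_2=-dx_1$. Twistor space: $\mathscr T=\{[y_0:y_1:y_2:y_3]\in\mathbb{CP}^3 : (y_0,y_1)\ne(0,0)\}$. $\mathscr S$ is the total space of the degree 2 holomorphic line bundle over $\mathbb{CP}^1$, with weighted homogeneous coordinates $[y_0:y_1;v]=[\lambda y_0:\lambda y_1;\lambda^2v]$ for $\lambda\in\mathbb C^*$. The cylinder $\mathscr C$ is embedded in $\mathscr S$ by $(e^{i\theta},v)\mapsto[e^{-i\theta/2}:e^{i\theta/2};v]$. The map $\pi:\mathscr T\to\mathscr S$ is $\pi([y_0:y_1:y_2:y_3])=[y_0:y_1;\frac{y_0y_2+y_1y_3}2]$. The restriction $\mathscr T|_{\mathscr C}=\pi^{-1}(\mathscr C)$ is identified with $\mathscr C\times\mathbb C$ by $$(e^{i\theta},v;\nu)\mapsto[e^{-i\theta/2}:e^{i\theta/2}:e^{i\theta/2}(v-i\nu):e^{-i\theta/2}(v+i\nu)].$$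 For real-valued $h\in C^\infty(\mathscr C)$, put $\mathscr P_h=\{(e^{i\theta},v;\nu)\in\mathscr T|_{\mathscr C} : \mathrm{Im}(\nu)=h(e^{i\theta},v)\}$, a real 3-dimensional submanifold of $\mathscr T$. Holomorphic disks: $\mathbb D=\{\omega\in\mathbb C:|\omega|\le1\}$. A holomorphic disk on $(\mathscr T,\mathscr P_h)$ is the image $\mathcal D$ of a continuous map $(\mathbb D,\partial\mathbb D)\to(\mathscr T,\mathscr P_h)$ that is holomorphic on the interior of $\mathbb D$; $\partial\mathcal D$ denotes the image of $\partial\mathbb D$. A family of holomorphic disks parametrized by a manifold $M$ is smooth if it is given by $\mathcal D_x=\mathfrak f(\{x\}\times\mathbb D)$ for a smooth map $\mathfrak f:M\times\mathbb D\to\mathscr T$ with $\mathfrak f(M\times\partial\mathbb D)\subset\mathscr P_h$, holomorphic along each $\{x\}\times\mathbb D$. Parameter space: $M=\mathbb R\times\mathbb R^{1,2}=\{(s,t,z)\}$ is identified with $\mathbb C^2$ by $(a,b)=(t+is,z)$ and given the standard orientation of $\mathbb C^2$, i.e. that of $dt\wedge ds\wedge dx_1\wedge dx_2$. A $\beta$-surface for a conformal structure of signature $(--++)$ is a surface on which the conformal structure vanishes (totally null) and whose tangent bivector is anti-self-dual everywhere. A conformal structure is self-dual if the anti-self-dual part of its Weyl tensor vanishes. *)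

(* Defs.v *)
From mathcomp Require Import all_boot all_order all_algebra.
From mathcomp Require Import complex.
From mathcomp Require Import all_classical all_reals all_analysis.

Set Implicit Arguments.
Unset Strict Implicit.
Unset Printing Implicit Defensive.

Import Order.TTheory GRing.Theory Num.Theory.
Import numFieldNormedType.Exports.

Local Open Scope classical_set_scope.
Local Open Scope ring_scope.
Local Open Scope complex_scope.

(* [f] is C^k on the open set [U]: all iterated directional derivatives of [f]
   of order <= k exist and are continuous on [U].  For finite-dimensional [V]
   (the only case used) this is the usual notion. *)
Fixpoint Ck_on (R : realType) (V W : normedModType R) (k : nat)
    (U : set V) (f : V -> W) : Prop :=
  (forall x, U x -> {for x, continuous f}) /\
  if k is k'.+1 then
    forall v, (forall x, U x -> derivable f x v) /\ Ck_on k' U ('D_v f)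
  else True.

Definition smooth_on (R : realType) (V W : normedModType R)
    (U : set V) (f : V -> W) : Prop := forall k, Ck_on k U f.

Definition partial (R : realType) (n : nat) (i : 'I_n.+1)
    (f : 'rV[R]_n.+1 -> R) (x : 'rV[R]_n.+1) : R := 'D_(delta_mx 0 i) f x.

Definition row4 (K : nzRingType) (a b c d : K) : 'rV[K]_4 :=
  \row_(i < 4) [:: a; b; c; d]`_i.

Definition row3 (K : nzRingType) (a b c : K) : 'rV[K]_3 :=
  \row_(i < 3) [:: a; b; c]`_i.

Definition expi (R : realType) (theta : R) : R[i] := cos theta +i* sin theta.

(* A function on the cylinder S^1 x R is given by [h : R[i] -> R -> R], of which
   only the values [h w v] with [`|w| = 1] are ever used; it is smooth iff its
   pullback by the covering (theta, v) |-> (e^{i theta}, v) is. *)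
Definition smooth_cylinder (R : realType) (h : R[i] -> R -> R) : Prop :=
  smooth_on [set: 'rV[R]_2]
    (fun p : 'rV[R]_2 => (h (expi (p 0 0)) (p 0 1) : R^o)).

(* Points of R^{1,2} are rows (t, x1, x2). *)
Definition transformR (R : realType) (h : R[i] -> R -> R) (p : 'rV[R]_3) : R :=
  (2 * pi)^-1 *
  (\int[lebesgue_measure]_(theta in `[0, 2 * pi])
     h (expi theta)
       (p 0 0 + complex.Re ((p 0 1 +i* p 0 2) * expi (- theta))))%R.

(* 1-forms on R^{1,2} are rows of coefficients along (dt, dx1, dx2); the star is
   only ever applied to combinations of dx1 and dx2. *)
Definition check_d (R : realType) (u : 'rV[R]_3 -> R) (p : 'rV[R]_3) :
  'rV[R]_3 := row3 0 (partial 1 u p) (partial 2 u p).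

Definition check_star (R : realType) (eta : 'rV[R]_3) : 'rV[R]_3 :=
  row3 0 (- eta 0 2) (eta 0 1).

(* A point of CP^3 is a line in C^4, and [y0 : y1 : y2 : y3] is <[y]>. *)
Definition CP3 (R : realType) : set {vspace 'rV[R[i]]_4} :=
  [set L | \dim L = 1%N].

Definition twistor_space (R : realType) : set {vspace 'rV[R[i]]_4} :=
  [set L | CP3 L /\
     exists2 y : 'rV[R[i]]_4, y \in L & (y 0 0, y 0 1) != (0, 0)].

(* The affine chart {y_i <> 0} of CP^3 and its coordinates y_j / y_i. *)
Definition chart_dom (R : realType) (i : 'I_4) : set {vspace 'rV[R[i]]_4} :=
  [set L | (vpick L : 'rV_4) 0 i != 0].

Definition chart (R : realType) (i j : 'I_4) (L : {vspace 'rV[R[i]]_4}) : R[i] :=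
  (vpick L : 'rV_4) 0 j / (vpick L : 'rV_4) 0 i.

(* The identification of the part of twistor space lying over the cylinder with
   S^1 x R x C; it is 2 pi-periodic in theta, since theta |-> theta + 2 pi
   changes the sign of the homogeneous coordinates. *)
Definition twistor_point (R : realType) (theta v : R) (nu : R[i]) :
    {vspace 'rV[R[i]]_4} :=
  <[row4 (expi (- (theta / 2))) (expi (theta / 2))
         (expi (theta / 2) * (v%:C - 'i * nu))
         (expi (- (theta / 2)) * (v%:C + 'i * nu))]>%VS.

Definition twistor_P (R : realType) (h : R[i] -> R -> R) :
    set {vspace 'rV[R[i]]_4} :=
  [set L | exists theta v nu,
     complex.Im nu = h (expi theta) v /\ L = twistor_point theta v nu].

(* Points of M are rows (t, s, x1, x2): in this order the coordinates are
   positively oriented for the orientation coming from (a, b) = (t + is, z).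
   Of a family [f : M -> R[i] -> CP^3] only the restriction to M x D is used,
   D being the closed unit disk. *)

(* Smoothness of [f : M x D -> T] at the points of M x D, including those of the
   boundary: in some affine chart [f] locally extends to a smooth map on an open
   subset of M x R^2. *)
Definition smooth_family (R : realType)
    (f : 'rV[R]_4 -> R[i] -> {vspace 'rV[R[i]]_4}) : Prop :=
  forall (x0 : 'rV[R]_4) (w0 : 'rV[R]_2), `|w0 0 0 +i* w0 0 1| <= 1 ->
  exists (i : 'I_4) (U : set ('rV[R]_4 * 'rV[R]_2)%type)
         (G : 'I_4 -> ('rV[R]_4 * 'rV[R]_2)%type -> R[i]),
    [/\ open U, U (x0, w0),
        forall j, smooth_on U (fun q => (complex.Re (G j q) : R^o)) /\
                  smooth_on U (fun q => (complex.Im (G j q) : R^o)) &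
        forall x w, U (x, w) -> `|w 0 0 +i* w 0 1| <= 1 ->
          chart_dom i (f x (w 0 0 +i* w 0 1)) /\
          forall j, chart i j (f x (w 0 0 +i* w 0 1)) = G j (x, w)].

(* [derivable] is taken over the field R[i]: it is complex differentiability. *)
Definition holomorphic_in_disk (R : realType)
    (D : R[i] -> {vspace 'rV[R[i]]_4}) : Prop :=
  forall w0 : R[i], `|w0| < 1 ->
  exists i : 'I_4, (\forall w \near (w0 : R[i]^o), chart_dom i (D w)) /\
    forall j, derivable (fun w : R[i]^o => (chart i j (D w) : R[i]^o)) w0 1.

Definition smooth_disk_family (R : realType) (h : R[i] -> R -> R)
    (f : 'rV[R]_4 -> R[i] -> {vspace 'rV[R[i]]_4}) : Prop :=
  [/\ forall x w, `|w| <= 1 -> twistor_space (f x w),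
      forall x w, `|w| = 1 -> twistor_P h (f x w),
      forall x, holomorphic_in_disk (f x) &
      smooth_family f].

Definition disk_boundary (R : realType) (D : R[i] -> {vspace 'rV[R[i]]_4}) :
  set {vspace 'rV[R[i]]_4} := D @` [set w | `|w| = 1].

Definition signature_mmpp (R : realType) (g : 'M[R]_4) : Prop :=
  exists2 P : 'M[R]_4, P \in unitmx &
    P *m g *m P^T = diag_mx (row4 (-1) (-1) 1 1).

Definition neutral_metric (R : realType) (g : 'rV[R]_4 -> 'M[R]_4) : Prop :=
  [/\ smooth_on setT g, forall x, (g x)^T = g x &
      forall x, signature_mmpp (g x)].

(* The conformal factor may have either sign: in neutral signature -g again has
   signature (--++), and has the same null vectors as g. *)
Definition conformal (R : realType) (g g' : 'rV[R]_4 -> 'M[R]_4) : Prop :=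
  exists lam : 'rV[R]_4 -> R,
    [/\ smooth_on setT (lam : _ -> R^o), forall x, lam x != 0 &
        forall x, g' x = lam x *: g x].

Definition neutral_conformal_structure (R : realType)
    (c : set ('rV[R]_4 -> 'M[R]_4)) : Prop :=
  exists2 g, neutral_metric g & c = [set g' | conformal g g'].

Section Curvature.
Context {R : realType} (g : 'rV[R]_4 -> 'M[R]_4).

Definition ginv (x : 'rV[R]_4) : 'M[R]_4 := invmx (g x).

(* Gamma^k_ij *)
Definition christoffel (k i j : 'I_4) (x : 'rV[R]_4) : R :=
  2^-1 * \sum_l ginv x k l *
    (partial i (fun y => g y j l) x + partial j (fun y => g y i l) x
     - partial l (fun y => g y i j) x).

(* R^l_kij, defined by R(d_i, d_j) d_k = R^l_kij d_l with
   R(X, Y) = [nabla_X, nabla_Y] - nabla_[X, Y] *)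
Definition riemann_up (l k i j : 'I_4) (x : 'rV[R]_4) : R :=
  partial i (christoffel l j k) x - partial j (christoffel l i k) x
  + \sum_m (christoffel l i m x * christoffel m j k x
            - christoffel l j m x * christoffel m i k x).

Definition riemann (l k i j : 'I_4) (x : 'rV[R]_4) : R :=
  \sum_m g x l m * riemann_up m k i j x.

Definition ricci (k j : 'I_4) (x : 'rV[R]_4) : R :=
  \sum_i riemann_up i k i j x.

Definition scalar_curvature (x : 'rV[R]_4) : R :=
  \sum_k \sum_j ginv x k j * ricci k j x.

Definition weyl (l k i j : 'I_4) (x : 'rV[R]_4) : R :=
  riemann l k i j x
  - 2^-1 * (g x l i * ricci k j x - g x l j * ricci k i x
            - g x k i * ricci l j x + g x k j * ricci l i x)
  + scalar_curvature x / 6 * (g x l i * g x k j - g x l j * g x k i).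

End Curvature.

Definition levi_civita (R : realType) (a b c d : 'I_4) : R :=
  \det (\matrix_(i < 4, j < 4) ((tnth [tuple a; b; c; d] i == j)%:R : R)).

(* Hodge star of the metric [g] on 2-forms at a point, for the orientation in
   which the coordinates (t, s, x1, x2) are positive; the 2-form is given by its
   antisymmetric matrix of coefficients. *)
Definition hodge (R : realType) (g F : 'M[R]_4) : 'M[R]_4 :=
  \matrix_(a < 4, b < 4)
    (2^-1 * Num.sqrt `|\det g| *
     \sum_c \sum_d levi_civita R a b c d * (invmx g *m F *m invmx g) c d).

(* The star acts on the first pair of indices of the Weyl tensor W, and commutes
   with W; the anti-self-dual part is (W - *W) / 2. *)
Definition weyl_asd (R : realType) (g : 'rV[R]_4 -> 'M[R]_4)
    (l k i j : 'I_4) (x : 'rV[R]_4) : R :=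
  2^-1 * (weyl g l k i j x
          - hodge (g x) (\matrix_(a < 4, b < 4) weyl g a b i j x) l k).

Definition self_dual_metric (R : realType) (g : 'rV[R]_4 -> 'M[R]_4) : Prop :=
  forall l k i j x, weyl_asd g l k i j x = 0.

(* The Weyl tensor is conformally covariant, so the choice of the representative
   is immaterial; similarly for [beta_surface] below. *)
Definition self_dual (R : realType) (c : set ('rV[R]_4 -> 'M[R]_4)) : Prop :=
  exists2 g, c g & self_dual_metric g.

(* Nonempty embedded submanifold of dimension 2: locally the zero set of a
   submersion to R^2. *)
Definition surface (R : realType) (S : set 'rV[R]_4) : Prop :=
  S !=set0 /\
  forall x, S x -> exists (U : set 'rV[R]_4) (F : 'rV[R]_4 -> 'rV[R]_2),
    [/\ open U, U x, smooth_on U F,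
        forall w, exists v, 'D_v F x = w &
        forall y, U y -> (S y <-> F y = 0)].

Definition tangent (R : realType) (S : set 'rV[R]_4) (x u : 'rV[R]_4) : Prop :=
  exists gam : R -> 'rV[R]_4,
    [/\ smooth_on [set: R^o] (gam : R^o -> _), gam 0 = x,
        forall r, S (gam r) & derive1 gam 0 = u].

(* The bivector u /\ w, with indices lowered by [g]. *)
Definition bivector_flat (R : realType) (g : 'M[R]_4) (u w : 'rV[R]_4) :
  'M[R]_4 := g *m (u^T *m w - w^T *m u) *m g^T.

Definition beta_surface (R : realType) (c : set ('rV[R]_4 -> 'M[R]_4))
    (S : set 'rV[R]_4) : Prop :=
  surface S /\
  exists2 g, c g &
    forall x u w, S x -> tangent S x u -> tangent S x w ->
      u *m g x *m w^T = 0 /\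
      hodge (g x) (bivector_flat (g x) u w) = - bivector_flat (g x) u w.

Definition base_point (R : realType) (x : 'rV[R]_4) : 'rV[R]_3 :=
  row3 (x 0 0) (x 0 2) (x 0 3).

Definition metric_VA (R : realType) (V : 'rV[R]_3 -> R)
    (A : 'rV[R]_3 -> 'rV[R]_3) (x : 'rV[R]_4) : 'M[R]_4 :=
  let p := base_point x in
  let sigma := row4 (A p 0 0) 1 (A p 0 1) (A p 0 2) in
  - (V p)^-1 *: (sigma^T *m sigma) + V p *: diag_mx (row4 (-1) 0 1 1).

(* Main.v *)
Require Import Defs.
From mathcomp Require Import all_boot all_order all_algebra.
From mathcomp Require Import complex.
From mathcomp Require Import all_classical all_reals all_analysis.
From mathcomp Require Import ring lra.

(* For w = e^{i theta} the equations of incidence of x = (s, t, z) with the point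
   (e^{i theta}, v; nu) of P_h are t + Re(z conj(w)) = v and s - Im(z conj(w)) + i Phi = nu, where
   Phi(x, .) is holomorphic in the disk and Re Phi = h(e^{i theta}, t + Re(z conj(w))) on its
   boundary. So the disks are given by the Schwarz integral Phi of the pulled back h; as a
   Fourier series it converges with all its derivatives up to the boundary, and is extended
   smoothly beyond it by cutting off w^k at |w|^2 = 1 + 1/k.

   On the boundary, the derivatives of Im Phi along the tangent directions (-1, cos, sin) and
   (0, -sin, cos) of {t + Re(z conj(w)) = v} are sums of telescoping conjugate Fourier series, and
   turn out to be linear in the first derivatives of Rh. This identifies the tangent planes of
   the surfaces {x | p in the boundary of D_x} with the totally null anti-self-dual planes of
   the metric g_(V,A). A symmetric form that vanishes on all these planes at a point is a
   multiple of g_(V,A), hence uniqueness. Since Rh solves the wave equation, (V, A) is a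
   monopole, and then the Levi-Civita connection of g_(V,A) in an explicit null coframe takes
   its values in one of the two ideals of so(2,2), which makes the curvature self-dual. *)

Set Implicit Arguments.
Unset Strict Implicit.
Unset Printing Implicit Defensive.
Import Order.TTheory GRing.Theory Num.Theory.
Import numFieldNormedType.Exports.
Local Open Scope classical_set_scope.
Local Open Scope ring_scope.
Local Open Scope complex_scope.

(** * Derivatives along lines and the mean value theorem *)

Section Lines.
Context {R : realType} {V W : normedModType R}.
Implicit Types (f : V -> W) (x v : V).

(** The family must be smooth across the boundary circle, while the power series of Phi need not
    converge for |w| > 1. The cutoffs are therefore matched to the degree: where the one of w^k can
    be nonzero, |w|^k stays bounded, and each derivative costs only a factor of order k, which the
    rapidly decreasing Fourier coefficients absorb. All exchanges of derivatives with circle means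
    or with series are instances of one statement on bounded functionals of equicontinuous families.

    The telescoping has a closed form behind it. Conjugation is minus the mean against cot(d/2), d =
    t - theta. In the two tangent directions the pulled back h is differentiated to a factor cos d -
    1 or sin d, which cancels the pole at d = 0 and leaves sin d and -(1 + cos d). What remains are
    means against 1, cos and sin, that is, first derivatives of Rh. In V = 1 - d_t Rh the 1 stems
    from the term Im(z conj(w)) and the rest from Im Phi. *)

Lemma is_derive_line f x v (a : R) : derivable f (a *: v + x) v ->
  is_derive a (1 : R^o) (fun t : R^o => f (t *: v + x)) ('D_v f (a *: v + x)).
Proof.
move=> df.
suff E : (fun t : R => t^-1 *: (f ((t *: (1 : R^o) + a) *: v + x) - f (a *: v + x))) =
    (fun t : R => t^-1 *: (f (t *: v + (a *: v + x)) - f (a *: v + x))).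
  split.
    by move: df; rewrite /derivable /= -E.
  by rewrite /derive /= -E.
apply/funext => t; congr (_ *: (f _ - _)).
by rewrite addrA -scalerDl; congr (_ *: _ + _); congr (_ + _); rewrite /GRing.scale /= mulr1.
Qed.

Lemma is_derive_alongP f x v (df : W) :
  is_derive (0 : R^o) (1 : R^o) (fun t : R^o => f (t *: v + x)) df -> is_derive x v f df.
Proof.
have E : (fun t : R => t^-1 *: (f ((t *: (1 : R^o) + 0) *: v + x) - f (0 *: v + x))) =
    (fun t : R => t^-1 *: (f (t *: v + x) - f x)).
  apply/funext => t; congr (_ *: (f _ - f _)); last by rewrite scale0r add0r.
  by congr (_ *: _ + _); rewrite addr0 /GRing.scale /= mulr1.
by case=> d1 d2; split; [move: d1; rewrite /derivable /= E | move: d2; rewrite /derive /= E].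
Qed.

End Lines.

Lemma mvt_dir {R : realType} {V : normedModType R} (f : V -> R) (x v : V) :
  (forall y, derivable f y v) ->
  exists2 a : R, 0 <= a <= 1 & f (v + x) - f x = 'D_v f (a *: v + x).
Proof.
move=> df.
have d t : is_derive t (1 : R^o) (fun t : R^o => f (t *: v + x)) ('D_v f (t *: v + x)).
  exact: is_derive_line.
have [|] := @MVT_segment R (fun t => f (t *: v + x)) (fun t => 'D_v f (t *: v + x)) 0 1 ler01.
- apply: continuous_subspaceT => t; apply: differentiable_continuous.
  by apply/derivable1_diffP; case: (d t).
- move=> c; rewrite in_itv /= => c01 E; exists c => //.
  by move: E; rewrite scale1r scale0r add0r subr0 mulr1.
Qed.

Lemma is_derive_scale {R : realType} {V : normedModType R} (f : V -> R) (x v : V) (t : R) :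
  derivable f x v -> is_derive x (t *: v) f (t * 'D_v f x).
Proof.
move=> df; apply: is_derive_alongP.
rewrite (_ : (fun _ => _) = (fun s : R => f (s *: v + x)) \o (fun s : R => s * t)); last first.
  by apply/funext => s /=; rewrite scalerA.
rewrite mulrC; apply: (@is_derive1_comp R (fun s : R => f (s *: v + x)) (fun s => s * t)).
  by rewrite mul0r; apply: is_derive_eq; [apply: is_derive_line; rewrite scale0r add0r|rewrite scale0r add0r].
by apply: is_derive_eq; rewrite scaler0 add0r /GRing.scale /= mulr1.
Qed.

Lemma mvt_dir_scale {R : realType} {V : normedModType R} (f : V -> R) (x v : V) (t : R) :
  (forall y, derivable f y v) ->
  exists2 a : R, 0 <= a <= 1 & f (t *: v + x) - f x = t * 'D_v f ((a * t) *: v + x).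
Proof.
move=> df; have d y := is_derive_scale t (df y).
have [|a a01 E] := @mvt_dir R V f x (t *: v); first by move=> y; case: (d y).
by exists a => //; rewrite E -scalerA; case: (d (a *: (t *: v) + x)).
Qed.

(** * Equicontinuous families of C^n functions *)

Section Families.
Context {R : realType}.

(* Pointwise bounded families, equicontinuous together with their derivatives of order <= n:
   a bounded linear functional in the index (a mean, a weighted series) turns them into C^n
   functions, and may be exchanged with differentiation. *)
Fixpoint equiC (V : normedModType R) (I : Type) (D : set I) (adm : set (I -> R)) (n : nat)
    (u : I -> V -> R) : Prop :=
  [/\ forall x, adm (u^~ x),
      forall x, exists M, forall i, D i -> `|u i x| <= M,
      forall x (e : R), 0 < e -> \forall y \near x, forall i, D i -> `|u i y - u i x| <= e &
      if n is m.+1 then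
        forall v, (forall i x, derivable (u i) x v) /\ equiC D adm m (fun i => 'D_v (u i))
      else True].

Section OneSpace.
Context {V : normedModType R} {I : Type} {D : set I} {adm : set (I -> R)}.
Implicit Types (u w : I -> V -> R) (x v : V).

Lemma equiC_adm n u x : equiC D adm n u -> adm (u^~ x).
Proof. by case: n => [|n] []. Qed.

Lemma equiC_bounded n u x : equiC D adm n u -> exists M, forall i, D i -> `|u i x| <= M.
Proof. by case: n => [|n] []. Qed.

Lemma equiC_cont n u x (e : R) : equiC D adm n u -> 0 < e ->
  \forall y \near x, forall i, D i -> `|u i y - u i x| <= e.
Proof. by case: n => [|n] [] ? ? c ? e0; exact: c. Qed.

Lemma equiC0 n u : equiC D adm n u -> equiC D adm 0 u.
Proof. by case: n => [|n] []. Qed.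

Lemma equiC_derivable n u i x v : equiC D adm n.+1 u -> derivable (u i) x v.
Proof. by case=> _ _ _ /(_ v)[]. Qed.

Lemma equiC_derive n u v : equiC D adm n.+1 u -> equiC D adm n (fun i => 'D_v (u i)).
Proof. by case=> _ _ _ /(_ v)[]. Qed.

Lemma equiCW n u : equiC D adm n.+1 u -> equiC D adm n u.
Proof.
elim: n u => [|n IH] u [a b c d]; split => //.
by move=> v; have [d1 d2] := d v; split => //; exact: IH.
Qed.

Lemma equiC_loc_bounded n u x : equiC D adm n u ->
  exists2 M, 0 < M & \forall y \near x, forall i, D i -> `|u i y| <= M.
Proof.
move=> eu; have [M hM] := equiC_bounded x eu; have c := equiC_cont x eu ltr01.
exists (`|M| + 1); first by rewrite ltr_wpDl.
near=> y => i Di; rewrite -[u i y](subrK (u i x)) addrC.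
apply: le_trans (ler_normD _ _) _; apply: lerD.
  by apply: le_trans (hM _ Di) _; exact: ler_norm.
by move: i Di; near: y.
Unshelve. all: by end_near. Qed.

Lemma equiC_add n u w : (forall a b, adm a -> adm b -> adm (fun i => a i + b i)) ->
  equiC D adm n u -> equiC D adm n w -> equiC D adm n (fun i x => u i x + w i x).
Proof.
move=> ad; elim: n u w => [|n IH] u w eu ew; split.
1,5: by move=> x; apply: ad; [exact: (equiC_adm x eu)|exact: (equiC_adm x ew)].
1,4: move=> x; have [M hM] := equiC_bounded x eu; have [N hN] := equiC_bounded x ew;
  by exists (M + N) => i Di; apply: le_trans (ler_normD _ _) _; apply: lerD; [exact: hM|exact: hN].
1,3: move=> x e e0; have c1 := equiC_cont x eu (divr_gt0 e0 (ltr0n _ 2));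
  have c2 := equiC_cont x ew (divr_gt0 e0 (ltr0n _ 2));
  near=> y => i Di; rewrite opprD addrACA (splitr e); apply: le_trans (ler_normD _ _) _;
  by apply: lerD; move: i Di; near: y.
- by [].
- move=> v; split.
    by move=> i x; apply: derivableD; [exact: equiC_derivable eu|exact: equiC_derivable ew].
  rewrite (_ : (fun i => _) = (fun i x => 'D_v (u i) x + 'D_v (w i) x)).
    by apply: IH; exact: equiC_derive.
  by apply/funext => i; apply/funext => x; apply: deriveD;
    [exact: equiC_derivable eu|exact: equiC_derivable ew].
Unshelve. all: by end_near. Qed.

Lemma equiC_mul_cont n u w x (e : R) : equiC D adm n u -> equiC D adm n w -> 0 < e ->
  \forall y \near x, forall i, D i -> `|u i y * w i y - u i x * w i x| <= e.
Proof.
move=> eu ew e0; have [M hM] := equiC_bounded x eu; have [N N0 hN] := equiC_loc_bounded x ew.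
have c1 := equiC_cont x eu (divr_gt0 e0 (mulr_gt0 (ltr0n _ 2) N0)).
have M1 : 0 < `|M| + 1 by rewrite ltr_wpDl.
have c2 := equiC_cont x ew (divr_gt0 e0 (mulr_gt0 (ltr0n _ 2) M1)).
near=> y => i Di.
rewrite (_ : _ - _ = (u i y - u i x) * w i y + u i x * (w i y - w i x)); last by ring.
rewrite (splitr e); apply: le_trans (ler_normD _ _) _; apply: lerD; rewrite normrM.
- apply: (@le_trans _ _ (e / (2 * N) * N)).
    by apply: ler_pM => //; move: i Di; near: y.
  by rewrite le_eqVlt; apply/orP; left; apply/eqP; field; rewrite gt_eqF.
- apply: (@le_trans _ _ ((`|M| + 1) * (e / (2 * (`|M| + 1))))).
    apply: ler_pM => //; last by move: i Di; near: y.
    by apply: le_trans (hM _ Di) _; rewrite (le_trans (ler_norm _)) // lerDl.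
  by rewrite le_eqVlt; apply/orP; left; apply/eqP; field; rewrite gt_eqF.
Unshelve. all: by end_near. Qed.

Lemma equiC_mul n u w : (forall a b, adm a -> adm b -> adm (fun i => a i + b i)) ->
  (forall a b, adm a -> adm b -> adm (fun i => a i * b i)) ->
  equiC D adm n u -> equiC D adm n w -> equiC D adm n (fun i x => u i x * w i x).
Proof.
move=> ad am; elim: n u w => [|n IH] u w eu ew; split.
1,5: by move=> x; apply: am; [exact: (equiC_adm x eu)|exact: (equiC_adm x ew)].
1,4: move=> x; have [M hM] := equiC_bounded x eu; have [N hN] := equiC_bounded x ew;
  by exists (M * N) => i Di; rewrite normrM; apply: ler_pM => //; [exact: hM|exact: hN].
1,3: by move=> x e; exact: equiC_mul_cont eu ew.
- by [].
- move=> v; split.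
    by move=> i x; apply: derivableM; [exact: equiC_derivable eu|exact: equiC_derivable ew].
  rewrite (_ : (fun i => _) = (fun i x => u i x * 'D_v (w i) x + w i x * 'D_v (u i) x)).
    apply: equiC_add => //; apply: IH; [exact: equiCW|exact: equiC_derive| |exact: equiC_derive].
    exact: equiCW.
  by apply/funext => i; apply/funext => x; apply: deriveM;
    [exact: equiC_derivable eu|exact: equiC_derivable ew].
Qed.

Lemma equiC_cst n (a : I -> R) : adm a -> adm (fun=> 0) ->
  (exists M, forall i, D i -> `|a i| <= M) -> equiC D adm n (fun i (_ : V) => a i).
Proof.
elim: n a => [|n IH] a aa a0 [M hM]; (split; [by []|by exists M| |]).
- by move=> x e e0; near=> y => i Di; rewrite subrr normr0 ltW.
- by [].
- by move=> x e e0; near=> y => i Di; rewrite subrr normr0 ltW.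
- move=> v; split; first by move=> i x; exact: derivable_cst.
  rewrite (_ : (fun i => _) = (fun i (x : V) => 0)); last first.
    by apply/funext => i; apply/funext => x; exact: derive_cst.
  by apply: (IH (fun=> 0)) => //; exists 0 => i _; rewrite normr0.
Unshelve. all: by end_near. Qed.

End OneSpace.

(** Serves to add to the index a parameter that the family ignores, to view a single function as a
    constant family, and to extract one member of a family. *)
Lemma equiC_reindex (V : normedModType R) (I J : Type) (D : set I) (adm : set (I -> R))
    (D' : set J) (adm' : set (J -> R)) (r : J -> I) n (u : I -> V -> R) :
  (forall j, D' j -> D (r j)) -> (forall a, adm a -> adm' (a \o r)) ->
  equiC D adm n u -> equiC D' adm' n (u \o r).
Proof.
move=> hD ha; elim: n u => [|n IH] u eu; split.
1,5: by move=> x; exact: (ha _ (equiC_adm x eu)).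
1,4: by move=> x; have [M hM] := equiC_bounded x eu; exists M => j /hD; exact: hM.
1,3: by move=> x e e0; have := equiC_cont x eu e0; apply: filterS => y h j /hD; exact: h.
- by [].
- move=> v; split; first by move=> j x; exact: equiC_derivable eu.
  by apply: (IH (fun i => 'D_v (u i))); exact: equiC_derive.
Qed.

(** The first hypothesis says that [g] is affine with linear part [L], without asking for a bundled
    linear map; projections, coordinates and [base_point] are all of this form. Derivatives of the
    composite along [v] are derivatives of [u i] along [L v]. *)
Lemma equiC_affine (V V' : normedModType R) (I : Type) (D : set I) (adm : set (I -> R))
    (g L : V -> V') n (u : I -> V' -> R) :
  (forall (t : R) v x, g (t *: v + x) = t *: L v + g x) -> continuous g ->
  equiC D adm n u -> equiC D adm n (fun i x => u i (g x)).
Proof.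
move=> gL cg; elim: n u => [|n IH] u eu; split.
1,5: by move=> x; exact: (equiC_adm (g x) eu).
1,4: by move=> x; have [M hM] := equiC_bounded (g x) eu; exists M.
1,3: by move=> x e e0; have := equiC_cont (g x) eu e0; exact: (cg x).
- by [].
- have E i x v : (fun t : R => t^-1 *: (u i (g (t *: v + x)) - u i (g x))) =
      (fun t : R => t^-1 *: (u i (t *: L v + g x) - u i (g x) : R^o)).
    by apply/funext => t; rewrite gL.
  move=> v; split.
    move=> i x; rewrite /derivable /= E; exact: (equiC_derivable eu).
  rewrite (_ : (fun i => _) = (fun i x => 'D_(L v) (u i) (g x))).
    exact: (IH (fun i => 'D_(L v) (u i)) (equiC_derive (L v) eu)).
  by apply/funext => i; apply/funext => x; rewrite /derive /= E.
Qed.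

(** A difference quotient is a derivative at an intermediate point, and the derivatives are
    equicontinuous. The convergence is thus uniform in the index, which is what a bounded functional
    needs. *)
Lemma equiC_uniform_derive (V : normedModType R) (I : Type) (D : set I) (adm : set (I -> R))
    n (u : I -> V -> R) x v (e : R) : equiC D adm n.+1 u -> 0 < e ->
  \forall t \near 0^', forall i, D i ->
    `|t^-1 * (u i (t *: v + x) - u i x) - 'D_v (u i) x| <= e.
Proof.
move=> eu e0; have := equiC_cont x (equiC_derive v eu) e0.
move=> /nbhs_ballP[r /= r0 hr].
have rv : 0 < r / (`|v| + 1) by rewrite divr_gt0 // ltr_wpDl.
near=> t => i Di.
have t0 : t != 0 by near: t; exact: nbhs_dnbhs_neq.
have tr : `|t| < r / (`|v| + 1).
  by near: t; apply: (@dnbhs0_lt _ R^o).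
have [a /andP[a0 a1] ->] := @mvt_dir_scale R V (u i) x v t (fun y => equiC_derivable eu).
rewrite mulKf //; move: i Di; apply: hr.
rewrite -ball_normE /= opprD addrC subrK normrN normrZ.
apply: (@le_lt_trans _ _ (`|t| * (`|v| + 1))).
  apply: ler_pM => //; last by rewrite lerDl.
  by rewrite normrM ler_piMl // ger0_norm.
by rewrite -ltr_pdivlMr // ltr_wpDl.
Unshelve. all: by end_near. Qed.

End Families.

(** * Bounded functionals of the index *)

Section Functionals.
Context {R : realType}.

(** [adm] is the space on which [L] is linear, below the continuous functions of an angle or the
    bounded sequences; [D] is the set of indices that [L] sees, and bounds are asked for only
    there. *)
Record bounded_functional (I : Type) (D : set I) (adm : set (I -> R))
    (L : (I -> R) -> R) (C : R) : Prop := BoundedFunctional {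
  functional_admD : forall a b, adm a -> adm b -> adm (fun i => a i + b i);
  functional_admZ : forall c a, adm a -> adm (fun i => c * a i);
  functionalD : forall a b, adm a -> adm b -> L (fun i => a i + b i) = L a + L b;
  functionalZ : forall c a, adm a -> L (fun i => c * a i) = c * L a;
  functional_bound : forall a M, adm a -> (forall i, D i -> `|a i| <= M) -> `|L a| <= C * M }.

(** The functional acts on the second component of the index; the first is a parameter in which the
    estimates have to be uniform. *)
Definition pair_domain (J I : Type) (DJ : set J) (D : set I) : set (J * I) :=
  [set ji | DJ ji.1 /\ D ji.2].

Definition pair_adm (J I : Type) (adm : set (I -> R)) : set (J * I -> R) :=
  [set a | forall j, adm (fun i => a (j, i))].

Context {V : normedModType R} {I J : Type} {D : set I} {adm : set (I -> R)}
  {L : (I -> R) -> R} {C : R} (FL : bounded_functional D adm L C).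

Lemma functionalB a b : adm a -> adm b -> L (fun i => a i - b i) = L a - L b.
Proof.
move=> aa ab; rewrite (_ : (fun i => _) = (fun i => a i + (-1) * b i)); last first.
  by apply/funext => i; rewrite mulN1r.
by rewrite (functionalD FL) ?(functionalZ FL) ?mulN1r//; exact: (functional_admZ FL).
Qed.

Lemma functional_admB a b : adm a -> adm b -> adm (fun i => a i - b i).
Proof.
move=> aa ab; rewrite (_ : (fun i => _) = (fun i => a i + (-1) * b i)); last first.
  by apply/funext => i; rewrite mulN1r.
by apply: (functional_admD FL) => //; exact: (functional_admZ FL).
Qed.

Lemma functional_le a M : adm a -> 0 <= M -> (forall i, D i -> `|a i| <= M) ->
  `|L a| <= (`|C| + 1) * M.
Proof.
move=> aa M0 aM; apply: le_trans (functional_bound FL aa aM) _.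
by apply: ler_wpM2r => //; rewrite (le_trans (ler_norm _)) // lerDl.
Qed.

Lemma is_derive_functional (u : I -> V -> R) n x v : equiC D adm n.+1 u ->
  is_derive x v (fun x => L (u^~ x) : R^o) (L (fun i => 'D_v (u i) x)).
Proof.
move=> eu.
have cv : (fun t : R => t^-1 *: ((L (u^~ (t *: v + x)) : R^o) - L (u^~ x))) @ 0^'
    --> (L (fun i => 'D_v (u i) x) : R^o).
  apply/cvgrPdist_le => e e0.
  have C1 : 0 < `|C| + 1 by rewrite ltr_wpDl.
  have := equiC_uniform_derive x v eu (divr_gt0 e0 C1).
  apply: filterS => t ht; rewrite distrC.
  have ax y : adm (u^~ y) := equiC_adm y eu.
  have ad : adm (fun i => 'D_v (u i) x) := equiC_adm x (equiC_derive v eu).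
  rewrite /GRing.scale /= -functionalB // -(functionalZ FL); last exact: functional_admB.
  rewrite -functionalB //; last by apply: (functional_admZ FL); exact: functional_admB.
  apply: (@le_trans _ _ ((`|C| + 1) * (e / (`|C| + 1)))); last by rewrite mulrC mulfVK // gt_eqF.
  apply: functional_le => //; last by rewrite divr_ge0 // ltW.
  by apply: functional_admB => //; apply: (functional_admZ FL); exact: functional_admB.
by split; [apply/cvg_ex; exists (L (fun i => 'D_v (u i) x)) | exact: cvg_lim cv].
Qed.

(** The joint hypothesis gives estimates uniform in [j]. The hypothesis for each [j] gives
    differentiability, which [equiC] asks of all indices, not only of those in [DJ]. *)
Lemma equiC_functional (DJ : set J) n (u : J -> I -> V -> R) :
  equiC (pair_domain DJ D) (pair_adm adm) n (fun ji => u ji.1 ji.2) ->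
  (forall j, equiC D adm n (u j)) ->
  equiC DJ setT n (fun j x => L (fun i => u j i x)).
Proof.
elim: n u => [|n IH] u eu ej; split.
1,5: by [].
1,4: move=> x; have [M hM] := equiC_bounded x eu; exists ((`|C| + 1) * `|M|) => j Dj;
  apply: functional_le => //; [exact: (equiC_adm x eu)|];
  by move=> i Di; apply: (le_trans (hM (j, i) _)); [|exact: ler_norm].
1,3: move=> x e e0; have C1 : 0 < `|C| + 1 by [rewrite ltr_wpDl];
  have := equiC_cont x eu (divr_gt0 e0 C1); apply: filterS => y hy j Dj;
  rewrite -functionalB; [|exact: (equiC_adm y eu)|exact: (equiC_adm x eu)];
  (apply: (@le_trans _ _ ((`|C| + 1) * (e / (`|C| + 1)))); last by rewrite mulrC mulfVK // gt_eqF);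
  apply: functional_le; [apply: functional_admB; [exact: (equiC_adm y eu)|exact: (equiC_adm x eu)]
    |by rewrite divr_ge0 // ltW|by move=> i Di; exact: (hy (j, i))].
- by [].
- move=> v; split.
    by move=> j x; have [] := is_derive_functional x v (ej j).
  rewrite (_ : (fun j => _) = (fun j x => L (fun i => 'D_v (u j i) x))); last first.
    apply/funext => j; apply/funext => x.
    by have [_ ->] := is_derive_functional x v (ej j).
  apply: (IH (fun j i => 'D_v (u j i))); first exact: (equiC_derive v eu).
  by move=> j; exact: (equiC_derive v (ej j)).
Qed.

End Functionals.

(** * Differential calculus of functions of class C^k *)

Section Smooth.
Context {R : realType}.
Implicit Types V W : normedModType R.

(** A family with a single member is equicontinuous iff this member is continuous; so the rules
    proved for families yield those for C^n functions. *)
Lemma Ck_onE V n (f : V -> R) :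
  Ck_on n setT (f : V -> R^o) <-> equiC [set: unit] setT n (fun=> f).
Proof.
elim: n f => [|n IH] f; split.
- move=> [c _]; split => // x; first by exists `|f x|.
  by move=> e e0; have /cvgrPdist_le/(_ e e0) := c x I; apply: filterS => y h i _; rewrite distrC.
- move=> [_ _ c _]; split => // x _; apply/cvgrPdist_le => e e0.
  by apply: filterS (c x e e0) => y h; rewrite distrC; exact: (h tt).
- move=> [c d]; split => // [x|x e e0|v]; first by exists `|f x|.
  + by have /cvgrPdist_le/(_ e e0) := c x I; apply: filterS => y h i _; rewrite distrC.
  + by have [d1 /IH d2] := d v; split => // i x; exact: d1.
- move=> [_ _ c d]; split.
  + move=> x _; apply/cvgrPdist_le => e e0.
    by apply: filterS (c x e e0) => y h; rewrite distrC; exact: (h tt).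
  + by move=> v; have [d1 /IH d2] := d v; split => // x _; exact: (d1 tt).
Qed.

Lemma Ck_on_setTW V W n (f : V -> W) : Ck_on n.+1 setT f -> Ck_on n setT f.
Proof.
elim: n f => [|n IH] f [c d]; split => // v; have [d1 d2] := d v; split => //.
exact: IH.
Qed.

Lemma Ck_on_continuous V W n (f : V -> W) : Ck_on n setT f -> continuous f.
Proof. by case: n => [|n] [c _] x; exact: c. Qed.

Lemma Ck_on_derivable V W n (f : V -> W) x v : Ck_on n.+1 setT f -> derivable f x v.
Proof. by case=> _ /(_ v)[d _]; exact: d. Qed.

Lemma Ck_on_derive V W n (f : V -> W) v : Ck_on n.+1 setT f -> Ck_on n setT ('D_v f).
Proof. by case=> _ /(_ v)[]. Qed.

End Smooth.

Section Chain.
Context {R : realType}.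
Implicit Types V : normedModType R.

(** The mean value theorem yields intermediate points at unknown parameters in [0, 1]; whatever
    these are, the points tend to [x]. *)
Lemma cvg_scale_line V (x u v : V) (a b : R -> R) :
  (forall t, 0 <= a t <= 1) -> (forall t, 0 <= b t <= 1) ->
  ((a t * t) *: u + ((b t * t) *: v + x)) @[t --> 0^'] --> x.
Proof.
have H c : (forall t, 0 <= c t <= 1) -> (c t * t) @[t --> (0 : R)^'] --> (0 : R^o).
  move=> h; apply/cvgrPdist_le => e e0; near=> t.
  have /andP[c0 c1] := h t.
  rewrite sub0r normrN normrM (ger0_norm c0) (le_trans (ler_piMl _ c1)) //.
  by apply: ltW; near: t; apply: (@dnbhs0_lt _ R^o).
move=> ha hb; rewrite -[X in _ --> X]add0r -[X in _ --> _ + X]add0r.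
apply: cvgD; first by rewrite -(scale0r u); apply: cvgZr_tmp; exact: H.
apply: cvgD; last exact: cvg_cst.
by rewrite -(scale0r v); apply: cvgZr_tmp; exact: H.
Unshelve. all: by end_near. Qed.

Lemma continuous_cvg_dnbhs V (g : V -> R) (s : R -> V) (a : V) :
  continuous (g : V -> R^o) -> s @ 0^' --> a -> (fun t => g (s t) : R^o) @ 0^' --> (g a : R^o).
Proof. by move=> cg sa; apply: (@cvg_comp _ _ _ s (g : V -> R^o) _ (nbhs a)) => //; exact: cg. Qed.

Lemma cvg_dnbhs_unique (F G : R -> R) (a b : R) : (F : _ -> R^o) @ 0^' --> (a : R^o) ->
  (G : _ -> R^o) @ 0^' --> (b : R^o) -> (forall t, t != 0 -> F t = G t) -> a = b.
Proof.
move=> Fa Gb E; apply: (@cvg_unique R^o (@norm_hausdorff _ _) (F @ 0^')) => //.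
apply: cvg_trans Gb; apply: near_eq_cvg; near=> t; rewrite E //; near: t.
exact: nbhs_dnbhs_neq.
Unshelve. all: by end_near. Qed.

(** The increment along u + v is cut into a step along v from x and a step along u. The mean value
    theorem on the second, with the continuity of the derivative along u, gives the sum. *)
Lemma derive_dirD V (f : V -> R) x u v : Ck_on 1 setT (f : V -> R^o) ->
  'D_(u + v) f x = 'D_u f x + 'D_v f x.
Proof.
move=> cf.
have dV y w : derivable (f : V -> R^o) y w by exact: Ck_on_derivable cf.
have cD w : continuous ('D_w (f : V -> R^o)).
  by apply: (@Ck_on_continuous _ _ _ 0); exact: Ck_on_derive.
have /choice[a ha] (t : R) : exists a : R, 0 <= a <= 1 /\
    f (t *: u + (t *: v + x)) - f (t *: v + x) = t * 'D_u f ((a * t) *: u + (t *: v + x)).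
  by have [a a01 E] := @mvt_dir_scale R V f (t *: v + x) u t (dV ^~ u); exists a.
have c1 : (fun t : R => 'D_u f ((a t * t) *: u + ((1 * t) *: v + x)) : R^o) @ 0^' --> ('D_u f x : R^o).
  apply: (continuous_cvg_dnbhs (cD u)).
  apply: (cvg_scale_line _ _ _ ) => t; first by have [] := ha t.
  by rewrite ler01 lexx.
have c2 : (fun t : R => t^-1 *: (f (t *: v + x) - f x : R^o)) @ 0^' --> ('D_v f x : R^o).
  exact: (dV x v).
have c3 : (fun t : R => 'D_u f ((a t * t) *: u + ((1 * t) *: v + x)) +
    t^-1 *: (f (t *: v + x) - f x : R^o) : R^o) @ 0^' --> ('D_u f x + 'D_v f x : R^o).
  exact: cvgD c1 c2.
rewrite /derive; apply: cvg_lim => //; apply: cvg_trans c3; apply: near_eq_cvg; near=> t.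
have t0 : t != 0 by near: t; exact: nbhs_dnbhs_neq.
rewrite /= mul1r (_ : t *: (u + v) + x = t *: u + (t *: v + x)); last by rewrite scalerDr addrA.
have [_ E] := ha t.
by apply: (mulfI t0); rewrite /GRing.scale /= mulrDr !mulVKf // -E addrA subrK.
Unshelve. all: by end_near. Qed.

Lemma derive_row n (f : 'rV[R]_n -> R) x v : Ck_on 1 setT (f : _ -> R^o) ->
  'D_v f x = \sum_i v 0 i * 'D_(delta_mx 0 i) f x.
Proof.
move=> cf.
have dZ t w : 'D_(t *: w) f x = t * 'D_w f x.
  by have [_ ->] := @is_derive_scale R _ f x w t (Ck_on_derivable cf).
rewrite {1}(row_sum_delta v).
transitivity (\sum_i 'D_(v 0 i *: delta_mx 0 i) f x); last by apply: eq_bigr.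
apply: (big_morph (fun w => 'D_w f x)); last exact: derive0.
by move=> a b; exact: derive_dirD.
Qed.

(** With g(t0 + t) = g(t0) + t d(t) and d(t) tending to g'(t0), the mean value theorem is applied
    along the moving direction d(t). *)
Lemma is_derive_curve n (f : 'rV[R]_n -> R) (g : R -> 'rV[R]_n) (dg : 'rV[R]_n) (t0 : R) :
  Ck_on 1 setT (f : _ -> R^o) -> is_derive (t0 : R^o) (1 : R^o) (g : R^o -> _) dg ->
  is_derive (t0 : R^o) (1 : R^o) (fun t : R^o => f (g t) : R^o) ('D_dg f (g t0)).
Proof.
move=> cf [dg1 dg2].
have dV y w : derivable (f : _ -> R^o) y w by exact: Ck_on_derivable cf.
have cD w : continuous ('D_w (f : _ -> R^o)).
  by apply: (@Ck_on_continuous _ _ _ 0); exact: Ck_on_derive.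
pose d (t : R) := t^-1 *: (g (t + t0) - g t0).
have cd : d @ 0^' --> dg.
  move: dg1; rewrite /derivable => /cvg_ex[l hl].
  have E : (fun h : R => h^-1 *: ((g : R^o -> _) (h *: (1 : R^o) + t0) - g t0)) = d.
    by apply/funext => h; rewrite /d /GRing.scale /= mulr1.
  by rewrite -dg2 /derive; rewrite E in hl *; rewrite (cvg_lim _ hl).
have /choice[a ha] (t : R) : exists a : R, 0 <= a <= 1 /\
    f (t *: d t + g t0) - f (g t0) = t * 'D_(d t) f ((a * t) *: d t + g t0).
  by have [a a01 E] := @mvt_dir_scale R _ f (g t0) (d t) t (dV ^~ (d t)); exists a.
have cat : (a t * t) @[t --> (0 : R)^'] --> (0 : R^o).
  apply/cvgrPdist_le => e e0; near=> t.
  have [/andP[c0 c1] _] := ha t.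
  rewrite sub0r normrN normrM (ger0_norm c0) (le_trans (ler_piMl _ c1)) //.
  by apply: ltW; near: t; apply: (@dnbhs0_lt _ R^o).
have cy : ((a t * t) *: d t + g t0) @[t --> 0^'] --> g t0.
  rewrite -[X in _ --> X]add0r; apply: cvgD; last exact: cvg_cst.
  by rewrite -(scale0r dg); apply: cvgZ.
(* In coordinates only derivatives along fixed basis vectors occur, and these are continuous
   although the direction [d t] moves. *)
have cS : (\sum_i d t 0 i * 'D_(delta_mx 0 i) f ((a t * t) *: d t + g t0)) @[t --> (0 : R)^']
    --> (\sum_i dg 0 i * 'D_(delta_mx 0 i) f (g t0) : R^o).
  apply: (cvg_big (U := R^o) (op := +%R)); first exact: add_continuous.
  move=> i _; apply: (@cvgM R^o).
    by apply: (@continuous_cvg_dnbhs _ (fun M : 'rV[R]_n => M 0 i)) => //; exact: coord_continuous.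
  exact: (continuous_cvg_dnbhs (cD (delta_mx 0 i))).
have cv : (fun h : R => h^-1 *: ((f (g (h *: (1 : R^o) + t0)) : R^o) - f (g t0))) @ 0^'
   --> ('D_dg f (g t0) : R^o).
  rewrite derive_row //; apply: cvg_trans cS; apply: near_eq_cvg; near=> t.
  have t0n : t != 0 by near: t; exact: nbhs_dnbhs_neq.
  rewrite -derive_row // /GRing.scale /= mulr1.
  apply: (mulfI t0n); rewrite mulVKf //; have [_ <-] := ha t.
  by rewrite /d scalerA divff // scale1r subrK.
by split; [apply/cvg_ex; exists ('D_dg f (g t0)) | exact: cvg_lim cv].
Unshelve. all: by end_near. Qed.

Lemma is_derive_comp_row V n (f : 'rV[R]_n -> R) (g : V -> 'rV[R]_n) x v :
  Ck_on 1 setT (f : _ -> R^o) -> derivable g x v ->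
  is_derive x v (fun y => f (g y) : R^o) ('D_('D_v g x) f (g x)).
Proof.
move=> cf dg; apply: is_derive_alongP.
have d0 : is_derive (0 : R^o) (1 : R^o) (fun t : R^o => g (t *: v + x)) ('D_v g x).
  have E : x = 0 *: v + x by rewrite scale0r add0r.
  by rewrite [X in 'D_v g X]E; apply: is_derive_line; rewrite -E.
by have := is_derive_curve cf d0; rewrite scale0r add0r.
Qed.

(** The second difference of f over a parallelogram does not depend on the order of u and v; two
    applications of the mean value theorem in either order express it by the two mixed
    derivatives. *)
Lemma schwarz V (f : V -> R) x u v : Ck_on 2 setT (f : V -> R^o) ->
  'D_u ('D_v f) x = 'D_v ('D_u f) x.
Proof.
move=> cf.
have d1 y w : derivable (f : V -> R^o) y w by exact: Ck_on_derivable cf.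
have d2 y w z : derivable ('D_w (f : V -> R^o)) y z.
  exact: (Ck_on_derivable (Ck_on_derive w cf)).
have cD w z : continuous ('D_z ('D_w (f : V -> R^o))).
  exact: (Ck_on_continuous (Ck_on_derive z (Ck_on_derive w cf))).
have dsh (w z y : V) : is_derive y w (fun y => f (z + y) - f y : R^o) ('D_w f (z + y) - 'D_w f y).
  apply: is_deriveB; last exact: derivableP.
  have E : (fun h : R => h^-1 *: ((f (z + (h *: w + y)) : R^o) - f (z + y))) =
     (fun h : R => h^-1 *: ((f (h *: w + (z + y)) : R^o) - f (z + y))).
    by apply/funext => h; rewrite addrCA.
  have := derivableP (d1 (z + y) w); case=> e1 e2; split.
    by rewrite /derivable /= E.
  by rewrite /derive /= E.
have key (w z : V) : exists a b : R -> R, [/\ forall t, 0 <= a t <= 1, forall t, 0 <= b t <= 1 &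
   forall t, f (t *: w + (t *: z + x)) - f (t *: w + x) - f (t *: z + x) + f x =
     t * (t * 'D_w ('D_z f) ((b t * t) *: w + ((a t * t) *: z + x)))].
  have /choice[ab hab] (t : R) : exists ab : R * R, [/\ 0 <= ab.1 <= 1, 0 <= ab.2 <= 1 &
     f (t *: w + (t *: z + x)) - f (t *: w + x) - f (t *: z + x) + f x =
     t * (t * 'D_w ('D_z f) ((ab.2 * t) *: w + ((ab.1 * t) *: z + x)))].
    have [a a01 E] := @mvt_dir_scale R V (fun y => f (t *: w + y) - f y) x z t
       (fun y => @ex_derive _ _ _ _ _ _ _ (dsh z (t *: w) y)).
    have [b b01 F] := @mvt_dir_scale R V ('D_z f) ((a * t) *: z + x) w t (fun y => d2 y z w).
    exists (a, b); split => //=; rewrite -F.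
    have [_ <-] := dsh z (t *: w) ((a * t) *: z + x); rewrite -E.
    by ring.
  exists (fun t => (ab t).1), (fun t => (ab t).2).
  by split => t; have [] := hab t.
have [a [b [a1 b1 E1]]] := key u v; have [c [d [c1 e1 E2]]] := key v u.
have l1 : ('D_u ('D_v f) ((b t * t) *: u + ((a t * t) *: v + x)) : R^o) @[t --> 0^']
   --> ('D_u ('D_v f) x : R^o).
  by apply: (continuous_cvg_dnbhs (cD _ _)); exact: cvg_scale_line.
have l2 : ('D_v ('D_u f) ((d t * t) *: v + ((c t * t) *: u + x)) : R^o) @[t --> 0^']
   --> ('D_v ('D_u f) x : R^o).
  by apply: (continuous_cvg_dnbhs (cD _ _)); exact: cvg_scale_line.
apply: (cvg_dnbhs_unique l1 l2) => t t0.
apply: (mulfI t0); apply: (mulfI t0).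
apply: etrans (etrans (esym (E1 t)) _) (E2 t).
by rewrite [t *: v + (t *: u + x)]addrCA; ring.
Qed.

End Chain.

Section Calculus.
Context {R : realType}.
Implicit Types V W : normedModType R.

Lemma cvg_mx (T : Type) (F : set_system T) (FF : Filter F) m n (M : T -> 'M[R]_(m, n))
    (L : 'M[R]_(m, n)) :
  (forall i j, (M x i j : R^o) @[x --> F] --> (L i j : R^o)) -> M @ F --> L.
Proof.
move=> h; apply/cvgrPdist_le => e e0; near=> x.
rewrite /Num.Def.normr/= mx_normrE (bigmax_le _ (ltW e0))//= => i _.
rewrite !mxE/=; move: i; near: x; apply: filter_forall => -[i j] /=.
exact: ((cvgrPdist_le _ _).1 (h i j)).
Unshelve. all: by end_near. Qed.

Lemma Ck_on_mxP V m n k (M : V -> 'M[R]_(m, n)) :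
  Ck_on k setT M <-> forall i j, Ck_on k setT (fun x => M x i j : R^o).
Proof.
elim: k M => [|k IH] M; split.
- move=> [c _] i j; split => // x _.
  by apply: (@cvg_comp _ _ _ M (fun A : 'M[R]_(m, n) => A i j : R^o) _ (nbhs (M x)));
    [exact: c|exact: coord_continuous].
- by move=> h; split => // x _; apply: cvg_mx => i j; have [c _] := h i j; exact: c.
- move=> [c d] i j; split.
    move=> x _; apply: (@cvg_comp _ _ _ M (fun A : 'M[R]_(m, n) => A i j : R^o) _ (nbhs (M x)));
      [exact: c|exact: coord_continuous].
  move=> v; have [d1 d2] := d v; split.
    by move=> x Ux; have /derivable_mxP := d1 x Ux; exact.
  have /IH/(_ i j) := d2; congr Ck_on; apply/funext => x.
  by rewrite derive_mx ?mxE //; exact: d1.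
- move=> h; split.
    by move=> x _; apply: cvg_mx => i j; have [c _] := h i j; exact: c.
  move=> v.
  have dM x : derivable M x v.
    by apply/derivable_mxP => i j; exact: Ck_on_derivable (h i j).
  split; first by move=> x _; exact: dM.
  apply/IH => i j; rewrite (_ : (fun x => _) = 'D_v (fun x => M x i j : R^o)).
    exact: Ck_on_derive.
  by apply/funext => x; rewrite derive_mx // mxE.
Qed.

Lemma Ck_onD V n (f g : V -> R) : Ck_on n setT (f : V -> R^o) -> Ck_on n setT (g : V -> R^o) ->
  Ck_on n setT (fun x => f x + g x : R^o).
Proof. by move=> /Ck_onE ? /Ck_onE ?; apply/Ck_onE; exact: equiC_add. Qed.

Lemma Ck_onM V n (f g : V -> R) : Ck_on n setT (f : V -> R^o) -> Ck_on n setT (g : V -> R^o) ->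
  Ck_on n setT (fun x => f x * g x : R^o).
Proof. by move=> /Ck_onE ? /Ck_onE ?; apply/Ck_onE; exact: equiC_mul. Qed.

Lemma Ck_on_cst V n (a : R) : Ck_on n setT (fun _ : V => a : R^o).
Proof. by apply/Ck_onE; apply: (@equiC_cst _ V unit setT setT n (fun=> a)) => //; exists `|a|. Qed.

Lemma Ck_on_sum V n (I : Type) (r : seq I) (f : I -> V -> R) :
  (forall i, Ck_on n setT (f i : V -> R^o)) -> Ck_on n setT (fun x => \sum_(i <- r) f i x : R^o).
Proof.
move=> h; elim: r => [|i r IH].
  by rewrite (_ : (fun x => _) = fun=> 0); [exact: Ck_on_cst|apply/funext => x; rewrite big_nil].
rewrite (_ : (fun x => _) = fun x => f i x + \sum_(j <- r) f j x); first exact: Ck_onD.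
by apply/funext => x; rewrite big_cons.
Qed.

Lemma Ck_on_affine V V' n (g L : V -> V') (f : V' -> R) :
  (forall (t : R) v x, g (t *: v + x) = t *: L v + g x) -> continuous g ->
  Ck_on n setT (f : V' -> R^o) -> Ck_on n setT (fun x => f (g x) : R^o).
Proof. by move=> gL cg /Ck_onE cf; apply/Ck_onE; exact: (equiC_affine gL cg cf). Qed.

Lemma Ck_on_comp_row V n k (f : 'rV[R]_k -> R) (g : V -> 'rV[R]_k) :
  Ck_on n setT (f : _ -> R^o) -> (forall i, Ck_on n setT (fun x => g x 0 i : R^o)) ->
  Ck_on n setT (fun x => f (g x) : R^o).
Proof.
move=> cf cg; have cg' : Ck_on n setT g by apply/Ck_on_mxP => i j; rewrite ord1.
elim: n f cf cg cg' => [|n IH] f cf cg cg'.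
  split=> // x _; apply: (@cvg_comp _ _ _ g (f : _ -> R^o) _ (nbhs (g x))).
    exact: (Ck_on_continuous cg').
  exact: (Ck_on_continuous cf).
split.
  move=> x _; apply: (@cvg_comp _ _ _ g (f : _ -> R^o) _ (nbhs (g x))).
    exact: (Ck_on_continuous cg').
  exact: (Ck_on_continuous cf).
have c1f : Ck_on 1 setT (f : _ -> R^o).
  by elim: (n) cf => // m IHm /Ck_on_setTW.
move=> v; have dg x : derivable g x v := Ck_on_derivable cg'.
split; first by move=> x _; have [] := is_derive_comp_row c1f (dg x).
rewrite (_ : 'D_v _ =
   fun x => \sum_i 'D_v (fun y => g y 0 i : R^o) x * 'D_(delta_mx 0 i) f (g x)); last first.
  apply/funext => x; have [_ ->] := is_derive_comp_row c1f (dg x).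
  by rewrite derive_row //; apply: eq_bigr => i _; rewrite derive_mx // mxE.
apply: Ck_on_sum => i; apply: Ck_onM; first exact: Ck_on_derive.
apply: (IH ('D_(delta_mx 0 i) f)); first exact: Ck_on_derive.
  by move=> j; exact: Ck_on_setTW.
exact: Ck_on_setTW.
Qed.

Lemma Ck_onV V n (f : V -> R) : (forall x, f x != 0) -> Ck_on n setT (f : V -> R^o) ->
  Ck_on n setT (fun x => (f x)^-1 : R^o).
Proof.
move=> f0; elim: n => [|n IH] cf.
  by split => // x _; apply: (@cvgV R^o) => //; exact: (Ck_on_continuous cf).
split; first by move=> x _; apply: (@cvgV R^o) => //; exact: (Ck_on_continuous cf).
move=> v; have df x : derivable (f : V -> R^o) x v := Ck_on_derivable cf.
split; first by move=> x _; exact: derivableV.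
rewrite (_ : 'D_v _ = fun x => (- 1) * (((f x)^-1 * (f x)^-1) * 'D_v f x)).
  have h := IH (Ck_on_setTW cf).
  by apply: Ck_onM; [exact: Ck_on_cst|apply: Ck_onM; [exact: Ck_onM|exact: Ck_on_derive]].
apply/funext => x; rewrite [LHS](@deriveV _ _ f x v) //.
by rewrite /GRing.scale /= mulN1r mulNr -exprVn expr2.
Qed.

(** Derivatives are computed by the rules below and then fitted with this lemma to the wanted
    function and value, usually by a ring identity. *)
Lemma is_derive_cast V W (f g : V -> W) x v (d d' : W) :
  is_derive x v f d -> (forall y, f y = g y) -> d = d' -> is_derive x v g d'.
Proof. by move=> h /funext <- <-. Qed.

Lemma is_derive_comp1 V (f : R -> R) (g : V -> R) x v (a b : R) :
  is_derive (g x : R^o) (1 : R^o) (f : R^o -> R^o) a -> is_derive x v (g : V -> R^o) b ->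
  is_derive x v (fun y => f (g y) : R^o) (a * b).
Proof.
move=> fa [gb1 gb2]; apply: is_derive_alongP.
have E : 0 *: v + x = x by rewrite scale0r add0r.
have d0 : is_derive (0 : R^o) (1 : R^o) (fun t : R^o => g (t *: v + x) : R^o) b.
  by have := @is_derive_line _ _ _ (g : V -> R^o) x v 0; rewrite E gb2; apply.
by apply: (@is_derive1_comp R f (fun t => g (t *: v + x))); rewrite E.
Qed.

Lemma is_derive_linear V (g L : V -> R) x v :
  (forall t : R, g (t *: v + x) = t * L v + g x) -> is_derive x v (g : V -> R^o) (L v).
Proof.
move=> gL.
have cv : (fun t : R => t^-1 *: ((g (t *: v + x) : R^o) - g x)) @ 0^' --> (L v : R^o).
  have c : (fun _ : R => L v : R^o) @ 0^' --> (L v : R^o) by exact: cvg_cst.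
  apply: cvg_trans c; apply: near_eq_cvg; near=> t.
  rewrite gL addrK /GRing.scale /= mulKf //.
  by near: t; exact: nbhs_dnbhs_neq.
by split; [apply/cvg_ex; exists (L v)|exact: cvg_lim cv].
Unshelve. all: by end_near. Qed.

Lemma is_derive_coord m n (M N : 'M[R]_(m, n)) i j :
  is_derive M N (fun A : 'M[R]_(m, n) => A i j : R^o) (N i j).
Proof. by apply: (@is_derive_linear _ _ (fun N : 'M[R]_(m, n) => N i j)) => t; rewrite !mxE. Qed.

Section PointwiseRules.
Context {V : normedModType R} {x v : V} {f g : V -> R} {a b : R}.
Hypotheses (df : is_derive x v (f : V -> R^o) a) (dg : is_derive x v (g : V -> R^o) b).

Lemma isdD : is_derive x v (fun y => f y + g y : R^o) (a + b).
Proof. exact: is_deriveD. Qed.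

Lemma isdM : is_derive x v (fun y => f y * g y : R^o) (f x * b + g x * a).
Proof. exact: is_deriveM. Qed.

Lemma isdN : is_derive x v (fun y => - f y : R^o) (- a).
Proof. exact: is_deriveN. Qed.

Lemma isdB : is_derive x v (fun y => f y - g y : R^o) (a - b).
Proof. exact: is_deriveB. Qed.

Lemma isdZ c : is_derive x v (fun y => c * f y : R^o) (c * a).
Proof. exact: is_deriveZ. Qed.

Lemma isdV : f x != 0 -> is_derive x v (fun y => (f y)^-1 : R^o) (- (f x) ^- 2 * a).
Proof.
move=> f0; have [d1 d2] := df; split; first exact: derivableV.
by have := @deriveV _ _ f x v f0 d1; rewrite d2.
Qed.

End PointwiseRules.

Lemma isd_cst V (x v : V) (c : R) : is_derive x v (fun=> c : R^o) 0.
Proof. exact: is_derive_cst. Qed.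

Definition smooth V (f : V -> R) : Prop := smooth_on setT (f : V -> R^o).

Lemma smoothD V (f g : V -> R) : smooth f -> smooth g -> smooth (fun x => f x + g x).
Proof. by move=> hf hg k; apply: Ck_onD; [exact: hf|exact: hg]. Qed.

Lemma smoothM V (f g : V -> R) : smooth f -> smooth g -> smooth (fun x => f x * g x).
Proof. by move=> hf hg k; apply: Ck_onM; [exact: hf|exact: hg]. Qed.

Lemma smooth_cst V (a : R) : smooth (fun _ : V => a).
Proof. by move=> k; exact: Ck_on_cst. Qed.

Lemma smoothN V (f : V -> R) : smooth f -> smooth (fun x => - f x).
Proof.
move=> hf; rewrite (_ : (fun x => _) = (fun x => (- 1) * f x)).
  by apply: smoothM => //; exact: smooth_cst.
by apply/funext => x; rewrite mulN1r.
Qed.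

Lemma smoothB V (f g : V -> R) : smooth f -> smooth g -> smooth (fun x => f x - g x).
Proof. by move=> hf hg; apply: smoothD => //; exact: smoothN. Qed.

Lemma smooth_sum V (I : Type) (r : seq I) (f : I -> V -> R) :
  (forall i, smooth (f i)) -> smooth (fun x => \sum_(i <- r) f i x).
Proof. by move=> hf k; apply: Ck_on_sum => i; exact: hf. Qed.

Lemma smoothV V (f : V -> R) : (forall x, f x != 0) -> smooth f -> smooth (fun x => (f x)^-1).
Proof. by move=> f0 hf k; exact: Ck_onV. Qed.

Lemma smooth_affine V V' (g L : V -> V') (f : V' -> R) :
  (forall (t : R) v x, g (t *: v + x) = t *: L v + g x) -> continuous g ->
  smooth f -> smooth (fun x => f (g x)).
Proof. by move=> gL cg hf k; exact: (Ck_on_affine gL cg (hf k)). Qed.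

Lemma smooth_comp_row V k (f : 'rV[R]_k -> R) (g : V -> 'rV[R]_k) :
  smooth f -> (forall i, smooth (fun x => g x 0 i)) -> smooth (fun x => f (g x)).
Proof. by move=> hf hg n; apply: Ck_on_comp_row => // i; exact: hg. Qed.

Lemma smooth_mxP V m n (M : V -> 'M[R]_(m, n)) :
  smooth_on setT M <-> forall i j, smooth (fun x => M x i j).
Proof.
split=> [h i j k|h k]; first by have /Ck_on_mxP/(_ i j) := h k.
by apply/Ck_on_mxP => i j; exact: h.
Qed.

Lemma smooth_derive V (f : V -> R) v : smooth f -> smooth ('D_v f).
Proof. by move=> h k; exact: (Ck_on_derive v (h k.+1)). Qed.

Lemma smooth_derivable V (f : V -> R) x v : smooth f -> derivable (f : V -> R^o) x v.
Proof. by move=> h; exact: (Ck_on_derivable (h 1%N)). Qed.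

Lemma smooth_is_derive V (f : V -> R) x v : smooth f -> is_derive x v (f : V -> R^o) ('D_v f x).
Proof. by move=> h; apply: derivableP; exact: smooth_derivable. Qed.

Lemma smooth_continuous V (f : V -> R) : smooth f -> continuous (f : V -> R^o).
Proof. by move=> h; exact: (Ck_on_continuous (h 0%N)). Qed.

Lemma smooth_id : smooth (fun x : R^o => x).
Proof.
move=> [|k]; first by split => // x _.
split=> [x _ //|v]; split; first by move=> x _; exact: derivable_id.
rewrite (_ : 'D_v _ = fun=> v); first exact: Ck_on_cst.
by apply/funext => x; exact: derive_id.
Qed.

Lemma smooth_coord m n (i : 'I_m) (j : 'I_n) : smooth (fun M : 'M[R]_(m, n) => M i j).
Proof.
apply: (@smooth_affine _ R^o (fun M : 'M[R]_(m, n) => M i j : R^o) (fun M => M i j : R^o) id).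
- by move=> t v x; rewrite !mxE.
- exact: coord_continuous.
- exact: smooth_id.
Qed.

Lemma smooth_comp1 V (f : R -> R) (g : V -> R) :
  smooth (f : R^o -> R) -> smooth g -> smooth (fun x => f (g x)).
Proof.
move=> hf hg.
(* A real variable is viewed as a row with one entry, for which the chain rule is available. *)
have h1 : smooth (fun r : 'rV[R]_1 => f (r 0 0)).
  apply: (@smooth_affine _ R^o (fun r : 'rV[R]_1 => r 0 0 : R^o) (fun r => r 0 0 : R^o)) => //.
    by move=> t v x; rewrite !mxE.
  exact: coord_continuous.
have := @smooth_comp_row V 1 _ (fun x => \row_(i < 1) g x) h1.
rewrite (_ : (fun x => _ (_ 0 0)) = fun x => f (g x)); last by apply/funext => x; rewrite mxE.
apply => i; rewrite (_ : (fun x => _) = g) //.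
by apply/funext => x; rewrite mxE.
Qed.

End Calculus.

(** * Smooth cutoffs of the powers of w *)

Section FlatFunction.
Context {R : realType}.
Implicit Types (k : nat) (x : R).

(** The classical flat function e^(-1/x), multiplied by x^(-k) so that the derivatives remain in the
    span of the family. *)
Definition flat k x : R := if 0 < x then x ^- k * expR (- x^-1) else 0.

Lemma flat_ge0 k x : 0 <= flat k x.
Proof. by rewrite /flat; case: ltP => // x0; rewrite mulr_ge0 ?expR_ge0 // invr_ge0 exprn_ge0 // ltW. Qed.

Lemma flat_gt0 k x : 0 < x -> 0 < flat k x.
Proof. by move=> x0; rewrite /flat x0 mulr_gt0 ?expR_gt0 // invr_gt0 exprn_gt0. Qed.

Lemma flat_le0 k x : x <= 0 -> flat k x = 0.
Proof. by move=> x0; rewrite /flat ltNge x0. Qed.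

(** From e^(1/x) = (e^a)^(k+1) with a = 1 / ((k+1) x) and e^a >= a. The linear bound makes the whole
    family continuous and differentiable at 0. *)
Lemma flat_bound k x : flat k x <= k.+1%:R ^+ k.+1 * `|x|.
Proof.
rewrite /flat; case: ltP => [x0|_]; last by rewrite mulr_ge0 // exprn_ge0.
have K0 : 0 < k.+1%:R :> R by rewrite ltr0n.
have E : (x^-1 / k.+1%:R) ^+ k.+1 <= expR x^-1.
  set a := x^-1 / _; have -> : x^-1 = k.+1%:R * a by rewrite mulrC divfK // gt_eqF.
  rewrite expRM_natl; apply: lerXn2r; rewrite ?nnegrE ?expR_ge0 ?divr_ge0 ?invr_ge0 ?ltW //.
  by apply: lt_le_trans (expR_ge1Dx _); rewrite ltrDr.
rewrite (gtr0_norm x0) expRN ler_pdivrMr ?expR_gt0 //.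
rewrite (_ : x ^- k = k.+1%:R ^+ k.+1 * x * (x^-1 / k.+1%:R) ^+ k.+1); last first.
  by rewrite expr_div_n exprVn (exprS x); field; rewrite gt_eqF ?ltr0n // !expf_neq0 ?gt_eqF.
by apply: ler_wpM2l => //; rewrite mulr_ge0 ?exprn_ge0 // ltW.
Qed.

Lemma is_derive_flat k x :
  is_derive (x : R^o) (1 : R^o) (flat k : R^o -> R^o) (flat k.+2 x - k%:R * flat k.+1 x).
Proof.
have [x0|x0|->] := ltgtP x 0.
- apply: (@near_eq_is_derive _ _ _ (cst 0 : R^o -> R^o)).
  + near=> y; rewrite flat_le0 //; apply: ltW; near: y; exact: lt_nbhsl.
  + by rewrite !flat_le0 ?ltW // mulr0 subr0; exact: is_derive_cst.
- apply: (@near_eq_is_derive _ _ _ (fun y : R^o => y ^- k * expR (- y^-1) : R^o)).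
  + by near=> y; rewrite /flat ifT //; near: y; exact: lt_nbhsr.
  + have xn : x != 0 by rewrite gt_eqF.
    have d1 : is_derive (x : R^o) (1 : R^o) (fun y : R => y^-1) (- x ^- 2).
      have := @is_deriveV R id x (1 : R^o) 1 xn (is_derive_id _ _).
      by rewrite /GRing.scale /= mulr1.
    have d2 : is_derive (x : R^o) (1 : R^o) (fun y : R => (y^-1) ^+ k) (- (k%:R * x^-1 ^+ k.+1)).
      have := @is_deriveX _ _ (fun y : R^o => y^-1) k x (1 : R^o) _ d1.
      move/is_derive_cast; apply.
        by move=> y; elim: (k) => [|j IH]; rewrite ?expr0 // !exprS -IH.
      rewrite /GRing.scale /=; case: (k) => [|j]; first by rewrite !mul0r oppr0.
      by rewrite succnK -exprVn mulrN -mulrA -exprD addn2.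
    have d3 : is_derive (x : R^o) (1 : R^o) (fun y : R => expR (- y^-1)) (x ^- 2 * expR (- x^-1)).
      have d4 : is_derive (x : R^o) (1 : R^o) (fun y : R => - y^-1) (x ^- 2).
        by have := is_deriveN d1; rewrite opprK.
      rewrite mulrC; exact: (@is_derive_comp1 _ R^o expR (fun y => - y^-1) _ _ _ _ (is_derive_expR _) d4).
    have /is_derive_cast := is_deriveM d2 d3; apply; first by move=> y /=; rewrite -exprVn.
    rewrite /flat x0 -!exprVn [LHS]/(_ ^+ _ * (_ ^+ _ * _) + _ * - (_ * _)) mulrA -exprD addn2.
    by congr (_ + _); rewrite mulrN; congr (- _); rewrite mulrCA; congr (_ * _); rewrite mulrC.
- rewrite !flat_le0 // mulr0 subr0.
  suff cv : (fun h : R => h^-1 *: ((flat k : R^o -> R^o) (h *: (1 : R^o) + 0) - flat k 0)) @ 0^'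
      --> (0 : R^o).
    by split; [apply/cvg_ex; exists 0|exact: cvg_lim cv].
  apply/cvgrPdist_le => e e0.
  have K0 : 0 < k.+2%:R ^+ k.+2 :> R by rewrite exprn_gt0 // ltr0n.
  near=> h; rewrite sub0r normrN addr0 [flat k 0]flat_le0 // subr0 /GRing.scale /= mulr1.
  have h0 : h != 0 by near: h; exact: nbhs_dnbhs_neq.
  (* The difference quotient at 0 is again a member of the family, hence small by [flat_bound]. *)
  have -> : h^-1 * flat k h = flat k.+1 h.
    rewrite /flat; case: ltP => _; last by rewrite mulr0.
    by rewrite -!exprVn exprS mulrA.
  rewrite (ger0_norm (flat_ge0 _ _)); apply: le_trans (flat_bound _ _) _.
  rewrite -ler_pdivlMl // mulrC; apply: ltW; near: h.
  by apply: (@dnbhs0_lt _ R^o); rewrite divr_gt0.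
Unshelve. all: by end_near. Qed.

Lemma smooth_flat k : smooth (flat k : R^o -> R).
Proof.
have cf j : continuous (flat j : R^o -> R^o).
  move=> x; apply: differentiable_continuous; apply/derivable1_diffP.
  by have [] := is_derive_flat j x.
move=> n; elim: n k => [|n IH] k; first by split => // x _; exact: cf.
split => [x _|v]; first exact: cf.
have d x : is_derive x v (flat k : R^o -> R^o) (v * (flat k.+2 x - k%:R * flat k.+1 x)).
  have := is_derive_flat k x => -[d1 d2].
  by have := is_derive_scale v d1; rewrite d2 /GRing.scale /= mulr1.
split; first by move=> x _; have [] := d x.
rewrite (_ : 'D_v _ = fun x => v * (flat k.+2 x + (- k%:R) * flat k.+1 x)).
  apply: Ck_onM; first exact: Ck_on_cst.
  by apply: Ck_onD; [exact: IH|apply: Ck_onM; [exact: Ck_on_cst|exact: IH]].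
by apply/funext => x; have [_ ->] := d x; rewrite mulNr.
Qed.

Definition cutoff (y : R) : R := flat 0 (1 - y) / (flat 0 (1 - y) + flat 0 y).

Lemma cutoff_denominator_gt0 y : 0 < flat 0 (1 - y) + flat 0 y.
Proof.
have [y1|y1] := ltP y 1; first by rewrite ltr_pwDl ?flat_ge0 // flat_gt0 // subr_gt0.
by rewrite ltr_wpDl ?flat_ge0 // flat_gt0 // (lt_le_trans ltr01).
Qed.

Lemma cutoff_left y : y <= 0 -> cutoff y = 1.
Proof.
move=> y0; rewrite /cutoff [flat 0 y]flat_le0 // addr0 divff // gt_eqF // flat_gt0 //.
by rewrite subr_gt0 (le_lt_trans y0).
Qed.

Lemma cutoff_right y : 1 <= y -> cutoff y = 0.
Proof. by move=> y1; rewrite /cutoff flat_le0 ?mul0r // subr_le0. Qed.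

Lemma smooth_cutoff : smooth (cutoff : R^o -> R).
Proof.
have s1 : smooth (fun y : R^o => flat 0 (1 - y)).
  apply: (@smooth_comp1 _ _ (flat 0) (fun y : R^o => 1 - y)); first exact: smooth_flat.
  by apply: smoothB; [exact: smooth_cst|exact: smooth_id].
apply: smoothM => //; apply: smoothV => [y|]; first by rewrite gt_eqF // cutoff_denominator_gt0.
by apply: smoothD => //; exact: smooth_flat.
Qed.

Definition cutoffn (m : nat) : R -> R := iter m (fun f : R -> R => 'D_(1 : R^o) (f : R^o -> R^o)) cutoff.

Lemma smooth_cutoffn m : smooth (cutoffn m : R^o -> R).
Proof. by elim: m => [|m IH]; [exact: smooth_cutoff|exact: (smooth_derive (1 : R^o) IH)]. Qed.

Lemma is_derive_cutoffn m y :
  is_derive (y : R^o) (1 : R^o) (cutoffn m : R^o -> R^o) (cutoffn m.+1 y).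
Proof. exact: (smooth_is_derive y 1 (@smooth_cutoffn m)). Qed.

Lemma cutoffn_left m y : y < 0 -> cutoffn m.+1 y = 0.
Proof.
move=> y0.
have H j z : z < 0 -> cutoffn j z = (j == 0)%:R.
  elim: j z => [|j IH] z z0; first by rewrite /cutoffn /= cutoff_left // ltW.
  have [_ <-] := is_derive_cutoffn j z.
  have [|_ ->] := @near_eq_is_derive _ _ _ (cst ((j == 0)%:R : R^o)) (cutoffn j : R^o -> R^o) z
    (1 : R^o) 0 _ (is_derive_cst _ _ _) => //.
  by near=> x; rewrite IH //; near: x; exact: lt_nbhsl.
by rewrite H.
Unshelve. all: by end_near. Qed.

Lemma cutoffn_right m y : 1 < y -> cutoffn m y = 0.
Proof.
elim: m y => [|m IH] y y1; first by rewrite /cutoffn /= cutoff_right // ltW.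
have [_ <-] := is_derive_cutoffn m y.
have [|_ ->] := @near_eq_is_derive _ _ _ (cst (0 : R^o)) (cutoffn m : R^o -> R^o) y
    (1 : R^o) 0 _ (is_derive_cst _ _ _) => //.
by near=> x; rewrite IH //; near: x; exact: lt_nbhsr.
Unshelve. all: by end_near. Qed.

Lemma cutoffn_bounded m : exists2 B, 0 < B & forall y, `|cutoffn m y| <= B.
Proof.
have c : {within `[0, 1], continuous (cutoffn m)}.
  by apply: continuous_subspaceT => x; exact: (smooth_continuous (@smooth_cutoffn m)).
have [M _ hM] := EVT_max ler01 c; have [N _ hN] := EVT_min ler01 c.
exists (`|cutoffn m M| + `|cutoffn m N| + 1) => [|y]; first by rewrite ltr_wpDl // addr_ge0.
have [y0|y0] := ltP y 0.
  case: m c M hM N hN => [|m] c M hM N hN; last by rewrite cutoffn_left // normr0 !addr_ge0.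
  by rewrite /cutoffn /= (cutoff_left (ltW y0)) normr1 lerDr addr_ge0.
have [y1|y1] := ltP 1 y; first by rewrite cutoffn_right // normr0 !addr_ge0.
have y01 : y \in `[0, 1] by rewrite in_itv /= y0 y1.
have := hM _ y01; have := hN _ y01; move: (cutoffn m) => f h1 h2.
rewrite ler_norml; apply/andP; split.
  have := ler_norm (- f N); rewrite normrN => h3; have := normr_ge0 (f M); lra.
by have := ler_norm (f M); have := normr_ge0 (f N); lra.
Qed.

End FlatFunction.

Section CutoffPowers.
Context {R : realType}.
Implicit Types (c z : R[i]) (k l m : nat).

Definition plane (w : 'rV[R]_2) : R[i] := w 0 0 +i* w 0 1.

(** The squared modulus as a real number: the norm [|z|] has values in [R[i]]. As a polynomial in
    the coordinates it is also smooth at 0. *)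
Definition sqnorm z : R := complex.Re z ^+ 2 + complex.Im z ^+ 2.

Lemma sqnorm_ge0 z : 0 <= sqnorm z.
Proof. by rewrite addr_ge0 // sqr_ge0. Qed.

Lemma sqnormM z1 z2 : sqnorm (z1 * z2) = sqnorm z1 * sqnorm z2.
Proof. by case: z1 => a b; case: z2 => u v; rewrite /sqnorm /=; ring. Qed.

Lemma sqnormX z k : sqnorm (z ^+ k) = sqnorm z ^+ k.
Proof.
elim: k => [|k IH]; last by rewrite !exprS sqnormM IH.
by rewrite /sqnorm /= expr1n expr0n addr0 expr0.
Qed.

Lemma Re_le_sqnorm z : `|complex.Re z| <= sqnorm z + 1.
Proof.
have := sqr_ge0 (complex.Im z); have := sqr_ge0 (`|complex.Re z| - 1).
rewrite /sqnorm sqrrB real_normK ?num_real // expr1n mulr1 => h1 h2.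
have := normr_ge0 (complex.Re z); have := sqr_ge0 (complex.Re z); lra.
Qed.

Lemma is_derive_Re_pow c k (w v : 'rV[R]_2) :
  is_derive w v (fun w => complex.Re (c * plane w ^+ k) : R^o)
    (k%:R * complex.Re (c * plane v * plane w ^+ k.-1)).
Proof.
have dc i := is_derive_coord w v 0 i.
elim: k c => [|k IH] c.
  have /is_derive_cast := is_derive_cst (complex.Re c : R^o) w v.
  apply => [y|].
    by rewrite expr0 mulr1.
  by rewrite mul0r.
have := isdD (isdM (dc 0) (IH c)) (isdM (dc 1) (IH (c * 'i))).
move/is_derive_cast; apply => [y|].
  rewrite exprS; move: (plane y ^+ k) => z; rewrite /plane.
  by case: z => a b; case: (c) => u1 u2 /=; ring.
rewrite succnK.
(* The truncated predecessor is harmless: for k = 0 the factor [k%:R] kills the term. *)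
have E : plane w ^+ k = plane w ^+ k.-1 * plane w \/ k = 0%N.
  by case: (k) => [|j]; [right|left; rewrite exprSr].
case: E => [->|->].
  move: (plane w ^+ k.-1) => z; rewrite /plane mulrS.
  by case: z => a b; case: (c) => u1 u2 /=; ring.
by rewrite !expr0 /plane; case: (c) => u1 u2 /=; ring.
Qed.

(** [l] and [m] count the derivatives that have fallen on the power and on the cutoff, which closes
    the family under differentiation up to coefficients of order k. For k = 0 the cutoff is
    evaluated at 0, where it equals 1. *)
Definition cutpow c l m k (w : 'rV[R]_2) : R :=
  complex.Re (c * plane w ^+ (k - l)) * cutoffn m (k%:R * (sqnorm (plane w) - 1)).

Lemma is_derive_cutpow c l m k (w v : 'rV[R]_2) :
  is_derive w v (cutpow c l m k : _ -> R^o)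
    ((k - l)%:R * cutpow (c * plane v) l.+1 m k w +
     k%:R * (2 * (w 0 0 * v 0 0 + w 0 1 * v 0 1) * cutpow c l m.+1 k w)).
Proof.
have dc i := is_derive_coord w v 0 i.
have dq : is_derive w v (fun w => k%:R * (sqnorm (plane w) - 1) : R^o)
    (k%:R * (2 * (w 0 0 * v 0 0 + w 0 1 * v 0 1))).
  have := isdZ (isdB (isdD (isdM (dc 0) (dc 0)) (isdM (dc 1) (dc 1))) (isd_cst w v 1)) k%:R.
  by move/is_derive_cast; apply => [y|]; rewrite /sqnorm /plane /=; ring.
have d1 := is_derive_comp1 (@is_derive_cutoffn R m _) dq.
have := isdM (is_derive_Re_pow c (k - l) w v) d1.
move/is_derive_cast; apply => //.
by rewrite /cutpow subnS; ring.
Qed.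

(** Where the cutoff can be nonzero, |w|^2 <= 1 + 1/k, and then |w|^(2(k - l)) <= (1 + 1/k)^k <= e,
    independently of k. *)
Lemma cutpow_bounded c l m : exists2 B, 0 < B & forall k w, `|cutpow c l m k w| <= B.
Proof.
have [B B0 hB] := @cutoffn_bounded R m.
exists ((sqnorm c * expR 1 + 1) * B) => [|k w].
  by rewrite mulr_gt0 // ltr_wpDl // mulr_ge0 ?sqnorm_ge0 ?expR_ge0.
rewrite /cutpow normrM.
have [kq|kq] := ltP 1 (k%:R * (sqnorm (plane w) - 1)).
  by rewrite cutoffn_right // normr0 mulr0 mulr_ge0 ?addr_ge0 ?mulr_ge0 ?sqnorm_ge0 ?expR_ge0 // ltW.
apply: ler_pM => //; apply: le_trans (Re_le_sqnorm _) _; rewrite lerD2r sqnormM.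
apply: ler_wpM2l; rewrite ?sqnorm_ge0 // sqnormX.
case: k kq => [|k] kq; first by rewrite expr0 -[leLHS]addr0 (le_trans _ (expR_ge1Dx _)) // lerD2l.
have K0 : 0 < k.+1%:R :> R by rewrite ltr0n.
have q1 : sqnorm (plane w) <= 1 + k.+1%:R^-1.
  by rewrite -lerBlDl -[leRHS]mulr1 ler_pdivlMl.
apply: (@le_trans _ _ ((1 + k.+1%:R^-1) ^+ (k.+1 - l))).
  by apply: lerXn2r; rewrite ?nnegrE ?sqnorm_ge0 // addr_ge0.
apply: (@le_trans _ _ ((1 + k.+1%:R^-1) ^+ k.+1)).
  by apply: ler_weXn2l; rewrite ?leq_subr // lerDl.
rewrite -[X in expR X](@divff _ k.+1%:R) ?gt_eqF // expRM_natl.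
by apply: lerXn2r; rewrite ?nnegrE ?expR_ge0 ?addr_ge0 // expR_ge1Dx.
Qed.

End CutoffPowers.

Section CutoffPowerFamilies.
Context {R : realType}.

(** Beyond some index K all members are below e/2 in absolute value; the finitely many others are
    continuous one by one. *)
Lemma equiC_decay (V : normedModType R) (u : nat -> V -> R) (B : R) :
  (forall k, continuous (u k : V -> R^o)) -> (forall k x, `|u k x| <= B / k.+1%:R) ->
  equiC setT setT 0 u.
Proof.
move=> cu uB; have B0 : 0 <= B by have := uB 0%N 0; rewrite divr1; apply: le_trans.
split => //; first by move=> x; exists B => k _; apply: le_trans (uB k x) _;
  rewrite ler_pdivrMr ?ltr0n // ler_peMr // ler1n.
move=> x e e0.
pose K := Num.bound (2 * B / e).
have KB k : (K <= k)%N -> B / k.+1%:R <= e / 2.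
  move=> Kk; rewrite ler_pdivrMr ?ltr0n // -ler_pdivrMl ?divr_gt0 //.
  rewrite (_ : _ * B = 2 * B / e); last by field; rewrite gt_eqF.
  have := archi_boundP (divr_ge0 (mulr_ge0 (ler0n R 2) B0) (ltW e0)).
  rewrite -/K => /ltW h; apply: le_trans h _; by rewrite ler_nat ltnW // ltnS.
have cK : \forall y \near x, forall k : 'I_K, `|u k y - u k x| <= e.
  apply: filter_forall => k; have /cvgrPdist_le/(_ e e0) := cu k x.
  by apply: filterS => y; rewrite distrC.
near=> y => k _.
have [kK|Kk] := ltnP k K; last first.
  apply: le_trans (ler_normB _ _) _; rewrite (splitr e).
  by apply: lerD; apply: le_trans (uB _ _) (KB _ Kk).
suff h : forall k : 'I_K, `|u k y - u k x| <= e by exact: (h (Ordinal kK)).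
by near: y.
Unshelve. all: by end_near. Qed.
Lemma equiC_succ (V : normedModType R) (I : Type) (D : set I) (adm : set (I -> R)) n
    (u : I -> V -> R) : equiC D adm n u ->
  (forall v, (forall i x, derivable (u i : V -> R^o) x v) /\ equiC D adm n (fun i => 'D_v (u i))) ->
  equiC D adm n.+1 u.
Proof. by move=> /equiC0[a b c _] h; split. Qed.

Lemma equiC_weight (V : normedModType R) (D : set nat) n (a : nat -> R) (u : nat -> V -> R) :
  (forall k, `|a k| <= 1) -> equiC D setT n u -> equiC D setT n (fun k x => a k * u k x).
Proof. by move=> a1 eu; apply: equiC_mul => //; apply: equiC_cst => //; exists 1 => k _. Qed.

Lemma smooth_Re_pow (c : R[i]) k : smooth (fun w : 'rV[R]_2 => complex.Re (c * plane w ^+ k)).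
Proof.
elim: k c => [|k IH] c.
  by rewrite (_ : (fun w => _) = fun=> complex.Re (c * 1)) //; exact: smooth_cst.
rewrite (_ : (fun w => _) = fun w : 'rV[R]_2 => w 0 0 * complex.Re (c * plane w ^+ k) +
    w 0 1 * complex.Re (c * 'i * plane w ^+ k)).
  by apply: smoothD; apply: smoothM => //; exact: smooth_coord.
apply/funext => w; rewrite exprS; move: (plane w ^+ k) => z; rewrite /plane.
by case: z => a b; case: (c) => u1 u2 /=; ring.
Qed.

Lemma smooth_cutpow c l m k : smooth (@cutpow R c l m k).
Proof.
apply: smoothM; first exact: smooth_Re_pow.
apply: (@smooth_comp1 _ _ (cutoffn m)); first exact: smooth_cutoffn.
apply: smoothM; first exact: smooth_cst.
apply: smoothB; last exact: smooth_cst.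
by rewrite /sqnorm /plane /=; apply: smoothD; apply: smoothM; exact: smooth_coord.
Qed.

(** Each derivative costs a factor of order k. Of the n + 1 weights, n pay for the n derivatives and
    the last one provides the decay asked for by [equiC_decay]. *)
Lemma equiC_cutpow n c l m :
  equiC setT setT n (fun k w => k.+1%:R ^- n.+1 * @cutpow R c l m k w).
Proof.
have w1 (j k : nat) : (j <= k)%N -> `|j%:R / k.+1%:R : R| <= 1.
  move=> jk; rewrite ger0_norm ?divr_ge0 // ler_pdivrMr ?ltr0n // mul1r ler_nat.
  exact: leq_trans jk _.
elim: n c l m => [|n IH] c l m.
  have [B B0 hB] := @cutpow_bounded R c l m.
  apply: (@equiC_decay _ _ B) => [k|k x].
    apply: smooth_continuous; apply: smoothM; [exact: smooth_cst|exact: smooth_cutpow].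
  rewrite expr1 normrM mulrC [`|_^-1|]ger0_norm ?invr_ge0 //.
  by apply: ler_wpM2r => //; rewrite invr_ge0.
have E k : k.+1%:R ^- n.+2 = 1%:R / k.+1%:R * k.+1%:R ^- n.+1 :> R.
  by rewrite mul1r -!exprVn exprS.
apply: equiC_succ.
  rewrite (_ : (fun k => _) = fun k w => 1%:R / k.+1%:R * (k.+1%:R ^- n.+1 * cutpow c l m k w)).
    apply: equiC_weight => // k; rewrite ger0_norm ?divr_ge0 // ler_pdivrMr ?ltr0n //.
    by rewrite mul1r ler1n.
  by apply/funext => k; apply/funext => w; rewrite E mulrA.
move=> v; have d k w := isdZ (is_derive_cutpow c l m k w v) (k.+1%:R ^- n.+2).
split; first by move=> k w; have [] := d k w.
rewrite (_ : (fun k => _) = fun k w =>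
   (k - l)%:R / k.+1%:R * (k.+1%:R ^- n.+1 * cutpow (c * plane v) l.+1 m k w) +
   (2 * (w 0 0 * v 0 0 + w 0 1 * v 0 1)) *
     (k%:R / k.+1%:R * (k.+1%:R ^- n.+1 * cutpow c l m.+1 k w))); last first.
  by apply/funext => k; apply/funext => w; have [_ ->] := d k w; rewrite E; ring.
apply: equiC_add => //; first by apply: equiC_weight => // k; apply: w1; exact: leq_subr.
apply: equiC_mul => //; last by apply: equiC_weight => // k; exact: w1.
have s : smooth (fun w : 'rV[R]_2 => 2 * (w 0 0 * v 0 0 + w 0 1 * v 0 1)).
  apply: smoothM; first exact: smooth_cst.
  by apply: smoothD; apply: smoothM; [exact: smooth_coord|exact: smooth_cst|
    exact: smooth_coord|exact: smooth_cst].
have /Ck_onE := s n.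
exact: (@equiC_reindex _ _ unit nat setT setT setT setT (fun=> tt)).
Qed.

End CutoffPowerFamilies.

(** * Fourier series on the circle *)

Section CircleMean.
Context {R : realType}.
Implicit Types (f g : R -> R).

Definition circle_arc : set R := [set` `[0, 2 * (pi : R)]].

Definition contf : set (R -> R) := [set f | continuous (f : R^o -> R^o)].

Definition circle_mean f : R :=
  (2 * pi)^-1 * (\int[lebesgue_measure]_(t in `[0%R, (2 * pi)%R]) f t).

Lemma pi2_gt0 : 0 < 2 * (pi : R).
Proof. by rewrite mulr_gt0 // pi_gt0. Qed.

Lemma contf_integrable f : contf f ->
  (@lebesgue_measure R).-integrable `[0%R, (2 * pi)%R] (EFin \o f).
Proof.
move=> cf; apply: continuous_compact_integrable; first exact: segment_compact.
exact: continuous_subspaceT.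
Qed.

Lemma circle_mean_cst (c : R) : circle_mean (fun=> c) = c.
Proof.
rewrite /circle_mean Rintegral_cst //= lebesgue_measure_itv /= lte_fin pi2_gt0 -EFinD /=.
by rewrite subr0 mulrCA mulVf ?mulr1 // gt_eqF // pi2_gt0.
Qed.

Lemma contfD f g : contf f -> contf g -> contf (fun t => f t + g t).
Proof. by move=> cf cg x; apply: (@cvgD _ R^o); [exact: cf|exact: cg]. Qed.

Lemma contfM f g : contf f -> contf g -> contf (fun t => f t * g t).
Proof. by move=> cf cg x; apply: (@cvgM R^o); [exact: cf|exact: cg]. Qed.

Lemma contf_cst (c : R) : contf (fun=> c).
Proof. by move=> x; exact: cvg_cst. Qed.

Lemma contf_derivable f (df : R -> R) :
  (forall t, is_derive (t : R^o) (1 : R^o) (f : R^o -> R^o) (df t)) -> contf f.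
Proof.
move=> d t; apply: differentiable_continuous; apply/derivable1_diffP.
by have [] := d t.
Qed.

Lemma circle_mean_le f g : contf f -> contf g -> (forall t, circle_arc t -> f t <= g t) ->
  circle_mean f <= circle_mean g.
Proof.
move=> cf cg fg; rewrite /circle_mean ler_pM2l ?invr_gt0 ?pi2_gt0 //.
by apply: le_Rintegral => //; exact: contf_integrable.
Qed.

Lemma circle_mean_functional : bounded_functional circle_arc contf circle_mean 1.
Proof.
split.
- exact: contfD.
- by move=> c a ca; apply: contfM => //; exact: contf_cst.
- move=> a b ca cb; by rewrite /circle_mean (RintegralD _ (contf_integrable ca) (contf_integrable cb)) // mulrDr.
- move=> c a ca; rewrite /circle_mean (RintegralZl _ _ (contf_integrable ca)) //.
  by rewrite mulrCA.
- move=> a M ca aM; rewrite mul1r ler_norml.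
  have h t : circle_arc t -> - M <= a t /\ a t <= M by move/aM; rewrite ler_norml => /andP[].
  have := circle_mean_le (@contf_cst (- M)) ca (fun t ht => (h t ht).1).
  have := circle_mean_le ca (@contf_cst M) (fun t ht => (h t ht).2).
  by rewrite !circle_mean_cst => -> ->.
Qed.

Lemma circle_mean_derive f (df : R -> R) : contf df ->
  (forall t, is_derive (t : R^o) (1 : R^o) (f : R^o -> R^o) (df t)) ->
  f (2 * pi) = f 0 -> circle_mean df = 0.
Proof.
move=> cdf d f0; rewrite /circle_mean /Rintegral.
have cf : continuous (f : R^o -> R^o) by exact: contf_derivable d.
rewrite (@continuous_FTC2 R df f 0 (2 * pi) pi2_gt0).
- by rewrite f0 subee // mulr0.
- exact: continuous_subspaceT.
- split.
  + by move=> x _; have [] := d x.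
  + by apply: cvg_at_right_filter; exact: cf.
  + by apply: cvg_at_left_filter; exact: cf.
- by move=> x _; rewrite derive1E; have [_ ->] := d x.
Qed.

End CircleMean.

Section Periodic.
Context {R : realType}.

(** The arc is compact, so joint smoothness in (t, x) makes bounds and continuity in x uniform in t.
    Derivatives in x are derivatives of the joint function along (0, v), which keeps the induction
    going. *)
Lemma slices (V : normedModType R) n (K : R -> V -> R) :
  smooth (fun q : (R^o * V)%type => K q.1 q.2) -> equiC circle_arc contf n K.
Proof.
elim: n K => [|n IH] K sK; last first.
  have dK t x v : (fun h : R => h^-1 *: ((K t (h *: v + x) : R^o) - K t x)) =
    (fun h : R => h^-1 *: (((fun q : (R^o * V)%type => K q.1 q.2 : R^o) (h *: (0, v) + (t, x))) - K t x)).
    by apply/funext => h /=; rewrite scaler0 add0r.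
  apply: equiC_succ; first exact: IH.
  move=> v; split.
    by move=> t x; rewrite /derivable /= dK; exact: (@smooth_derivable _ _ _ (t, x) (0, v) sK).
  apply: IH; rewrite (_ : (fun q => _) = 'D_(0 : R^o, v) (fun q : (R^o * V)%type => K q.1 q.2 : R^o)).
    exact: smooth_derive.
  by apply/funext => -[t x]; rewrite [LHS]/derive /= dK.
have cK : continuous (fun q : (R^o * V)%type => K q.1 q.2 : R^o) := smooth_continuous sK.
have ct x : contf (K ^~ x).
  move=> t; apply: (@cvg_comp _ _ _ (fun t : R^o => (t, x)) (fun q : (R^o * V)%type => K q.1 q.2 : R^o)
     _ (nbhs ((t : R^o), x))); last exact: (cK (t, x)).
  have := @cvg_pair R^o R^o V (nbhs (t : R^o)) (nbhs (t : R^o)) (nbhs x) _ _ _ id (fun=> x).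
  by apply; [exact: cvg_id|exact: cvg_cst].
split => //.
- move=> x.
  have c : {within `[0, 2 * pi], continuous (K ^~ x)} by apply: continuous_subspaceT; exact: ct.
  have [M _ hM] := EVT_max (ltW pi2_gt0) c; have [N _ hN] := EVT_min (ltW pi2_gt0) c.
  exists (`|K M x| + `|K N x|) => t ht; have := hM t ht; have := hN t ht => h1 h2.
  rewrite ler_norml; apply/andP; split.
    have := ler_norm (- K N x); rewrite normrN => h3; have := normr_ge0 (K M x); lra.
  by have := ler_norm (K M x); have := normr_ge0 (K N x); lra.
- move=> x e e0.
  (* Compactness in the form of the tube lemma: it suffices to find, for each t, neighbourhoods of t
     and of x. *)
  have /compact_near_coveringP := @segment_compact R 0 (2 * pi).
  apply => t _.
  have /cvgrPdist_le/(_ _ (divr_gt0 e0 (ltr0n _ 2))) c1 := cK (t, x).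
  have /cvgrPdist_le/(_ _ (divr_gt0 e0 (ltr0n _ 2))) c2 := ct x t.
  have c3 : \forall t' \near t & y \near x, `|K t x - K t' y| <= e / 2 by exact: c1.
  have c4 : \forall t' \near t & y \near x, `|K t x - K t' x| <= e / 2 by exact: (cvg_fst c2).
  apply: filterS2 c3 c4 => -[t' y] /= h1 h2.
  rewrite -[_ - _](subrKA (K t x)) (splitr e); apply: le_trans (ler_normD _ _) _.
  by apply: lerD => //; rewrite distrC.
Qed.

Definition joint (V : normedModType R) (K : R -> V -> R) (q : (R^o * V)%type) : R := K q.1 q.2.

Definition periodic_smooth (V : normedModType R) (K : R -> V -> R) : Prop :=
  smooth (joint K) /\ forall t p, K (t + 2 * pi) p = K t p.

(** Taken on the product space, so that smoothness in both variables together is inherited from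
    [joint K]. *)
Definition dtheta (V : normedModType R) (K : R -> V -> R) (t : R) (p : V) : R :=
  'D_(1 : R^o, 0 : V) (joint K : _ -> R^o) (t : R^o, p).

Definition ddir (V : normedModType R) (v : V) (K : R -> V -> R) (t : R) : V -> R :=
  'D_v (K t : V -> R^o).

Context {V : normedModType R}.
Implicit Types (K G : R -> V -> R) (p v : V).

Lemma joint_slice K t p v (h : R) :
  joint K (h *: (0 : R^o, v) + (t : R^o, p)) = K t (h *: v + p).
Proof. by rewrite /joint /= scaler0 add0r. Qed.

Lemma ddirE K v t p : smooth (joint K) -> ddir v K t p = 'D_(0 : R^o, v) (joint K : _ -> R^o) (t : R^o, p).
Proof.
move=> sK.
have E : (fun h : R => h^-1 *: ((joint K (h *: (0 : R^o, v) + (t : R^o, p)) : R^o) - joint K (t, p))) =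
   (fun h : R => h^-1 *: ((K t (h *: v + p) : R^o) - K t p)).
  by apply/funext => h; rewrite joint_slice.
by rewrite /ddir [RHS]/derive /= E.
Qed.

Lemma joint_theta K t p (h : R) :
  joint K (h *: (1 : R^o, 0 : V) + (t : R^o, p)) = K (h + t) p.
Proof. by rewrite /joint /= scaler0 add0r /GRing.scale /= mulr1. Qed.

Lemma is_derive_theta K t p : smooth (joint K) ->
  is_derive (t : R^o) (1 : R^o) (K^~ p : R^o -> R^o) (dtheta K t p).
Proof.
move=> sK; have := smooth_is_derive (t : R^o, p) (1 : R^o, 0 : V) sK.
have E : (fun h : R => h^-1 *: ((joint K (h *: (1 : R^o, 0 : V) + (t : R^o, p)) : R^o) - joint K (t, p))) =
   (fun h : R => h^-1 *: ((K (h *: (1 : R^o) + t) p : R^o) - K t p)).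
  by apply/funext => h; rewrite joint_theta /GRing.scale /= mulr1.
by case=> d1 d2; split; [move: d1; rewrite /derivable /= -E|rewrite /derive /= -E].
Qed.

Lemma periodic_ddir K v : periodic_smooth K -> periodic_smooth (ddir v K).
Proof.
move=> [sK pK]; split.
  have E : joint (ddir v K) = 'D_(0 : R^o, v) (joint K : _ -> R^o).
    by apply/funext => -[t p]; rewrite /joint /= ddirE.
  by rewrite E; exact: smooth_derive.
move=> t p; have E : K (t + 2 * pi) = K t by apply/funext => q; exact: pK.
by rewrite /ddir E.
Qed.

Lemma periodic_dtheta K : periodic_smooth K -> periodic_smooth (dtheta K).
Proof.
move=> [sK pK]; split.
  have E : joint (dtheta K) = 'D_(1 : R^o, 0 : V) (joint K : _ -> R^o).
    by apply/funext => -[t p].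
  by rewrite E; exact: smooth_derive.
move=> t p.
have E : (fun h : R => h^-1 *: ((joint K (h *: (1 : R^o, 0 : V) + (t + 2 * pi : R^o, p)) : R^o) -
     joint K (t + 2 * pi, p))) =
   (fun h : R => h^-1 *: ((joint K (h *: (1 : R^o, 0 : V) + (t : R^o, p)) : R^o) - joint K (t, p))).
  by apply/funext => h; rewrite !joint_theta addrA /joint /= !pK.
by rewrite /dtheta [LHS]/derive /= E.
Qed.

Lemma periodic_contf K p : periodic_smooth K -> contf (K^~ p).
Proof. by move=> [sK _]; apply: contf_derivable => t; exact: is_derive_theta. Qed.

Lemma is_derive_ang (k : nat) (phi t : R) (f : R -> R) (df : R) :
  is_derive (k%:R * t + phi : R^o) (1 : R^o) (f : R^o -> R^o) df ->
  is_derive (t : R^o) (1 : R^o) (fun t : R^o => f (k%:R * t + phi) : R^o) (df * k%:R).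
Proof.
move=> h; apply: (@is_derive_comp1 _ R^o f (fun t => k%:R * t + phi)) => //.
rewrite -[X in is_derive _ _ _ X]mulr1.
apply: (@is_derive_linear _ R^o _ (fun v : R^o => k%:R * v)) => s.
by rewrite /GRing.scale /=; ring.
Qed.

Lemma contf_cos (k : nat) (phi : R) : contf (fun t => cos (k%:R * t + phi)).
Proof. by apply: contf_derivable => t; apply: is_derive_ang; exact: is_derive_cos. Qed.

(** One definition for cosine (phi = 0) and sine (phi = -pi/2) coefficients; integration by parts
    merely shifts the phase. *)
Definition coef (k : nat) (phi : R) K p : R := circle_mean (fun t => K t p * cos (k%:R * t + phi)).

Lemma sin_periodic_nat (k : nat) (x : R) : sin (k%:R * (2 * pi) + x) = sin x.
Proof.
rewrite -(periodicn (@sinD2pi R) k x) addrC.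
by rewrite -[pi *+ 2 *+ k]mulr_natl -[pi *+ 2]mulr_natl.
Qed.

(** The function K sin(k t + phi) is periodic, so its derivative has mean 0; and -sin x = cos(x +
    pi/2). *)
Lemma coef_parts (k : nat) phi K p : periodic_smooth K ->
  k%:R * coef k phi K p = coef k (phi + pi / 2) (dtheta K) p.
Proof.
move=> pK; have pdK := periodic_dtheta pK.
pose f t := K t p * sin (k%:R * t + phi).
have cs : contf (fun t => sin (k%:R * t + phi)).
  by apply: contf_derivable => t; apply: is_derive_ang; exact: is_derive_sin.
have df t : is_derive (t : R^o) (1 : R^o) (f : R^o -> R^o)
    (k%:R * (K t p * cos (k%:R * t + phi)) + (-1) * (dtheta K t p * cos (k%:R * t + (phi + pi / 2)))).
  have := isdM (is_derive_theta t p pK.1) (is_derive_ang (is_derive_sin (k%:R * t + phi))).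
  by move/is_derive_cast; apply => //; rewrite addrA cosDpihalf; ring.
have c1 : contf (fun t => K t p * cos (k%:R * t + phi)).
  by apply: contfM; [exact: periodic_contf|exact: contf_cos].
have c2 : contf (fun t => dtheta K t p * cos (k%:R * t + (phi + pi / 2))).
  by apply: contfM; [exact: periodic_contf|exact: contf_cos].
have F := @circle_mean_functional R.
have c1' := functional_admZ F k%:R c1; have c2' := functional_admZ F (-1) c2.
have := circle_mean_derive (contfD c1' c2') df.
rewrite (functionalD F) // !(functionalZ F) // => h; rewrite /coef.
apply/eqP; rewrite -subr_eq0; rewrite mulN1r in h; apply/eqP; apply: h.
rewrite /f sin_periodic_nat mulr0 add0r; have := pK.2 0 p; rewrite add0r => ->.
by [].
Qed.

(** Each of the N factors k + 1 is traded for one integration by parts plus a term of lower order: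
    rapid decay, together with all derivatives in p. *)
Lemma equiC_coef n phi N K : periodic_smooth K ->
  equiC setT setT n (fun k p => k.+1%:R ^+ N * coef k phi K p).
Proof.
elim: N phi K => [|N IH] phi K pK.
  rewrite (_ : (fun k => _) = fun k p => coef k phi K p); last first.
    by apply/funext => k; apply/funext => p; rewrite expr0 mul1r.
  have eK := slices n pK.1.
  apply: (equiC_functional (@circle_mean_functional R) (DJ := setT)
    (u := fun k t p => K t p * cos (k%:R * t + phi))); last first.
    move=> k; apply: equiC_mul => //; [exact: contfD|exact: contfM|].
    apply: equiC_cst; [exact: contf_cos|exact: contf_cst|].
    by exists 1 => t _; rewrite ler_norml cos_geN1 cos_le1.
  apply: equiC_mul.
  - by move=> a b ha hb k; apply: contfD; [exact: ha|exact: hb].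
  - by move=> a b ha hb k; apply: contfM; [exact: ha|exact: hb].
  - apply: (@equiC_reindex _ V _ _ circle_arc contf _ _ snd) eK; first by move=> kt [].
    by move=> a ca k.
  - apply: (@equiC_cst _ V _ _ _ n (fun kt : nat * R => cos (kt.1%:R * kt.2 + phi))).
    + by move=> k; exact: contf_cos.
    + by move=> k; exact: contf_cst.
    + by exists 1 => t _; rewrite ler_norml cos_geN1 cos_le1.
rewrite (_ : (fun k => _) = fun k p => k.+1%:R ^+ N * coef k (phi + pi / 2) (dtheta K) p +
    k.+1%:R ^+ N * coef k phi K p); last first.
  apply/funext => k; apply/funext => p.
  by rewrite exprSr -coef_parts // -natr1; ring.
by apply: equiC_add => //; apply: IH => //; exact: periodic_dtheta.
Qed.

Lemma is_derive_coef k phi K p v : periodic_smooth K ->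
  is_derive p v (coef k phi K : V -> R^o) (coef k phi (ddir v K) p).
Proof.
move=> pK; have eK := slices 1 pK.1.
have e1 : equiC circle_arc contf 1 (fun t p => K t p * cos (k%:R * t + phi)).
  apply: equiC_mul => //; [exact: contfD|exact: contfM|].
  apply: equiC_cst; [exact: contf_cos|exact: contf_cst|].
  by exists 1 => t _; rewrite ler_norml cos_geN1 cos_le1.
have /is_derive_cast := is_derive_functional (@circle_mean_functional R) p v e1.
apply => //; congr circle_mean; apply/funext => t.
have dK : is_derive p v (K t : V -> R^o) (ddir v K t p).
  by apply: derivableP; exact: equiC_derivable eK.
have := isdM dK (isd_cst p v (cos (k%:R * t + phi))) => -[_ ->].
by rewrite mulr0 add0r mulrC.
Qed.

End Periodic.

(** * Fourier inversion at a point by Fejer sums *)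

Section FourierInversion.
Context {R : realType}.
Implicit Types (f g : R -> R) (t x y : R).

Lemma mvt_between f (df : R -> R) x y :
  (forall t, is_derive (t : R^o) (1 : R^o) (f : R^o -> R^o) (df t)) ->
  exists2 a, 0 <= a <= 1 & f y - f x = (y - x) * df (x + a * (y - x)).
Proof.
move=> d.
have [a a01 E] := @mvt_dir_scale R R^o f x (1 : R^o) (y - x) (fun t => @ex_derive _ _ _ _ _ _ _ (d t)).
exists a => //; move: E; rewrite /GRing.scale /= !mulr1 subrK => ->.
by congr (_ * _); have [_ ->] := d (a * (y - x) + x); rewrite addrC.
Qed.

(** Periods are added and removed in natural numbers, the form in which periodicity iterates; adding
    [m] periods first makes the quantity to be truncated nonnegative. *)
Lemma periodic_reduce t t0 : exists m k : nat,
  `|t + (2 * pi) *+ m - (2 * pi) *+ k - t0| <= pi :> R.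
Proof.
have T0 := @pi2_gt0 R.
pose m := Num.bound (`|t0 - pi - t| / (2 * pi)).
pose y := t + (2 * pi) *+ m - t0 + pi.
have y0 : 0 <= y.
  have := archi_boundP (divr_ge0 (normr_ge0 (t0 - pi - t)) (ltW T0)).
  rewrite -/m ltr_pdivrMr // => h; have := ler_norm (t0 - pi - t); rewrite /y -mulr_natl; lra.
pose k := Num.trunc (y / (2 * pi)).
have /truncn_itv : 0 <= y / (2 * pi) by rewrite divr_ge0 // ltW.
rewrite -/k => /andP[]; rewrite ler_pdivlMr // ltr_pdivrMr // -[k.+1%:R]natr1 => h1 h2.
have E : (2 * pi) *+ k = k%:R * (2 * pi) :> R by rewrite [RHS]mulr_natl.
rewrite mulrDl mul1r -E in h2; rewrite -E in h1.
exists m, k; rewrite ler_norml.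
set w : R := (2 * pi) *+ k in h1 h2 *; set u : R := (2 * pi) *+ m in y y0 k E w h1 h2 *.
by clearbody w u; rewrite /y in h1 h2; lra.
Qed.

Lemma one_sub_cos_ge : exists2 c : R, 0 < c & forall d, `|d| <= pi -> c * d ^+ 2 <= 1 - cos d.
Proof.
have /cvgrPdist_lt/(_ 2^-1) : cos @ (0 : R) --> (cos 0 : R) := @continuous_cos R 0.
rewrite invr_gt0 ltr0n => /(_ isT) /nbhs_ballP[r0 /= r00 hr].
pose r := Num.min r0 (pi / 2).
have r_gt0 : 0 < r by rewrite lt_min r00 divr_gt0 ?pi_gt0.
have r_pi : r <= pi / 2 by rewrite ge_min lexx orbT.
have hc x : 0 <= x < r -> 2^-1 <= cos x.
  move=> /andP[x0 xr]; have := hr x; rewrite /ball /= cos0 sub0r normrN ger0_norm //.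
  move=> /(_ (lt_le_trans xr _)); rewrite ge_min lexx => /(_ isT).
  by rewrite ltr_norml => /andP[_]; lra.
have p0 := @pi_gt0 R.
have cr : cos r < 1.
  by rewrite -cos0 ltr_cos // ?in_itv /= ?lexx ?ltW //; lra.
(* For 0 <= d < r one has sin(d/2) >= d/4, so 1 - cos d = 2 sin(d/2)^2 >= d^2/8; for r <= d <= pi
   the cosine is at most cos r, and d^2 <= pi^2. *)
pose c := Num.min 8^-1 ((1 - cos r) / pi ^+ 2).
exists c => [|d dpi].
  by rewrite lt_min invr_gt0 ltr0n /= divr_gt0 ?exprn_gt0 // subr_gt0.
wlog d0 : d dpi / 0 <= d.
  move=> h; have [d0|d0] := leP 0 d; first exact: h.
  by rewrite -cosN -sqrrN; apply: h; rewrite ?normrN // oppr_ge0 ltW.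
rewrite (ger0_norm d0) in dpi.
have [dr|rd] := ltP d r.
  have [a /andP[a0 a1]] := mvt_between 0 (d / 2) (@is_derive_sin R).
  rewrite sin0 !subr0 add0r => E.
  have ad : 0 <= a * (d / 2) by rewrite mulr_ge0 // divr_ge0.
  have ad2 : a * (d / 2) < r.
    by apply: le_lt_trans dr; apply: (@le_trans _ _ (d / 2)); [rewrite ler_piMl // divr_ge0|lra].
  have s : d / 4 <= sin (d / 2).
    by rewrite E; have := hc _ (introT andP (conj ad ad2)); nra.
  have -> : 1 - cos d = 2 * sin (d / 2) ^+ 2.
    have := cos_mulr2n (d / 2); rewrite cos2sin2 (_ : d / 2 *+ 2 = d); last by lra.
    by move=> ->; rewrite mulr2n; ring.
  have c8 : c <= 8^-1 by rewrite ge_min lexx.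
  have := sqr_ge0 d; nra.
have cd : cos d <= cos r.
  have [->//|rd'] := eqVneq r d.
  have hd : d \in `[0, pi] by rewrite in_itv /= d0.
  have hr' : r \in `[0, pi] by rewrite in_itv /= (ltW r_gt0) (le_trans rd).
  by rewrite ltW // ltr_cos // lt_neqAle rd' rd.
have c2 : c <= (1 - cos r) / pi ^+ 2 by rewrite ge_min lexx orbT.
apply: (@le_trans _ _ (1 - cos r)); last lra.
apply: (@le_trans _ _ (c * pi ^+ 2)).
  apply: ler_wpM2l; last by apply: lerXn2r; rewrite ?nnegrE // (le_trans d0).
  by rewrite le_min invr_ge0 ler0n /= divr_ge0 ?exprn_ge0 ?subr_ge0 // ltW.
by rewrite -ler_pdivlMr // exprn_gt0.
Qed.

(** Taylor's formula of order two, by the mean value theorem for g and then for g1; the constant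
    bounds |g2| on the compact interval. *)
Lemma quadratic_bound (g g1 g2 : R -> R) t0 (r : R) : 0 <= r ->
  (forall t, is_derive (t : R^o) (1 : R^o) (g : R^o -> R^o) (g1 t)) ->
  (forall t, is_derive (t : R^o) (1 : R^o) (g1 : R^o -> R^o) (g2 t)) ->
  contf g2 -> g t0 = 0 -> g1 t0 = 0 ->
  exists2 M, 0 <= M & forall t, `|t - t0| <= r -> `|g t| <= M * (t - t0) ^+ 2.
Proof.
move=> r0 d1 d2 c2 g0 g10.
have ab : t0 - r <= t0 + r by lra.
have c : {within `[t0 - r, t0 + r], continuous g2} by exact: continuous_subspaceT.
have [M _ hM] := EVT_max ab c; have [N _ hN] := EVT_min ab c.
exists (`|g2 M| + `|g2 N|) => [|t tr]; first by rewrite addr_ge0.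
have [a /andP[a0 a1] E1] := mvt_between t0 t d1.
have [b /andP[b0 b1] E2] := mvt_between t0 (t0 + a * (t - t0)) d2.
rewrite g0 subr0 in E1; rewrite g10 subr0 in E2; rewrite E1 E2 [t0 + _ - t0]addrC addKr.
set z := t0 + _.
have hz : z \in `[t0 - r, t0 + r].
  have ba : `|b * (a * (t - t0))| <= r.
    apply: le_trans tr; rewrite !normrM (ger0_norm a0) (ger0_norm b0) mulrA.
    by rewrite ler_piMl // mulr_ile1.
  by rewrite in_itv /=; move: ba; rewrite ler_norml /z; move: (b * _) => w; lra.
have gz : `|g2 z| <= `|g2 M| + `|g2 N|.
  have := hM _ hz; have := hN _ hz; move: (g2 z) => u h1 h2.
  have := ler_norm (- g2 N); have := ler_norm (g2 M); rewrite normrN => h3 h4.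
  by have := normr_ge0 (g2 M); have := normr_ge0 (g2 N); rewrite ler_norml => h5 h6; lra.
rewrite !normrM (ger0_norm a0).
rewrite (_ : `|t - t0| * _ = (a * `|g2 z|) * `|t - t0| ^+ 2); last by ring.
rewrite real_normK ?num_real // ler_wpM2r ?sqr_ge0 //; apply: le_trans gz.
by rewrite ler_piMl.
Qed.

Lemma circle_mean_ang (k : nat) phi : circle_mean (fun t : R => cos (k.+1%:R * t + phi)) = 0.
Proof.
have F := @circle_mean_functional R.
have k0 : k.+1%:R != 0 :> R by rewrite pnatr_eq0.
apply: (mulfI k0); rewrite mulr0 -(functionalZ F); last exact: contf_cos.
apply: (@circle_mean_derive R (fun t => sin (k.+1%:R * t + phi))).
- by apply: (functional_admZ F); exact: contf_cos.
- move=> t; have := is_derive_ang (is_derive_sin (k.+1%:R * t + phi)).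
  by move/is_derive_cast; apply => //; rewrite mulrC.
- by rewrite sin_periodic_nat mulr0 add0r.
Qed.

Definition dirichlet (n : nat) (d : R) : R := 1 + 2 * \sum_(k < n) cos (k.+1%:R * d).

Lemma dirichlet_telescope n d :
  (1 - cos d) * dirichlet n d = cos (n%:R * d) - cos (n.+1%:R * d).
Proof.
rewrite /dirichlet; elim: n => [|n IH]; first by rewrite big_ord0 mulr0 addr0 mulr1 mul0r cos0 mul1r.
rewrite big_ord_recr /= [2 * (_ + _)]mulrDr addrA mulrDr IH.
have -> : cos (n%:R * d) = cos (n.+1%:R * d - d) by rewrite -natr1 mulrDl mul1r addrK.
have -> : cos (n.+2%:R * d) = cos (n.+1%:R * d + d) by rewrite -[n.+2%:R]natr1 mulrDl mul1r.
by rewrite cosB cosD; ring.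
Qed.

(** The Fejer kernel, unnormalized and cleared of its denominator 1 - cos d, which vanishes at d =
    0. *)
Lemma fejer n d : (1 - cos d) * \sum_(j < n) dirichlet j d = 1 - cos (n%:R * d).
Proof.
rewrite mulr_sumr; under eq_bigr do rewrite dirichlet_telescope.
elim: n => [|n IH]; first by rewrite big_ord0 mul0r cos0 subrr.
by rewrite big_ord_recr /= IH addrA subrK.
Qed.

Lemma circle_mean_sum (I : Type) (r : seq I) (F : I -> R -> R) :
  (forall i, contf (F i)) ->
  contf (fun t => \sum_(i <- r) F i t) /\
  circle_mean (fun t => \sum_(i <- r) F i t) = \sum_(i <- r) circle_mean (F i).
Proof.
move=> cF; elim: r => [|i r [IH1 IH2]].
  rewrite (_ : (fun t => _) = fun=> 0); last by apply/funext => t; rewrite big_nil.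
  by rewrite big_nil circle_mean_cst; split => //; exact: contf_cst.
rewrite (_ : (fun t => _) = fun t => F i t + \sum_(j <- r) F j t); last first.
  by apply/funext => t; rewrite big_cons.
rewrite big_cons -IH2; split; first exact: contfD.
exact: (functionalD (@circle_mean_functional R)).
Qed.

Lemma contf_shift_cos (k : nat) t0 : contf (fun t : R => cos (k%:R * (t - t0))).
Proof.
have := @contf_cos R k (- (k%:R * t0)).
by congr contf; apply/funext => t; rewrite mulrBr.
Qed.

Lemma contf_dirichlet n t0 : contf (fun t => dirichlet n (t - t0)).
Proof.
apply: contfD; first exact: contf_cst.
apply: contfM; first exact: contf_cst.
have [h _] := circle_mean_sum (F := fun (k : 'I_n) t => cos (k.+1%:R * (t - t0)))
  (index_enum 'I_n) (fun k => @contf_shift_cos k.+1 t0).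
exact: h.
Qed.

Lemma circle_mean_dirichlet n t0 (g : R -> R) : contf g ->
  circle_mean (fun t => g t * dirichlet n (t - t0)) =
  circle_mean g + 2 * \sum_(k < n) circle_mean (fun t => g t * cos (k.+1%:R * (t - t0))).
Proof.
move=> cg; have F := @circle_mean_functional R.
rewrite (_ : (fun t => _) = fun t => g t + 2 * \sum_(k < n) (g t * cos (k.+1%:R * (t - t0)))).
  have [c1 c2] := circle_mean_sum (F := fun (k : 'I_n) t => g t * cos (k.+1%:R * (t - t0)))
    (index_enum 'I_n) (fun k => contfM cg (@contf_shift_cos k.+1 t0)).
  rewrite (functionalD F) //; last exact: (functional_admZ F).
  by rewrite (functionalZ F) // c2.
by apply/funext => t; rewrite /dirichlet mulrDr mulr1 mulrCA mulr_sumr.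
Qed.

Lemma circle_mean_dirichlet1 n t0 : circle_mean (fun t => dirichlet n (t - t0)) = 1.
Proof.
have := circle_mean_dirichlet n t0 (@contf_cst R 1).
rewrite circle_mean_cst big1 ?mulr0 ?addr0 => [<-|k _].
  by congr circle_mean; apply/funext => t; rewrite mul1r.
rewrite -[RHS](circle_mean_ang k (- (k.+1%:R * t0))).
by congr circle_mean; apply/funext => t; rewrite mul1r mulrBr.
Qed.

(** The sine is odd and the kernel even about t0; here the products are expanded into single sine
    modes, each of mean 0. *)
Lemma circle_mean_dirichlet_sin n t0 :
  circle_mean (fun t => sin (t - t0) * dirichlet n (t - t0)) = 0.
Proof.
have F := @circle_mean_functional R.
have cs : contf (fun t => sin (t - t0)).
  have := @contf_cos R 1 (- t0 - pi / 2); congr contf; apply/funext => t.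
  by rewrite mul1r addrA cosBpihalf.
have ms : circle_mean (fun t => sin (t - t0)) = 0.
  rewrite -[RHS](circle_mean_ang 0 (- t0 - pi / 2)).
  by congr circle_mean; apply/funext => t; rewrite mul1r addrA cosBpihalf.
rewrite circle_mean_dirichlet // ms add0r big1 ?mulr0 // => k _.
have E : (fun t => sin (t - t0) * cos (k.+1%:R * (t - t0))) =
   (fun t => 2^-1 * cos (k.+2%:R * t + (- (k.+2%:R * t0) - pi / 2)) +
             (- 2^-1) * cos (k%:R * t + (- (k%:R * t0) - pi / 2))).
  apply/funext => t; rewrite !addrA -!mulrBr !cosBpihalf.
  rewrite (_ : k.+2%:R * (t - t0) = k.+1%:R * (t - t0) + (t - t0)); last first.
    by rewrite -[k.+2%:R]natr1 mulrDl mul1r.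
  rewrite (_ : k%:R * (t - t0) = k.+1%:R * (t - t0) - (t - t0)); last first.
    by rewrite -[k.+1%:R]natr1 mulrDl mul1r addrK.
  move: (k.+1%:R * _) => e; move: (t - t0) => d.
  by rewrite sinB sinD; field.
rewrite E (functionalD F) ?(functionalZ F); try exact: contf_cos;
  try by apply: (functional_admZ F); exact: contf_cos.
rewrite circle_mean_ang mulr0 add0r; move: (nat_of_ord k) => j.
(* The lower mode of the first product has frequency 0: it is the constant cos(-pi/2) = 0. *)
case: j => [|j]; last by rewrite circle_mean_ang mulr0.
rewrite (_ : (fun t => _) = fun=> 0) ?circle_mean_cst ?mulr0 //.
by apply/funext => t; rewrite !mul0r oppr0 !add0r -[- _]add0r cosBpihalf sin0.
Qed.

(** Convergence is assumed, so only the limit has to be identified, and Cesaro means suffice.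
    Subtracting f(t0) and f'(t0) sin(t - t0) leaves a function g with a double zero at t0, bounded
    by a multiple of 1 - cos(t - t0); against it the sums of Dirichlet kernels stay bounded. *)
Lemma fourier_inversion (f f1 f2 : R -> R) (t0 S : R) :
  (forall t, is_derive (t : R^o) (1 : R^o) (f : R^o -> R^o) (f1 t)) ->
  (forall t, is_derive (t : R^o) (1 : R^o) (f1 : R^o -> R^o) (f2 t)) ->
  contf f2 -> (forall t, f (t + 2 * pi) = f t) ->
  (fun n => circle_mean f + 2 * \sum_(k < n) circle_mean (fun t => f t * cos (k.+1%:R * (t - t0))))
    @ \oo --> S ->
  S = f t0.
Proof.
move=> d1 d2 c2 pf cS; have F := @circle_mean_functional R.
pose g t := f t - f t0 - f1 t0 * sin (t - t0).
have dsh t : is_derive (t : R^o) (1 : R^o) (fun t => t - t0 : R^o) 1.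
  by have /is_derive_cast := isdB (is_derive_id (t : R^o) (1 : R^o)) (isd_cst (t : R^o) (1 : R^o) t0);
     apply => //; rewrite subr0.
have ds t := @is_derive_comp1 _ R^o sin (fun t => t - t0) t _ _ _ (is_derive_sin (t - t0)) (dsh t).
have dc t := @is_derive_comp1 _ R^o cos (fun t => t - t0) t _ _ _ (is_derive_cos (t - t0)) (dsh t).
have dg t : is_derive (t : R^o) (1 : R^o) (g : R^o -> R^o) (f1 t - f1 t0 * cos (t - t0)).
  have := isdB (isdB (d1 t) (isd_cst _ _ (f t0))) (isdZ (ds t) (f1 t0)).
  by move/is_derive_cast; apply => //; rewrite subr0 mulr1.
have dg1 t : is_derive (t : R^o) (1 : R^o) (fun t => f1 t - f1 t0 * cos (t - t0) : R^o)
    (f2 t + f1 t0 * sin (t - t0)).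
  have := isdB (d2 t) (isdZ (dc t) (f1 t0)).
  by move/is_derive_cast; apply => //; rewrite mulr1 mulrN opprK.
have cs : contf (fun t => sin (t - t0)) by exact: contf_derivable ds.
have cg2 : contf (fun t => f2 t + f1 t0 * sin (t - t0)).
  by apply: contfD => //; exact: (functional_admZ F).
have g0 : g t0 = 0 by rewrite /g !subrr sin0 mulr0 subr0.
have g10 : f1 t0 - f1 t0 * cos (t0 - t0) = 0 by rewrite subrr cos0 mulr1 subrr.
have [M M0 hM] := quadratic_bound (ltW (@pi_gt0 R)) dg dg1 cg2 g0 g10.
have [c c0 hc] := one_sub_cos_ge.
(* [quadratic_bound] applies within distance pi of t0; periodicity of both sides carries the
   estimate to all t. *)
have gb t : `|g t| <= M / c * (1 - cos (t - t0)).
  have [m [k]] := periodic_reduce t t0; set t' := t + _ - _ => ht.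
  have per (h : R -> R) : (forall t, h (t + 2 * pi) = h t) -> h t' = h t.
    by move=> hp; rewrite -(@periodicn _ _ h (2 * pi) hp k t') subrK (@periodicn _ _ h (2 * pi) hp).
  have gp x : g (x + 2 * pi) = g x.
    by rewrite /g pf (_ : x + 2 * pi - t0 = x - t0 + pi *+ 2) ?sinD2pi // mulr2n; ring.
  have cp x : cos (x + 2 * pi - t0) = cos (x - t0).
    by rewrite (_ : x + 2 * pi - t0 = x - t0 + pi *+ 2) ?cosD2pi // mulr2n; ring.
  rewrite -(per g gp) -(per (fun t => cos (t - t0)) cp).
  apply: le_trans (hM _ ht) _; rewrite -mulrA; apply: ler_wpM2l => //.
  by rewrite ler_pdivlMl //; exact: hc.
pose s n := circle_mean f + 2 * \sum_(k < n) circle_mean (fun t => f t * cos (k.+1%:R * (t - t0))).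
have cf : contf f := contf_derivable d1.
have cg : contf g := contf_derivable dg.
have sE n : s n - f t0 = circle_mean (fun t => g t * dirichlet n (t - t0)).
  rewrite /s -circle_mean_dirichlet //.
  have cD := @contf_dirichlet n t0.
  rewrite (_ : (fun t => g t * _) = fun t => (f t * dirichlet n (t - t0) +
     (- f t0) * dirichlet n (t - t0)) + (- f1 t0) * (sin (t - t0) * dirichlet n (t - t0))); last first.
    by apply/funext => t; rewrite /g; ring.
  have h1 := contfM cf cD; have h2 := functional_admZ F (- f t0) cD.
  have h3 := contfM cs cD.
  rewrite (functionalD F (contfD h1 h2) (functional_admZ F _ h3)) (functionalD F h1 h2).
  by rewrite !(functionalZ F) // circle_mean_dirichlet1 circle_mean_dirichlet_sin mulr0 mulr1 addr0.
(* The factor 1 - cos in the bound of g turns the sum of kernels, by [fejer], into 1 - cos(n(t -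
   t0)) <= 2. The bound does not depend on n, so division by n + 1 sends it to 0. *)
have bound n : `|\sum_(j < n) (s j - f t0)| <= 2 * (M / c).
  have [h1 h2] := circle_mean_sum (F := fun (j : 'I_n) t => g t * dirichlet j (t - t0))
    (index_enum 'I_n) (fun j => contfM cg (@contf_dirichlet j t0)).
  under eq_bigr do rewrite sE; rewrite -h2 -[leRHS]mul1r.
  apply: (functional_bound F) => // t _.
  rewrite -mulr_sumr normrM.
  have q0 : 0 <= 1 - cos (t - t0) by rewrite subr_ge0 cos_le1.
  apply: (@le_trans _ _ (M / c * (1 - cos (t - t0)) * `|\sum_(j < n) dirichlet j (t - t0)|)).
    by apply: ler_wpM2r.
  rewrite -mulrA -{1}(ger0_norm q0) -normrM fejer mulrC.
  apply: ler_wpM2r; first by rewrite divr_ge0 // ltW.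
  rewrite ger0_norm ?subr_ge0 ?cos_le1 //; have := cos_geN1 (n%:R * (t - t0)); lra.
have l1 := cesaro cS.
apply/eqP; rewrite eq_sym; apply/eqP.
have l2 : arithmetic_mean s @ \oo --> f t0.
  apply/cvgrPdist_le => e e0.
  have := archi_boundP (divr_ge0 (mulr_ge0 (ler0n R 2) (divr_ge0 M0 (ltW c0))) (ltW e0)).
  set N := Num.bound _ => hN.
  near=> n; have Nn : (N <= n)%N by near: n; exact: nbhs_infty_ge.
  have n0 : 0 < n.+1%:R :> R by rewrite ltr0n.
  rewrite /arithmetic_mean /series /= distrC.
  rewrite (_ : _ - _ = n.+1%:R^-1 * \sum_(j < n.+1) (s j - f t0)); last first.
    rewrite big_mkord sumrB sumr_const card_ord mulrBr -[f t0 *+ _]mulr_natl mulKf ?gt_eqF //.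
  rewrite normrM ger0_norm ?invr_ge0 ?ler0n // ler_pdivrMl //.
  apply: le_trans (bound _) _; rewrite -ler_pdivrMr //.
  by apply: le_trans (ltW hN) _; rewrite ler_nat ltnW // ltnS.
exact: (@cvg_unique R^o (@norm_hausdorff _ _) _ _ _ _ l2 l1).
Unshelve. all: by end_near. Qed.

End FourierInversion.

(** * Weighted sums as bounded functionals of sequences *)

Section WeightedSum.
Context {R : realType}.
Implicit Types a b : nat -> R.

Definition bounded_seq : set (nat -> R) := [set a | exists M, forall k, `|a k| <= M].

Definition wterm a : nat -> R := fun k => k.+1%:R ^- 2 * a k.

(** Summable weights make summation a bounded functional on all bounded sequences; a rapidly
    convergent series is the weighted sum of its terms times (k + 1)^2. *)
Definition weighted_sum a : R := limn (series (wterm a)).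

Lemma inverse_squares_le n : \sum_(0 <= k < n) k.+1%:R ^- 2 <= 2 :> R.
Proof.
(* The sharper bound 2 - 1/(n + 1) is inductive, because 1/(x + 1)^2 <= 1/x - 1/(x + 1). *)
suff h : \sum_(0 <= k < n.+1) k.+1%:R ^- 2 <= 2 - n.+1%:R^-1 :> R.
  apply: (@le_trans _ _ (\sum_(0 <= k < n.+1) k.+1%:R ^- 2)).
    by rewrite big_nat_recr //= lerDl invr_ge0 exprn_ge0.
  by apply: le_trans h _; rewrite gerBl.
elim: n => [|n IH]; first by rewrite big_nat1 expr1n !invr1; lra.
rewrite big_nat_recr //=.
have : (n.+2%:R : R) ^- 2 <= n.+1%:R^-1 - n.+2%:R^-1.
  have h1 : 0 < n.+1%:R :> R by rewrite ltr0n.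
  have h2 : n.+2%:R = n.+1%:R + 1 :> R by rewrite natr1.
  rewrite h2; move: (n.+1%:R : R) h1 => x x0.
  have -> : x^-1 - (x + 1)^-1 = (x * (x + 1))^-1 by field; lra.
  by rewrite lef_pV2 ?posrE ?exprn_gt0 ?mulr_gt0 //; nra.
by move=> h; apply: le_trans (lerD IH h) _; rewrite addrA subrK.
Qed.

Lemma wterm_cvg a : bounded_seq a -> cvgn (series (wterm a)).
Proof.
move=> [M hM]; apply: normed_cvg.
have cinv : cvgn (series (fun k => k.+1%:R ^- 2 : R)).
  apply: nondecreasing_is_cvgn.
    apply/nondecreasing_seqP => n; rewrite /series /= big_nat_recr //= lerDl.
    by rewrite invr_ge0 exprn_ge0.
  by exists 2 => _ [n _ <-]; exact: inverse_squares_le.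
apply: (@series_le_cvg _ _ (fun k => `|M| * k.+1%:R ^- 2)).
- by move=> k; exact: normr_ge0.
- by move=> k; rewrite mulr_ge0 // invr_ge0 exprn_ge0.
- move=> k; rewrite [leLHS]normrM ger0_norm ?invr_ge0 ?exprn_ge0 // mulrC.
  apply: ler_wpM2r; first by rewrite invr_ge0 exprn_ge0.
  by apply: le_trans (hM k) _; exact: ler_norm.
- rewrite (_ : (fun k => _) = `|M| *: (fun k => k.+1%:R ^- 2 : R)) //.
  exact: is_cvg_seriesZ.
Qed.

Lemma weighted_sum_functional : bounded_functional setT bounded_seq weighted_sum 2.
Proof.
split.
- move=> a b [M hM] [N hN]; exists (M + N) => k.
  by apply: le_trans (ler_normD _ _) _; apply: lerD.
- move=> c a [M hM]; exists (`|c| * M) => k; rewrite normrM; exact: ler_wpM2l.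
- move=> a b /wterm_cvg ca /wterm_cvg cb; rewrite /weighted_sum -lim_seriesD //.
  by congr (limn (series _)); apply/funext => k; rewrite /wterm /= mulrDr.
- move=> c a /wterm_cvg ca; rewrite /weighted_sum -[RHS]/(c *: limn (series (wterm a))) -lim_seriesZ //.
  by congr (limn (series _)); apply/funext => k; rewrite /wterm /= mulrCA.
- move=> a M ba aM.
  have M0 : 0 <= M by apply: le_trans (normr_ge0 (a 0%N)) (aM 0%N I).
  have b n : `|series (wterm a) n| <= 2 * M.
    rewrite /series /=; apply: le_trans (ler_norm_sum _ _ _) _.
    apply: (@le_trans _ _ (\sum_(0 <= k < n) k.+1%:R ^- 2 * M)).
      apply: ler_sum => k _; rewrite /wterm normrM ger0_norm ?invr_ge0 ?exprn_ge0 //.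
      by apply: ler_wpM2l; [rewrite invr_ge0 exprn_ge0|exact: aM].
    by rewrite -mulr_suml; apply: ler_wpM2r => //; exact: inverse_squares_le.
  rewrite ler_norml; apply/andP; split.
    apply: limr_ge; first exact: wterm_cvg.
    by near=> n; have := b n; rewrite ler_norml => /andP[].
  apply: limr_le; first exact: wterm_cvg.
  by near=> n; have := b n; rewrite ler_norml => /andP[].
Unshelve. all: by end_near. Qed.

(* Square weights cancel those of the functional. *)
Lemma weighted_sum_cvg a : bounded_seq (fun k => k.+1%:R ^+ 2 * a k) ->
  (fun n => \sum_(k < n) a k) @ \oo --> weighted_sum (fun k => k.+1%:R ^+ 2 * a k).
Proof.
move=> /wterm_cvg; rewrite (_ : (fun n => \sum_(k < n) a k) = series (wterm (fun k => k.+1%:R ^+ 2 * a k))) //.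
apply/funext => n; rewrite /series /= big_mkord; apply: eq_bigr => k _.
by rewrite /wterm mulKf // expf_neq0 // pnatr_eq0.
Qed.

Lemma equiC_bounded_seq (V : normedModType R) n (u : nat -> V -> R) :
  equiC setT setT n u -> equiC setT bounded_seq n u.
Proof.
elim: n u => [|n IH] u [a b c d]; split => //.
1,2: by move=> x; have [M hM] := b x; exists M => k; exact: hM.
by move=> v; have [d1 d2] := d v; split => //; exact: IH.
Qed.

Lemma smooth_weighted_sum (V : normedModType R) (u : nat -> V -> R) :
  (forall n, equiC setT setT n u) -> smooth (fun x => weighted_sum (u^~ x)).
Proof.
move=> eu n; apply/Ck_onE.
apply: (equiC_functional weighted_sum_functional (DJ := [set: unit]) (u := fun _ => u)); last first.
  by move=> _; exact: equiC_bounded_seq.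
have := equiC_bounded_seq (eu n).
apply: (@equiC_reindex _ V nat (unit * nat) setT bounded_seq _ _ snd) => // a [M hM] j.
by exists M.
Qed.

Lemma is_derive_weighted_sum (V : normedModType R) (u : nat -> V -> R) x v :
  equiC setT setT 1 u ->
  is_derive x v (fun x => weighted_sum (u^~ x) : R^o) (weighted_sum (fun k => 'D_v (u k) x)).
Proof. by move=> /equiC_bounded_seq eu; exact: (is_derive_functional weighted_sum_functional x v eu). Qed.

End WeightedSum.

(** * The Schwarz integral *)

Section ConjugateSeries.
Context {R : realType} {V : normedModType R}.
Implicit Types (K G : R -> V -> R) (p : V) (c : R[i]) (k : nat).

(** For a real function the modes k and -k contribute the same real part; they coincide only for k =
    0. *)
Definition multiplicity k : R := if k == 0%N then 1 else 2.

(* At |w| <= 1 this is the real part of [c h_k w^k] (doubled for k > 0), where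
   h_k is the k-th Fourier coefficient of K. *)
Definition conj_term c K k (q : (V * 'rV[R]_2)%type) : R :=
  multiplicity k * (coef k 0 K q.1 * cutpow c 0 0 k q.2 +
    coef k (- (pi / 2)) K q.1 * cutpow (- 'i * c) 0 0 k q.2).

(** On the closed disk, c = 1 gives the real part and c = -i the imaginary part of the same
    holomorphic function. Keeping c general lets a derivative in w act as a change of c. *)
Definition conj_series c K (q : (V * 'rV[R]_2)%type) : R :=
  weighted_sum (fun k => k.+1%:R ^+ 2 * conj_term c K k q).

Lemma equiC_coef_cutpow n phi c l m K (a : nat -> R) : periodic_smooth K ->
  (exists M, forall k, `|a k| <= M) ->
  equiC setT setT n (fun k (q : (V * 'rV[R]_2)%type) =>
    k.+1%:R ^+ 2 * (a k * (coef k phi K q.1 * cutpow c l m k q.2))).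
Proof.
move=> pK [M hM].
(* Of the n + 3 weights granted by the decay of the coefficients, n + 1 go to [equiC_cutpow] and 2
   to the weighted sum. *)
have e1 : equiC setT setT n (fun k (q : (V * 'rV[R]_2)%type) => k.+1%:R ^+ n.+3 * coef k phi K q.1).
  apply: (@equiC_affine _ (V * 'rV[R]_2)%type V nat setT setT fst fst n
    (fun k p => k.+1%:R ^+ n.+3 * coef k phi K p)) => //; last exact: equiC_coef.
  by move=> q; exact: cvg_fst.
have e2 : equiC setT setT n (fun k (q : (V * 'rV[R]_2)%type) => k.+1%:R ^- n.+1 * cutpow c l m k q.2).
  apply: (@equiC_affine _ (V * 'rV[R]_2)%type 'rV[R]_2 nat setT setT snd snd n
    (fun k w => k.+1%:R ^- n.+1 * cutpow c l m k w)) => //; last exact: equiC_cutpow.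
  by move=> q; exact: cvg_snd.
rewrite (_ : (fun k => _) = fun k q => a k * ((k.+1%:R ^+ n.+3 * coef k phi K q.1) *
   (k.+1%:R ^- n.+1 * cutpow c l m k q.2))); last first.
  apply/funext => k; apply/funext => q.
  have E : k.+1%:R ^+ n.+3 = k.+1%:R ^+ 2 * k.+1%:R ^+ n.+1 :> R by rewrite -exprD.
  by rewrite E; field; rewrite expf_neq0 // pnatr_eq0.
apply: equiC_mul => //; last exact: equiC_mul.
by apply: equiC_cst => //; exists M => k _.
Qed.

Lemma multiplicity_bounded : exists M, forall k, `|multiplicity k| <= M.
Proof.
exists 2 => k; rewrite /multiplicity; case: eqP => _; rewrite ger0_norm //; lra.
Qed.

Lemma equiC_conj_term n c K : periodic_smooth K ->
  equiC setT setT n (fun k q => k.+1%:R ^+ 2 * conj_term c K k q).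
Proof.
move=> pK.
have e1 := equiC_coef_cutpow n 0 c 0 0 pK multiplicity_bounded.
have e2 := equiC_coef_cutpow n (- (pi / 2)) (- 'i * c) 0 0 pK multiplicity_bounded.
rewrite (_ : (fun k => _) = fun k q =>
  k.+1%:R ^+ 2 * (multiplicity k * (coef k 0 K q.1 * cutpow c 0 0 k q.2)) +
  k.+1%:R ^+ 2 * (multiplicity k * (coef k (- (pi / 2)) K q.1 * cutpow (- 'i * c) 0 0 k q.2))).
  exact: equiC_add.
by apply/funext => k; apply/funext => q; rewrite /conj_term -!mulrDr.
Qed.

Lemma smooth_conj_series c K : periodic_smooth K -> smooth (conj_series c K).
Proof. by move=> pK; apply: smooth_weighted_sum => n; exact: equiC_conj_term. Qed.

Lemma is_derive_fst (f : V -> R) (q u : (V * 'rV[R]_2)%type) a :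
  is_derive q.1 u.1 (f : V -> R^o) a -> is_derive q u (fun q => f q.1 : R^o) a.
Proof. by case=> d1 d2; split. Qed.

Lemma is_derive_snd (f : 'rV[R]_2 -> R) (q u : (V * 'rV[R]_2)%type) a :
  is_derive q.2 u.2 (f : _ -> R^o) a -> is_derive q u (fun q => f q.2 : R^o) a.
Proof. by case=> d1 d2; split. Qed.

Lemma is_derive_conj_series c K q v : periodic_smooth K ->
  is_derive q (v, 0) (conj_series c K : _ -> R^o) (conj_series c (ddir v K) q).
Proof.
move=> pK; have := is_derive_weighted_sum q (v, 0) (equiC_conj_term 1 c pK).
move/is_derive_cast; apply => //; congr weighted_sum; apply/funext => k.
have d0 (b : R[i]) : is_derive q (v, 0) (fun q : (V * 'rV[R]_2)%type => cutpow b 0 0 k q.2 : R^o) 0.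
  apply: is_derive_snd; have := is_derive0 (cutpow b 0 0 k : _ -> R^o) q.2.
  by apply.
have dc phi : is_derive q (v, 0) (fun q : (V * 'rV[R]_2)%type => coef k phi K q.1 : R^o)
    (coef k phi (ddir v K) q.1).
  by apply: is_derive_fst; exact: is_derive_coef.
have := isdZ (isdZ (isdD (isdM (dc 0) (d0 c)) (isdM (dc (- (pi / 2))) (d0 (- 'i * c))))
  (multiplicity k)) (k.+1%:R ^+ 2).
case=> _ -> ; rewrite /conj_term; congr (_ * (_ * _)).
by rewrite !mulr0 !add0r ![cutpow _ _ _ _ _ * _]mulrC.
Qed.

Definition conj_dseries c K (q : (V * 'rV[R]_2)%type) : R :=
  weighted_sum (fun k => k.+1%:R ^+ 2 * (multiplicity k * (coef k 0 K q.1 * (k%:R * cutpow c 1 0 k q.2) +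
    coef k (- (pi / 2)) K q.1 * (k%:R * cutpow (- 'i * c) 1 0 k q.2)))).

(* The derivative depends on the direction u only through the product [c * plane u]:
   these are the Cauchy-Riemann equations. *)
Lemma is_derive_conj_series_disk c K q u : periodic_smooth K -> sqnorm (plane q.2) < 1 ->
  is_derive q (0, u) (conj_series c K : _ -> R^o) (conj_dseries (c * plane u) K q).
Proof.
move=> pK q1; have := is_derive_weighted_sum q (0, u) (equiC_conj_term 1 c pK).
move/is_derive_cast; apply => //; congr weighted_sum; apply/funext => k.
have d0 (b : R[i]) : is_derive q (0, u) (fun q : (V * 'rV[R]_2)%type => cutpow b 0 0 k q.2 : R^o)
    (k%:R * cutpow (b * plane u) 1 0 k q.2).
  apply: is_derive_snd; have /is_derive_cast := is_derive_cutpow b 0 0 k q.2 u.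
  apply => //; rewrite subn0; case: k => [|k]; first by rewrite !mul0r addr0.
  (* Inside the disk and for positive k the cutoff is evaluated at a negative number, where its
     derivative vanishes. *)
  by rewrite {2}/cutpow cutoffn_left ?mulr0 ?addr0 // pmulr_rlt0 ?ltr0n // subr_lt0.
have dc phi : is_derive q (0, u) (fun q : (V * 'rV[R]_2)%type => coef k phi K q.1 : R^o) 0.
  apply: is_derive_fst; have := is_derive0 (coef k phi K : V -> R^o) q.1.
  by apply.
have := isdZ (isdZ (isdD (isdM (dc 0) (d0 c)) (isdM (dc (- (pi / 2))) (d0 (- 'i * c))))
  (multiplicity k)) (k.+1%:R ^+ 2).
by case=> _ ->; rewrite !mulr0 !addr0 (mulrA (- 'i)).
Qed.

Lemma conj_series_cvg c K q : periodic_smooth K ->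
  (fun n => \sum_(k < n) conj_term c K k q) @ \oo --> conj_series c K q.
Proof.
move=> pK; apply: weighted_sum_cvg.
by have [M hM] := equiC_bounded q (equiC_conj_term 0 c pK); exists M => k; exact: hM.
Qed.

Lemma coef_bounded K p : periodic_smooth K -> exists M, forall k phi, `|coef k phi K p| <= M.
Proof.
move=> pK; have [M hM] := equiC_bounded p (slices 0 pK.1).
exists M => k phi; rewrite -[leRHS]mul1r.
apply: (functional_bound (@circle_mean_functional R)).
  by apply: contfM; [exact: periodic_contf|exact: contf_cos].
move=> t ht; rewrite normrM; apply: le_trans (hM t ht).
by rewrite ler_piMr // ler_norml cos_geN1 cos_le1.
Qed.

(** One integration by parts bounds (k + 1) |coef| uniformly in the phase, so the phase may vary
    with k; it will contain -k phi. *)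
Lemma coef_cvg0 (phi : nat -> R) K p : periodic_smooth K ->
  (fun k => coef k (phi k) K p) @ \oo --> (0 : R).
Proof.
move=> pK; have [M1 h1] := coef_bounded p pK.
have [M2 h2] := coef_bounded p (periodic_dtheta pK).
have hM k f : k.+1%:R * `|coef k f K p| <= M1 + M2.
  rewrite -natr1 mulrDl mul1r addrC; apply: lerD => //.
  by rewrite -[k%:R]normr_nat -normrM coef_parts.
apply/cvgrPdist_le => e e0.
have M0 : 0 <= M1 + M2 by apply: le_trans (hM 0%N 0); rewrite mulr_ge0.
have := archi_boundP (divr_ge0 M0 (ltW e0)).
set N := Num.bound _ => hN; near=> k.
have Nk : (N <= k)%N by near: k; exact: nbhs_infty_ge.
have k0 : 0 < k.+1%:R :> R by rewrite ltr0n.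
rewrite sub0r normrN -(ler_pM2l k0); apply: le_trans (hM k _) _; rewrite -ler_pdivrMr //.
by apply: le_trans (ltW hN) _; rewrite ler_nat ltnW // ltnS.
Unshelve. all: by end_near. Qed.

Definition unit_row (phi : R) : 'rV[R]_2 := \row_(i < 2) [:: cos phi; sin phi]`_i.

Lemma plane_unit_row phi k : plane (unit_row phi) ^+ k = cos (k%:R * phi) +i* sin (k%:R * phi).
Proof.
elim: k => [|k IH]; first by rewrite expr0 mul0r cos0 sin0.
rewrite exprS IH -[k.+1%:R]natr1 mulrDl mul1r sinD cosD /plane !mxE /=.
by apply/eqP; rewrite eq_complex /=; apply/andP; split; apply/eqP; ring.
Qed.

Lemma cutpow_unit_row c phi k :
  cutpow c 0 0 k (unit_row phi) = complex.Re (c * (cos (k%:R * phi) +i* sin (k%:R * phi))).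
Proof.
rewrite /cutpow subn0 plane_unit_row /cutoffn /= cutoff_left ?mulr1 //.
by rewrite /sqnorm /plane !mxE /= cos2Dsin2 subrr mulr0.
Qed.

Lemma circle_mean_comb (f g : R -> R) (a b : R) : contf f -> contf g ->
  a * circle_mean f + b * circle_mean g = circle_mean (fun t => a * f t + b * g t).
Proof.
move=> cf cg; have F := @circle_mean_functional R.
by rewrite (functionalD F) ?(functionalZ F) //; exact: (functional_admZ F).
Qed.

Lemma conj_term_re K k p phi : periodic_smooth K ->
  conj_term 1 K k (p, unit_row phi) =
  multiplicity k * circle_mean (fun t => K t p * cos (k%:R * (t - phi))).
Proof.
move=> pK; rewrite /conj_term !cutpow_unit_row /=; congr (_ * _).
have cK f : contf (fun t => K t p * cos (k%:R * t + f)).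
  by apply: contfM; [exact: periodic_contf|exact: contf_cos].
rewrite ![coef _ _ _ _ * _]mulrC /coef circle_mean_comb //; congr circle_mean.
by apply/funext => t; rewrite addr0 cosBpihalf mulrBr cosB; ring.
Qed.

Lemma conj_term_im K k p phi : periodic_smooth K ->
  conj_term (- 'i) K k (p, unit_row phi) =
  - (multiplicity k * circle_mean (fun t => K t p * sin (k%:R * (t - phi)))).
Proof.
move=> pK; rewrite /conj_term !cutpow_unit_row /= -[RHS]mulrN; congr (_ * _).
have cK f : contf (fun t => K t p * cos (k%:R * t + f)).
  by apply: contfM; [exact: periodic_contf|exact: contf_cos].
have cs : contf (fun t => K t p * sin (k%:R * (t - phi))).
  apply: contfM; first exact: periodic_contf.
  have := @contf_cos R k (- (k%:R * phi) - pi / 2); congr contf; apply/funext => t.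
  by rewrite addrA cosBpihalf mulrBr.
rewrite ![coef _ _ _ _ * _]mulrC /coef circle_mean_comb //.
rewrite -[RHS]mulN1r -(functionalZ (@circle_mean_functional R)) //; congr circle_mean.
by apply/funext => t; rewrite addr0 cosBpihalf mulrBr sinB; ring.
Qed.

(** The decay of the coefficients makes the series converge and [fourier_inversion] identifies the
    sum; the mode 0, which has multiplicity 1, is split off. *)
Lemma conj_series_inversion K p phi : periodic_smooth K ->
  conj_series 1 K (p, unit_row phi) = K phi p.
Proof.
move=> pK; have pK1 := periodic_dtheta pK; have pK2 := periodic_dtheta pK1.
apply: (@fourier_inversion R (K^~ p) (dtheta K ^~ p) (dtheta (dtheta K) ^~ p)).
- by move=> t; exact: is_derive_theta pK.1.
- by move=> t; exact: is_derive_theta pK1.1.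
- exact: periodic_contf.
- by move=> t; exact: pK.2.
have := @conj_series_cvg 1 K (p, unit_row phi) pK; rewrite -(@cvg_shiftS R^o).
set s := (X in X @ _); set s' := (X in _ -> X @ _ --> _).
suff -> : s = s' by [].
apply/funext => n; rewrite /s /s' /= big_ord_recl /= conj_term_re // /multiplicity /= mul1r.
congr (_ + _); first by congr circle_mean; apply/funext => t; rewrite mul0r cos0 mulr1.
by rewrite mulr_sumr; apply: eq_bigr => k _; rewrite conj_term_re.
Qed.

Lemma coef_sin_shift G k p phi : coef k (- (k%:R * phi) - pi / 2) G p =
  circle_mean (fun t => G t p * sin (k%:R * (t - phi))).
Proof. by congr circle_mean; apply/funext => t; rewrite addrA cosBpihalf mulrBr. Qed.

(** The mode 0 contributes nothing to the conjugate series, so it is enough to bring the partial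
    sums of the sine modes into a closed form [s] and pass to the limit. *)
Lemma conj_series_im_limit K p phi (S : R) (s : nat -> R) : periodic_smooth K ->
  (forall n, \sum_(k < n) - (2 * circle_mean (fun t => K t p * sin (k.+1%:R * (t - phi)))) = s n) ->
  s @ \oo --> S -> conj_series (- 'i) K (p, unit_row phi) = S.
Proof.
move=> pK hs sS.
have := @conj_series_cvg (- 'i) K (p, unit_row phi) pK; rewrite -(@cvg_shiftS R^o).
set s' := (X in X @ _); suff -> : s' = s.
  by move=> h; exact: (@cvg_unique R^o (@norm_hausdorff _ _) _ _ _ _ h sS).
apply/funext => n; rewrite /s' /= -hs big_ord_recl /= conj_term_im // /multiplicity /= mul1r.
rewrite [X in - X](_ : _ = 0) ?oppr0 ?add0r; last first.
  rewrite -[RHS](circle_mean_cst (0 : R)); congr circle_mean; apply/funext => t.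
  by rewrite mul0r sin0 mulr0.
by apply: eq_bigr => k _; rewrite conj_term_im.
Qed.

(* The factor cos (t - phi) - 1, like sin (t - phi) below, makes the conjugate series telescope. *)
Lemma conj_series_radial K G p phi : periodic_smooth K -> periodic_smooth G ->
  (forall t, K t p = G t p * (cos (t - phi) - 1)) ->
  conj_series (- 'i) K (p, unit_row phi) = circle_mean (fun t => G t p * sin (t - phi)).
Proof.
move=> pK pG E.
pose S k := coef k (- (k%:R * phi) - pi / 2) G p.
have cS k : contf (fun t => G t p * cos (k%:R * t + (- (k%:R * phi) - pi / 2))).
  by apply: contfM; [exact: periodic_contf|exact: contf_cos].
(* With d = t - phi and e = (k + 1) d the factor is 2 sin e (1 - cos d) = 2 sin e - sin(e + d) -
   sin(e - d), minus a second difference. *)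
have E1 k : - (2 * circle_mean (fun t => K t p * sin (k.+1%:R * (t - phi)))) =
    (S k.+1 - S k) - (S k.+2 - S k.+1).
  have F := @circle_mean_functional R.
  rewrite /S /coef -!(functionalB F) //; try exact: (functional_admB F).
  rewrite -mulNr -(functionalZ F); last first.
    apply: contfM; first exact: periodic_contf.
    have := @contf_cos R k.+1 (- (k.+1%:R * phi) - pi / 2); congr contf; apply/funext => t.
    by rewrite addrA cosBpihalf mulrBr.
  congr circle_mean; apply/funext => t; rewrite E !addrA !cosBpihalf -!mulrBr.
  rewrite (_ : k.+2%:R * (t - phi) = k.+1%:R * (t - phi) + (t - phi)); last first.
    by rewrite -[k.+2%:R]natr1 mulrDl mul1r.
  rewrite (_ : k%:R * (t - phi) = k.+1%:R * (t - phi) - (t - phi)); last first.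
    by rewrite -[k.+1%:R]natr1 mulrDl mul1r addrK.
  move: (k.+1%:R * _) => e; move: (t - phi) => d.
  by rewrite sinB sinD; ring.
apply: (conj_series_im_limit (s := fun n => (S 1%N - S 0%N) - (S n.+1 - S n)) pK).
  move=> n; under eq_bigr do rewrite E1.
  elim: n => [|n IH]; first by rewrite big_ord0 subrr.
  by rewrite big_ord_recr /= IH addrA subrK.
rewrite (_ : circle_mean _ = S 1%N - S 0%N - (0 - 0)); last first.
  have -> : S 0%N = 0.
    rewrite /S coef_sin_shift -[RHS](circle_mean_cst (0 : R)); congr circle_mean.
    by apply/funext => t; rewrite mul0r sin0 mulr0.
  rewrite !subr0 /S coef_sin_shift; congr circle_mean.
  by apply/funext => t; rewrite mul1r.
have cS0 : S @ \oo --> (0 : R^o).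
  by rewrite /S; exact: (@coef_cvg0 (fun k => - (k%:R * phi) - pi / 2)).
apply: (@cvgB _ R^o); first exact: cvg_cst.
by apply: (@cvgB _ R^o) => //; rewrite (@cvg_shiftS R^o).
Qed.

Lemma conj_series_angular K G p phi : periodic_smooth K -> periodic_smooth G ->
  (forall t, K t p = G t p * sin (t - phi)) ->
  conj_series (- 'i) K (p, unit_row phi) = - circle_mean (fun t => G t p * (1 + cos (t - phi))).
Proof.
move=> pK pG E; have F := @circle_mean_functional R.
pose S k := coef k (- (k%:R * phi)) G p.
have cS k : contf (fun t => G t p * cos (k%:R * t + (- (k%:R * phi)))).
  by apply: contfM; [exact: periodic_contf|exact: contf_cos].
(* With d = t - phi and e = (k + 1) d, -2 sin d sin e = cos(e + d) - cos(e - d), a difference over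
   two steps. *)
have E1 k : - (2 * circle_mean (fun t => K t p * sin (k.+1%:R * (t - phi)))) = S k.+2 - S k.
  rewrite /S /coef -!(functionalB F) //.
  rewrite -mulNr -(functionalZ F); last first.
    apply: contfM; first exact: periodic_contf.
    have := @contf_cos R k.+1 (- (k.+1%:R * phi) - pi / 2); congr contf; apply/funext => t.
    by rewrite addrA cosBpihalf mulrBr.
  congr circle_mean; apply/funext => t; rewrite E -!mulrBr.
  rewrite (_ : k.+2%:R * (t - phi) = k.+1%:R * (t - phi) + (t - phi)); last first.
    by rewrite -[k.+2%:R]natr1 mulrDl mul1r.
  rewrite (_ : k%:R * (t - phi) = k.+1%:R * (t - phi) - (t - phi)); last first.
    by rewrite -[k.+1%:R]natr1 mulrDl mul1r addrK.
  move: (k.+1%:R * _) => e; move: (t - phi) => d.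
  by rewrite cosB cosD; ring.
apply: (conj_series_im_limit (s := fun n => - (S 0%N + S 1%N) + (S n.+1 + S n)) pK).
  move=> n; under eq_bigr do rewrite E1.
  elim: n => [|n IH]; first by rewrite big_ord0 [S 1%N + _]addrC addNr.
  by rewrite big_ord_recr /= IH; ring.
rewrite (_ : - circle_mean _ = - (S 0%N + S 1%N) + (0 + 0)); last first.
  rewrite !addr0 /S /coef -(functionalD F) //; congr (- circle_mean _).
  by apply/funext => t; rewrite !mul0r oppr0 !addr0 cos0 !mul1r mulrDr.
have cS0 : S @ \oo --> (0 : R^o) by exact: (@coef_cvg0 (fun k => - (k%:R * phi))).
apply: (@cvgD _ R^o); first exact: cvg_cst.
by apply: (@cvgD _ R^o) => //; rewrite (@cvg_shiftS R^o).
Qed.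

End ConjugateSeries.

(** * Complex differentiability from the Cauchy-Riemann equations *)

Section ComplexDerivability.
Context {R : realType}.
Implicit Types (z w h L : R[i]).

Lemma normC_sqr z : `|z| ^+ 2 = (sqnorm z)%:C.
Proof.
case: z => a b; rewrite normc_def /= -rmorphXn /= sqr_sqrtr //.
by rewrite addr_ge0 // sqr_ge0.
Qed.

Lemma normC_le z1 z2 (d : R) : 0 <= d -> (`|z1| <= d%:C * `|z2|) = (sqnorm z1 <= d ^+ 2 * sqnorm z2).
Proof.
move=> d0; have d0' : 0 <= d%:C :> R[i] by rewrite lecR.
by rewrite -ler_sqr ?nnegrE ?mulr_ge0 // exprMn !normC_sqr -rmorphXn -rmorphM lecR.
Qed.

(** A criterion in real squared moduli, which spares the estimates from norms with values in
    [R[i]]. *)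
Lemma derivable_remainder (F : R[i] -> R[i]) L w0 :
  (forall d : R, 0 < d -> exists2 e : R, 0 < e &
     forall h, sqnorm h < e -> sqnorm (F (h + w0) - F w0 - L * h) <= d ^+ 2 * sqnorm h) ->
  derivable (F : R[i]^o -> R[i]^o) (w0 : R[i]^o) (1 : R[i]^o).
Proof.
move=> H; apply/cvg_ex; exists L; apply/cvgrPdist_le => d d0.
(* A positive element of [R[i]] is real. *)
have dE : d = (complex.Re d)%:C by rewrite RRe_real // gtr0_real.
have rd0 : 0 < complex.Re d by rewrite -ltcR -dE.
have [e e0 he] := H _ rd0.
have e0' : 0 < (Num.sqrt e)%:C :> R[i] by rewrite ltcR sqrtr_gt0.
near=> h.
have h0 : h != 0 by near: h; exact: nbhs_dnbhs_neq.
have hn : `|h| < (Num.sqrt e)%:C by near: h; exact: (@dnbhs0_lt _ R[i]^o).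
have hs : sqnorm h < e.
  rewrite -ltcR -normC_sqr -(sqr_sqrtr (ltW e0)) rmorphXn /=.
  by rewrite ltr_sqr ?nnegrE // ltW.
rewrite distrC /GRing.scale /= mulr1.
have -> : h^-1 * (F (h + w0) - F w0) - L = h^-1 * (F (h + w0) - F w0 - L * h).
  by rewrite [RHS]mulrBr; congr (_ - _); rewrite mulrCA mulVf ?mulr1.
rewrite normrM normfV ler_pdivrMl ?normr_gt0 // [leRHS]mulrC dE (normC_le _ _ (ltW rd0)).
exact: he.
Unshelve. all: by end_near. Qed.

Definition complex_row w : 'rV[R]_2 := \row_(i < 2) [:: complex.Re w; complex.Im w]`_i.

Lemma plane_complex_row w : plane (complex_row w) = w.
Proof. by rewrite /plane !mxE /=; case: w. Qed.

Lemma complex_row_plane (v : 'rV[R]_2) : complex_row (plane v) = v.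
Proof.
apply/rowP => i; rewrite mxE /plane.
by case: i => -[|[|//]] hi /=; congr (v _ _); apply: val_inj.
Qed.

Lemma complex_rowD w z : complex_row (w + z) = complex_row w + complex_row z.
Proof.
apply/rowP => i; rewrite !mxE; case: w => a b; case: z => u v.
by case: i => -[|[|//]] hi.
Qed.

Lemma sum2 (F : 'I_2 -> R) : \sum_i F i = F 0 + F 1.
Proof. by rewrite !big_ord_recl big_ord0 addr0; congr (_ + F _); apply: val_inj. Qed.

(** The factor d^2/2 leaves room for the real and the imaginary part of a remainder to add up to
    d^2. *)
Lemma linear_remainder_sqr (x y A B A' B' d : R) : `|A - A'| <= d / 2 -> `|B - B'| <= d / 2 ->
  (x * A + y * B - (A' * x + B' * y)) ^+ 2 <= d ^+ 2 / 2 * (x ^+ 2 + y ^+ 2).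
Proof.
move=> h1 h2; have sq (u : R) : `|u| <= d / 2 -> u ^+ 2 <= d ^+ 2 / 4.
  by rewrite ler_norml => /andP[p1 p2]; nra.
have := sq _ h1; have := sq _ h2; rewrite {h1 h2 sq}.
rewrite (_ : x * A + y * B - _ = x * (A - A') + y * (B - B')); last by ring.
move: (A - A') (B - B') => {A A' B B'} A B hB hA.
apply: (@le_trans _ _ (2 * (x ^+ 2 * A ^+ 2 + y ^+ 2 * B ^+ 2))).
  by have := sqr_ge0 (x * A - y * B); nra.
have := ler_wpM2l (sqr_ge0 x) hA; have := ler_wpM2l (sqr_ge0 y) hB; lra.
Qed.

(** Both components have a first order expansion by the mean value theorem and continuity of the
    partial derivatives; the Cauchy-Riemann equations, stated by multiplying the direction by i,
    turn the real differential into multiplication by a complex number. *)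
Lemma derivable_cauchy_riemann (a b : 'rV[R]_2 -> R) w0 :
  smooth a -> smooth b ->
  (forall u, 'D_(complex_row ('i * plane u)) a (complex_row w0) = - 'D_u b (complex_row w0)) ->
  (forall u, 'D_(complex_row ('i * plane u)) b (complex_row w0) = 'D_u a (complex_row w0)) ->
  derivable (fun w : R[i]^o => a (complex_row w) +i* b (complex_row w) : R[i]^o) w0 (1 : R[i]^o).
Proof.
move=> sa sb cr1 cr2.
pose e0 : 'rV[R]_2 := delta_mx 0 0; pose e1 : 'rV[R]_2 := delta_mx 0 1.
have ie : complex_row ('i * plane e0) = e1.
  apply/rowP => i; rewrite !mxE /plane /e0 /e1 !mxE /=.
  by case: i => -[|[|//]] hi /=; ring.
have a1 : 'D_e1 a (complex_row w0) = - 'D_e0 b (complex_row w0) by rewrite -ie cr1.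
have b1 : 'D_e1 b (complex_row w0) = 'D_e0 a (complex_row w0) by rewrite -ie cr2.
apply: (@derivable_remainder _ ('D_e0 a (complex_row w0) +i* 'D_e0 b (complex_row w0))) => d d0.
have near_D (f : 'rV[R]_2 -> R) (e : 'rV[R]_2) : smooth f -> exists2 r : R, 0 < r &
    forall v : 'rV[R]_2, `|v| < r -> `|'D_e f (v + complex_row w0) - 'D_e f (complex_row w0)| <= d / 2.
  move=> sf; have := smooth_continuous (smooth_derive e sf) (x := complex_row w0).
  move/cvgrPdist_le => /(_ _ (divr_gt0 d0 (ltr0n _ 2))) /nbhs_ballP[r /= r0 hr].
  exists r => // v vr; rewrite distrC; apply: hr.
  by rewrite -ball_normE /= opprD addrCA subrr addr0 normrN.
have [r1 r10 h1] := near_D a e0 sa; have [r2 r20 h2] := near_D a e1 sa.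
have [r3 r30 h3] := near_D b e0 sb; have [r4 r40 h4] := near_D b e1 sb.
pose r := Num.min (Num.min r1 r2) (Num.min r3 r4).
have r0 : 0 < r by rewrite !lt_min r10 r20 r30 r40.
exists (r ^+ 2) => [|h hr]; first by rewrite exprn_gt0.
have hn (s : R) : 0 <= s <= 1 -> `|s *: complex_row h| < r.
  move=> /andP[s0 s1]; rewrite normrZ (ger0_norm s0).
  apply: (@le_lt_trans _ _ `|complex_row h|); first by rewrite ler_piMl.
  rewrite /Num.Def.normr /= mx_normrE; apply/bigmax_ltP; split => // -[i j] _ /=.
  rewrite -ltr_sqr ?nnegrE // ?(ltW r0) // real_normK ?num_real //; apply: le_lt_trans hr.
  rewrite mxE /sqnorm; case: j => -[|[|//]] hj /=; [rewrite lerDl|rewrite lerDr]; exact: sqr_ge0.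
have key (f : 'rV[R]_2 -> R) : smooth f ->
   (forall v : 'rV[R]_2, `|v| < r -> `|'D_e0 f (v + complex_row w0) - 'D_e0 f (complex_row w0)| <= d / 2) ->
   (forall v : 'rV[R]_2, `|v| < r -> `|'D_e1 f (v + complex_row w0) - 'D_e1 f (complex_row w0)| <= d / 2) ->
   (f (complex_row (h + w0)) - f (complex_row w0) - ('D_e0 f (complex_row w0) * complex.Re h +
      'D_e1 f (complex_row w0) * complex.Im h)) ^+ 2 <= d ^+ 2 / 2 * sqnorm h.
  move=> sf hf0 hf1.
  have [s s01 E] := @mvt_dir _ _ f (complex_row w0) (complex_row h)
    (fun y => smooth_derivable sf).
  rewrite complex_rowD E derive_row; last exact: (sf 1%N).
  rewrite sum2 -/e0 -/e1 !mxE /=.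
  have := hf0 _ (hn _ s01); have := hf1 _ (hn _ s01).
  move: ('D_e0 f _) ('D_e1 f _) ('D_e0 f _) ('D_e1 f _) => A' B' A B.
  by move=> p1 p2; exact: linear_remainder_sqr.
have lt_r (v : 'rV[R]_2) : `|v| < r -> [/\ `|v| < r1, `|v| < r2, `|v| < r3 & `|v| < r4].
  by rewrite !lt_min => /andP[/andP[-> ->] /andP[-> ->]].
have ka := key a sa (fun v vr => h1 v (let: And4 x _ _ _ := lt_r v vr in x))
  (fun v vr => h2 v (let: And4 _ x _ _ := lt_r v vr in x)).
have kb := key b sb (fun v vr => h3 v (let: And4 _ _ x _ := lt_r v vr in x))
  (fun v vr => h4 v (let: And4 _ _ _ x := lt_r v vr in x)).
move: ka kb; rewrite a1 b1.
move: ('D_e0 a _) ('D_e0 b _) (a _) (b _) (a _) (b _) => A B u1 u2 u3 u4.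
rewrite /sqnorm; clear; case: h => x y /= ka kb.
have -> : d ^+ 2 * (x ^+ 2 + y ^+ 2) =
  d ^+ 2 / 2 * (x ^+ 2 + y ^+ 2) + d ^+ 2 / 2 * (x ^+ 2 + y ^+ 2) by field.
by apply: le_trans (lerD ka kb); rewrite le_eqVlt; apply/orP; left; apply/eqP; ring.
Qed.

Context {V : normedModType R}.

(* The holomorphic function of w in the disk whose real part has boundary values [K ^~ p]. *)
Definition conj_fun (K : R -> V -> R) (p : V) (w : R[i]) : R[i] :=
  conj_series 1 K (p, complex_row w) +i* conj_series (- 'i) K (p, complex_row w).

(** Only the product of c with the direction matters, so multiplying the direction by i amounts to
    multiplying c by i. Up to sign this exchanges c = 1 and c = -i, the real and the imaginary
    part. *)
Lemma derivable_conj_fun (K : R -> V -> R) p w0 : periodic_smooth K -> sqnorm w0 < 1 ->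
  derivable (conj_fun K p : R[i]^o -> R[i]^o) (w0 : R[i]^o) (1 : R[i]^o).
Proof.
move=> pK w1.
have pE (t : R) (u v : 'rV[R]_2) : t *: ((0, u) : (V * 'rV[R]_2)%type) + (p, v) = (p, t *: u + v).
  by rewrite [LHS]surjective_pairing /= scaler0 add0r.
have sc c : smooth (fun v => conj_series c K (p, v)).
  apply: (@smooth_affine _ _ (V * 'rV[R]_2)%type (fun v : 'rV[R]_2 => (p, v)) (fun v => (0, v))).
  - by move=> t v x; rewrite pE.
  - move=> v; apply: (@cvg_pair _ V _ (nbhs v) (nbhs p) (nbhs v) _ _ _ (fun=> p) id); [exact: cvg_cst|exact: cvg_id].
  - exact: smooth_conj_series.
have dc c u : 'D_u (fun v => conj_series c K (p, v)) (complex_row w0) =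
    conj_dseries (c * plane u) K (p, complex_row w0).
  have := @is_derive_conj_series_disk _ _ c K (p, complex_row w0) u pK.
  rewrite /= plane_complex_row => /(_ w1)[_ <-].
  have E : (fun h : R => h^-1 *: ((conj_series c K (h *: ((0, u) : (V * 'rV[R]_2)%type) +
       (p, complex_row w0)) : R^o) - conj_series c K (p, complex_row w0))) =
     (fun h : R => h^-1 *: ((conj_series c K (p, h *: u + complex_row w0) : R^o) -
       conj_series c K (p, complex_row w0))).
    by apply/funext => h; rewrite pE.
  by rewrite [RHS]/derive /= E.
have cr2 u : 'D_(complex_row ('i * plane u)) (fun v => conj_series (- 'i) K (p, v)) (complex_row w0) =
    'D_u (fun v => conj_series 1 K (p, v)) (complex_row w0).
  have E : - 'i * plane (complex_row ('i * plane u)) = 1 * plane u.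
    by rewrite plane_complex_row mulrA mulNr -expr2 sqr_i opprK.
  exact: etrans (dc _ _) (etrans (congr1 (fun c => conj_dseries c K _) E) (esym (dc _ _))).
have cr1 u : 'D_(complex_row ('i * plane u)) (fun v => conj_series 1 K (p, v)) (complex_row w0) =
    - 'D_u (fun v => conj_series (- 'i) K (p, v)) (complex_row w0).
  (* The sign is taken out so that the direction becomes -i u, which for c = 1 yields the product
     belonging to c = -i and direction u. *)
  have -> : complex_row ('i * plane u) = (-1) *: complex_row (- 'i * plane u).
    by apply/rowP => i; rewrite !mxE; case: (plane u) => x y;
       case: i => -[|[|//]] hi /=; ring.
  have [_ ->] := is_derive_scale (-1) (smooth_derivable (x := complex_row w0)
    (v := complex_row (- 'i * plane u)) (sc 1)).
  have E : 1 * plane (complex_row (- 'i * plane u)) = - 'i * plane u.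
    by rewrite plane_complex_row mul1r.
  apply: etrans (mulN1r _) (congr1 -%R _).
  exact: etrans (dc _ _) (etrans (congr1 (fun c => conj_dseries c K _) E) (esym (dc _ _))).
exact: (@derivable_cauchy_riemann _ _ w0 (sc 1) (sc (- 'i)) cr1 cr2).
Qed.

End ComplexDerivability.

(** * Curvature of a metric in dimension four *)

Section FourIndices.
Context {R : realType}.

Definition o0 : 'I_4 := @Ordinal 4 0 isT.
Definition o1 : 'I_4 := @Ordinal 4 1 isT.
Definition o2 : 'I_4 := @Ordinal 4 2 isT.
Definition o3 : 'I_4 := @Ordinal 4 3 isT.

Lemma ord4_ind (P : 'I_4 -> Prop) : P o0 -> P o1 -> P o2 -> P o3 -> forall i, P i.
Proof.
by move=> p0 p1 p2 p3 [[|[|[|[|//]]]] h]; [move: p0|move: p1|move: p2|move: p3];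
  congr P; apply: val_inj.
Qed.

Lemma sum4 (T : nmodType) (F : 'I_4 -> T) : \sum_i F i = F o0 + F o1 + F o2 + F o3.
Proof.
rewrite !big_ord_recl big_ord0 addr0 !addrA.
by congr (_ + _ + _ + _); congr F; apply: val_inj.
Qed.

Definition tab (s : seq (seq R)) : 'M[R]_4 := \matrix_(i < 4, j < 4) nth 0 (nth [::] s i) j.

Lemma tabE s i j : tab s i j = nth 0 (nth [::] s i) j.
Proof. by rewrite mxE. Qed.

(* Multiplying the matrix of the index tuple by the Vandermonde matrix of
   (0, 1, 2, 3) gives the Vandermonde matrix of (a, b, c, d). *)
Lemma levi_civitaE (a b c d : 'I_4) :
  levi_civita R a b c d * 12 =
  (b%:R - a%:R) * (c%:R - a%:R) * (d%:R - a%:R) * (c%:R - b%:R) * (d%:R - b%:R) * (d%:R - c%:R).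
Proof.
pose D (v : 'I_4 -> R) : R := \det (Vandermonde 4 (\row_j v j)).
have prod4 (F : 'I_4 -> R) : \prod_i F i = F o0 * F o1 * F o2 * F o3.
  rewrite !big_ord_recl big_ord0 mulr1 !mulrA.
  by congr (_ * _ * _ * _); congr F; apply: val_inj.
have DE v : D v = (v o1 - v o0) * (v o2 - v o0) * (v o3 - v o0) * (v o2 - v o1) *
    (v o3 - v o1) * (v o3 - v o2).
  rewrite /D det_Vandermonde; under eq_bigr => i _ do rewrite big_mkcond prod4.
  by rewrite prod4 /= !mxE; ring.
have d12 : D (fun j => j%:R) = 12 by rewrite DE /=; ring.
rewrite -[X in _ * X]d12 /levi_civita /D -[X in _ * X]det_tr -det_mulmx.
have := DE (fun i => (tnth [tuple a; b; c; d] i)%:R).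
rewrite /D -[LHS]det_tr !(tnth_nth a) /= => <-; congr (\det _).
apply/matrixP => i k; rewrite !mxE (bigD1 (tnth [tuple a; b; c; d] i)) //= !mxE eqxx mul1r.
by rewrite big1 ?addr0 // => j ji; rewrite !mxE eq_sym (negbTE ji) mul0r.
Qed.

(** Half the contraction of an antisymmetric matrix with the Levi-Civita symbol, written out. *)
Definition dual4 (G : 'M[R]_4) : 'M[R]_4 := tab
  [:: [:: 0; G o2 o3; - G o1 o3; G o1 o2];
      [:: - G o2 o3; 0; G o0 o3; - G o0 o2];
      [:: G o1 o3; - G o0 o3; 0; G o0 o1];
      [:: - G o1 o2; G o0 o2; - G o0 o1; 0]].

Lemma levi_civita_contract (G : 'M[R]_4) (a b : 'I_4) : G^T = - G ->
  \sum_c \sum_d levi_civita R a b c d * G c d = 2 * dual4 G a b.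
Proof.
move=> GT; have sk c d : G d c = - G c d by have /matrixP/(_ c d) := GT; rewrite !mxE.
have n12 : 12 != 0 :> R by rewrite pnatr_eq0.
have lE (c d : 'I_4) : levi_civita R a b c d =
  (b%:R - a%:R) * (c%:R - a%:R) * (d%:R - a%:R) * (c%:R - b%:R) * (d%:R - b%:R) * (d%:R - c%:R) / 12.
  by rewrite -levi_civitaE mulfK.
under eq_bigr => c _ do under eq_bigr => d _ do rewrite lE.
rewrite !sum4 (sk o0 o1) (sk o0 o2) (sk o0 o3) (sk o1 o2) (sk o1 o3) (sk o2 o3) {lE}.
by rewrite mxE; elim/ord4_ind: a; elim/ord4_ind: b => /=; field.
Qed.

Lemma hodge_dual4 (g F : 'M[R]_4) : F^T = - F -> g^T = g ->
  hodge g F = Num.sqrt `|\det g| *: dual4 (invmx g *m F *m invmx g).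
Proof.
move=> FT gT; apply/matrixP => a b; rewrite mxE [RHS]mxE levi_civita_contract.
  by field.
by rewrite !trmx_mul FT trmx_inv gT mulNmx mulmxN mulmxA.
Qed.

End FourIndices.

Section MatrixFields.
Context {R : realType}.
Implicit Types (M N : 'rV[R]_4 -> 'M[R]_4) (i j k l : 'I_4) (x : 'rV[R]_4).

Definition smx M : Prop := forall a b, smooth (fun x => M x a b).

Definition Dm i M x : 'M[R]_4 := \matrix_(a < 4, b < 4) partial i (fun y => M y a b) x.

Lemma partial_isd i (f : 'rV[R]_4 -> R) x : smooth f ->
  is_derive x (delta_mx 0 i) (f : _ -> R^o) (partial i f x).
Proof. by move=> sf; exact: smooth_is_derive. Qed.

Lemma isd_partial i (f : 'rV[R]_4 -> R) x a :
  is_derive x (delta_mx 0 i) (f : _ -> R^o) a -> partial i f x = a.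
Proof. by case. Qed.

Lemma smooth_partial i (f : 'rV[R]_4 -> R) : smooth f -> smooth (partial i f).
Proof. by move=> sf; exact: smooth_derive. Qed.

Lemma partial_comm i j (f : 'rV[R]_4 -> R) x : smooth f ->
  partial i (partial j f) x = partial j (partial i f) x.
Proof. by move=> sf; exact: (schwarz x (delta_mx 0 i) (delta_mx 0 j) (sf 2%N)). Qed.

Local Opaque partial.

Lemma partial_ext i (f f' : 'rV[R]_4 -> R) x : (forall y, f y = f' y) -> partial i f x = partial i f' x.
Proof. by move=> /funext ->. Qed.

Lemma DmE i M x a b : Dm i M x a b = partial i (fun y => M y a b) x.
Proof. by rewrite mxE. Qed.

Lemma partial_sum i (f : 'I_4 -> 'rV[R]_4 -> R) x : (forall m, smooth (f m)) ->
  partial i (fun y => \sum_m f m y) x = \sum_m partial i (f m) x.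
Proof.
move=> sf; rewrite sum4.
have d m := partial_isd i x (sf m).
rewrite -(isd_partial (isdD (isdD (isdD (d o0) (d o1)) (d o2)) (d o3))).
by apply: partial_ext => y; rewrite sum4.
Qed.

Lemma smx_mul M N : smx M -> smx N -> smx (fun x => M x *m N x).
Proof.
move=> sM sN a b; rewrite (_ : (fun x => _) = fun x => \sum_m M x a m * N x m b).
  by apply: smooth_sum => m; apply: smoothM; [exact: sM|exact: sN].
by apply/funext => x; rewrite mxE.
Qed.

Lemma smx_add M N : smx M -> smx N -> smx (fun x => M x + N x).
Proof.
move=> sM sN a b; rewrite (_ : (fun x => _) = fun x => M x a b + N x a b).
  by apply: smoothD; [exact: sM|exact: sN].
by apply/funext => x; rewrite mxE.
Qed.

Lemma smx_Dm i M : smx M -> smx (Dm i M).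
Proof.
move=> sM a b; rewrite (_ : (fun x => _) = partial i (fun y => M y a b)).
  exact: smooth_partial.
by apply/funext => x; rewrite mxE.
Qed.

Lemma Dm_mul i M N x : smx M -> smx N ->
  Dm i (fun x => M x *m N x) x = Dm i M x *m N x + M x *m Dm i N x.
Proof.
move=> sM sN; apply/matrixP => a b; rewrite !mxE.
rewrite (_ : (fun y => _) = fun y => \sum_m M y a m * N y m b); last first.
  by apply/funext => y; rewrite mxE.
rewrite partial_sum; last by move=> m; apply: smoothM; [exact: sM|exact: sN].
rewrite -big_split; apply: eq_bigr => m _ /=; rewrite !mxE.
rewrite (isd_partial (isdM (partial_isd i x (sM a m)) (partial_isd i x (sN m b)))).
by rewrite addrC [N x m b * _]mulrC.
Qed.

Lemma Dm_add i M N x : smx M -> smx N ->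
  Dm i (fun x => M x + N x) x = Dm i M x + Dm i N x.
Proof.
move=> sM sN; apply/matrixP => a b; rewrite [LHS]DmE [RHS]mxE !DmE.
rewrite -(isd_partial (isdD (partial_isd i x (sM a b)) (partial_isd i x (sN a b)))).
by apply: partial_ext => y; rewrite mxE.
Qed.

Lemma Dm_tr i M x : Dm i (fun x => (M x)^T) x = (Dm i M x)^T.
Proof.
apply/matrixP => a b; rewrite !mxE; apply: partial_ext => y; by rewrite mxE.
Qed.

Lemma Dm_cst i (A : 'M[R]_4) x : Dm i (fun=> A) x = 0.
Proof. by apply/matrixP => a b; rewrite !mxE (isd_partial (isd_cst _ _ _)). Qed.

Lemma Dm_comm i j M x : smx M -> Dm i (Dm j M) x = Dm j (Dm i M) x.
Proof.
move=> sM; apply/matrixP => a b; rewrite [LHS]DmE [RHS]DmE.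
apply: etrans (partial_ext i x (fun y => DmE j M y a b)) _.
apply: etrans (partial_comm i j x (sM a b)) _.
exact: esym (partial_ext j x (fun y => DmE i M y a b)).
Qed.

Lemma smx_cst (A : 'M[R]_4) : smx (fun=> A).
Proof. by move=> a b; exact: smooth_cst. Qed.

Lemma smx_tr M : smx M -> smx (fun x => (M x)^T).
Proof.
move=> sM a b; rewrite (_ : (fun x => _) = fun x => M x b a); first exact: sM.
by apply/funext => x; rewrite mxE.
Qed.

End MatrixFields.

(** * The Levi-Civita connection and its curvature in matrix form *)

Section LeviCivita.
Local Opaque partial.
Context {R : realType} (g : 'rV[R]_4 -> 'M[R]_4) (Gam : 'I_4 -> 'rV[R]_4 -> 'M[R]_4).
Hypotheses (gsym : forall x, (g x)^T = g x) (gunit : forall x, g x \in unitmx).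

(** [Gam i x k j] stands for Gamma^k_ij. Compatibility expresses the derivatives of g by [Gam]; in
    the Koszul combination of them, symmetry cancels all terms but twice g Gam. *)
Lemma christoffel_unique :
  (forall i x, Dm i g x = (Gam i x)^T *m g x + g x *m Gam i x) ->
  (forall i j k x, Gam i x k j = Gam j x k i) ->
  forall k i j x, christoffel g k i j x = Gam i x k j.
Proof.
move=> comp sym k i j x.
have gs a b : g x a b = g x b a by rewrite -{1}gsym mxE.
have dg m a b : partial m (fun y => g y a b) x =
    (\sum_c Gam m x c a * g x c b) + \sum_c g x c a * Gam m x c b.
  have /matrixP/(_ a b) := comp m x; rewrite !mxE => ->.
  congr (_ + _); apply: eq_bigr => c _; first by rewrite !mxE.
  by rewrite [g x a c]gs.
have inner l : partial i (fun y => g y j l) x + partial j (fun y => g y i l) x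
     - partial l (fun y => g y i j) x = 2 * \sum_c g x l c * Gam i x c j.
  rewrite !dg !sum4.
  rewrite !(sym l i) !(sym l j) !(sym j i).
  rewrite (gs o0 l) (gs o1 l) (gs o2 l) (gs o3 l) (gs o0 j) (gs o1 j) (gs o2 j) (gs o3 j).
  by ring.
rewrite /christoffel; under eq_bigr => l _ do rewrite inner.
have -> : \sum_l ginv g x k l * (2 * \sum_c g x l c * Gam i x c j) =
   2 * (ginv g x *m (g x *m Gam i x)) k j.
  rewrite mxE mulr_sumr; apply: eq_bigr => l _; rewrite mulrCA; congr (_ * (_ * _)).
  by rewrite mxE.
by rewrite /ginv mulKmx // mulKf // pnatr_eq0.
Qed.

Hypotheses (comp : forall i x, Dm i g x = (Gam i x)^T *m g x + g x *m Gam i x)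
  (sym : forall i j k x, Gam i x k j = Gam j x k i) (sGam : forall i, smx (Gam i)).

Lemma christoffel_mx k i j x : christoffel g k i j x = Gam i x k j.
Proof. exact: christoffel_unique. Qed.

Definition curvature_mx i j x : 'M[R]_4 :=
  Dm i (Gam j) x - Dm j (Gam i) x + (Gam i x *m Gam j x - Gam j x *m Gam i x).

Lemma riemann_up_mx l k i j x : riemann_up g l k i j x = curvature_mx i j x l k.
Proof.
rewrite /riemann_up /curvature_mx !mxE -sumrB.
congr (_ - _ + _).
- by apply: partial_ext => y; exact: christoffel_mx.
- by apply: partial_ext => y; exact: christoffel_mx.
- by apply: eq_bigr => m _; rewrite !christoffel_mx.
Qed.

(** Symmetry of [Gam] makes the derivative terms and the product terms cancel separately in the
    cyclic sum. *)
Lemma bianchi l k i j x :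
  curvature_mx i j x l k + curvature_mx j k x l i + curvature_mx k i x l j = 0.
Proof.
have d a b c : Dm a (Gam b) x l c = Dm a (Gam c) x l b.
  by rewrite !DmE; apply: partial_ext => y; exact: sym.
have q a b c : (Gam a x *m Gam b x) l c = (Gam a x *m Gam c x) l b.
  by rewrite !mxE; apply: eq_bigr => m _; congr (_ * _); exact: sym.
have mE a b c : curvature_mx a b x l c = Dm a (Gam b) x l c - Dm b (Gam a) x l c +
    ((Gam a x *m Gam b x) l c - (Gam b x *m Gam a x) l c).
  rewrite /curvature_mx; move: (Dm _ _ _) (Dm _ _ _) (_ *m _) (_ *m _) => A B C D.
  by rewrite !mxE.
have alg (D Q : 'I_4 -> 'I_4 -> 'I_4 -> R) : (forall a b c, D a b c = D a c b) ->
    (forall a b c, Q a b c = Q a c b) ->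
    D i j k - D j i k + (Q i j k - Q j i k) + (D j k i - D k j i + (Q j k i - Q k j i)) +
    (D k i j - D i k j + (Q k i j - Q i k j)) = 0.
  move=> {d q mE} d q; rewrite (d k i j) (d i k j) (d j k i) (q k i j) (q i k j) (q j k i).
  by ring.
rewrite !mE.
exact: (alg (fun a b c => Dm a (Gam b) x l c) (fun a b c => (Gam a x *m Gam b x) l c) d q).
Qed.

End LeviCivita.

Lemma addmxE (R : realType) m n (A B : 'M[R]_(m, n)) a b : (A + B) a b = A a b + B a b.
Proof. by rewrite mxE. Qed.

Lemma oppmxE (R : realType) m n (A : 'M[R]_(m, n)) a b : (- A) a b = - A a b.
Proof. by rewrite mxE. Qed.

(** * Connections in a moving frame *)

Section Frame.
Context {R : realType} (g E F : 'rV[R]_4 -> 'M[R]_4) (om : 'I_4 -> 'rV[R]_4 -> 'M[R]_4)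
  (eta : 'M[R]_4).
Hypotheses (gE : forall x, g x = (E x)^T *m eta *m E x) (eta_sym : eta^T = eta).
Hypotheses (gunit : forall x, g x \in unitmx).
Hypotheses (EF : forall x, E x *m F x = 1%:M) (FE : forall x, F x *m E x = 1%:M).
Hypotheses (sE : smx E) (sF : smx F) (som : forall i, smx (om i)).
Hypothesis om_skew : forall i x, (om i x)^T *m eta + eta *m om i x = 0.
Hypothesis torsion_free : forall i j x,
  col j (Dm i E x + om i x *m E x) = col i (Dm j E x + om j x *m E x).
Local Opaque partial.

(** The gauge transform of the connection matrices [om] from the coframe [E] to the coordinates.
    Skewness of [om] becomes compatibility with g, and the first structure equation becomes symmetry
    of the Christoffel symbols. *)
Definition frame_gamma i x : 'M[R]_4 := F x *m (Dm i E x + om i x *m E x).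

Lemma frame_gammaE i x : E x *m frame_gamma i x = Dm i E x + om i x *m E x.
Proof. by rewrite mulmxA EF mul1mx. Qed.

Lemma smx_frame_gamma i : smx (frame_gamma i).
Proof. by apply: smx_mul => //; apply: smx_add; [exact: smx_Dm|exact: smx_mul]. Qed.

Lemma frame_gsym x : (g x)^T = g x.
Proof. by rewrite gE !trmx_mul trmxK eta_sym mulmxA. Qed.

Lemma frame_compatible i x :
  Dm i g x = (frame_gamma i x)^T *m g x + g x *m frame_gamma i x.
Proof.
have -> : g = fun x => ((E x)^T *m eta) *m E x by apply/funext.
have sT := smx_tr sE.
rewrite (Dm_mul i x (smx_mul sT (smx_cst eta)) sE) (Dm_mul i x sT (smx_cst eta)).
rewrite Dm_cst mulmx0 addr0 Dm_tr.
have dE : Dm i E x = E x *m frame_gamma i x - om i x *m E x by rewrite frame_gammaE addrK.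
rewrite dE; move: (frame_gamma i x) => G.
have sk := om_skew i x; move: (om i x) sk => W sk.
have {}sk : eta *m W = - (W^T *m eta) by apply/eqP; rewrite -addr_eq0 addrC sk.
rewrite linearB /= !trmx_mul !mulmxBl !mulmxBr !mulmxA.
rewrite -[(E x)^T *m eta *m W]mulmxA sk mulmxN mulNmx !mulmxA opprK.
by rewrite -addrA; congr (_ + _); rewrite addrCA addNr addr0.
Qed.

Lemma frame_gamma_sym i j k x : frame_gamma i x k j = frame_gamma j x k i.
Proof.
have h : col j (frame_gamma i x) = col i (frame_gamma j x).
  have colM (A B : 'M[R]_4) c : col c (A *m B) = A *m col c B by rewrite !colE mulmxA.
  by rewrite /frame_gamma (colM _ _ j) (colM _ _ i) torsion_free.
by have /matrixP/(_ k 0) := h; rewrite !mxE.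
Qed.

Definition frame_curvature i j x : 'M[R]_4 :=
  Dm i (om j) x - Dm j (om i) x + (om i x *m om j x - om j x *m om i x).

(** Differentiate E Gam_b = d_b E + om_b E along a and antisymmetrize: the second derivatives of E
    cancel, so curvature transforms as a tensor and only [om] has to be differentiated. *)
Lemma frame_curvatureE i j x :
  curvature_mx frame_gamma i j x = F x *m frame_curvature i j x *m E x.
Proof.
suff h : E x *m curvature_mx frame_gamma i j x = frame_curvature i j x *m E x.
  by rewrite -mulmxA -h mulmxA FE mul1mx.
have key a b : Dm a E x *m frame_gamma b x + E x *m Dm a (frame_gamma b) x =
    Dm a (Dm b E) x + (Dm a (om b) x *m E x + om b x *m Dm a E x).
  rewrite -(Dm_mul a x sE (smx_frame_gamma b)) -(Dm_mul a x (som b) sE).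
  rewrite -(Dm_add a x (smx_Dm b sE) (smx_mul (som b) sE)).
  have -> : (fun y => E y *m frame_gamma b y) = (fun y => Dm b E y + om b y *m E y) => //.
  by apply/funext => y; exact: frame_gammaE.
have dE a : Dm a E x = E x *m frame_gamma a x - om a x *m E x by rewrite frame_gammaE addrK.
have k1 := key i j; have k2 := key j i.
rewrite (Dm_comm i j x sE) in k1.
have {}k1 : E x *m Dm i (frame_gamma j) x = Dm j (Dm i E) x + (Dm i (om j) x *m E x +
   om j x *m Dm i E x) - Dm i E x *m frame_gamma j x by rewrite -k1 addrC addKr.
have {}k2 : E x *m Dm j (frame_gamma i) x = Dm j (Dm i E) x + (Dm j (om i) x *m E x +
   om i x *m Dm j E x) - Dm j E x *m frame_gamma i x by rewrite -k2 addrC addKr.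
rewrite /curvature_mx /frame_curvature mulmxDr mulmxBr k1 k2 {k1 k2 key}.
rewrite (dE i) (dE j) {dE}.
move: (Dm j (Dm i E) x) (Dm i (om j) x) (Dm j (om i) x) (om i x) (om j x) (E x)
  (frame_gamma i x) (frame_gamma j x) => DD D1 D2 W1 W2 e G1 G2.
rewrite !(mulmxBl, mulmxBr, mulmxDl, mulmxDr, mulNmx, mulmxN, mulmxA).
by apply/matrixP => a b; rewrite !(addmxE, oppmxE); ring.
Qed.

End Frame.

(** * Connections with values in one ideal of so(2,2) *)

Section SelfDualConnection.
Context {R : realType}.

(* One of the two ideals of so(2,2) in a null coframe; a Levi-Civita connection with
   values in it is Ricci-flat and has a self-dual curvature. *)
Definition sl2m (x y z : R) : 'M[R]_4 := tab
  [:: [:: x; 0; 0; y]; [:: 0; - x; - z; 0]; [:: 0; - y; x; 0]; [:: z; 0; 0; - x]].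

Definition is_sl2 (M : 'M[R]_4) : Prop := exists x y z, M = sl2m x y z.

Lemma is_sl2E M : is_sl2 M -> M = sl2m (M o0 o0) (M o0 o3) (M o3 o0).
Proof. by move=> [x [y [z ->]]]; rewrite !mxE. Qed.

Lemma is_sl2D M N : is_sl2 M -> is_sl2 N -> is_sl2 (M + N).
Proof.
move=> [x [y [z ->]]] [x' [y' [z' ->]]]; exists (x + x'), (y + y'), (z + z').
by apply/matrixP; elim/ord4_ind; elim/ord4_ind; rewrite !mxE /=; ring.
Qed.

Lemma is_sl2Z c M : is_sl2 M -> is_sl2 (c *: M).
Proof.
move=> [x [y [z ->]]]; exists (c * x), (c * y), (c * z).
by apply/matrixP; elim/ord4_ind; elim/ord4_ind; rewrite !mxE /=; ring.
Qed.

Lemma is_sl2B M N : is_sl2 M -> is_sl2 N -> is_sl2 (M - N).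
Proof. by move=> hM hN; rewrite -scaleN1r; apply: is_sl2D => //; exact: is_sl2Z. Qed.

Lemma is_sl2_sum (F : 'I_4 -> 'M[R]_4) : (forall i, is_sl2 (F i)) -> is_sl2 (\sum_i F i).
Proof. by move=> h; rewrite sum4; do ! apply: is_sl2D. Qed.

Lemma is_sl2_bracket M N : is_sl2 M -> is_sl2 N -> is_sl2 (M *m N - N *m M).
Proof.
move=> [x [y [z ->]]] [x' [y' [z' ->]]].
exists (y * z' - z * y'), (2 * (x * y' - y * x')), (2 * (z * x' - x * z')).
by apply/matrixP; elim/ord4_ind; elim/ord4_ind; rewrite !mxE !sum4 !mxE /=; ring.
Qed.

(** Conceptually, the Bianchi identity makes such a curvature a trace-free symmetric form on a
    single ideal, leaving no room for the trace-free Ricci tensor, which mixes both ideals, or for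
    the scalar curvature. In components it is a linear system for x, y, z, solved entry by entry. *)
Lemma sl2_bianchi_ricci (x y z : 'I_4 -> 'I_4 -> R) :
  (forall c d, x d c = - x c d) -> (forall c d, y d c = - y c d) -> (forall c d, z d c = - z c d) ->
  (forall c d e a, sl2m (x c d) (y c d) (z c d) a e + sl2m (x d e) (y d e) (z d e) a c +
     sl2m (x e c) (y e c) (z e c) a d = 0) ->
  forall b d, \sum_a sl2m (x a d) (y a d) (z a d) a b = 0.
Proof.
move=> ax ay az B b d.
have diag (u : 'I_4 -> 'I_4 -> R) : (forall c d, u d c = - u c d) -> forall c, u c c = 0.
  by move=> au c; have := au c c => h; lra.
have B1 c e f := (B c e f o0, B c e f o1, B c e f o2, B c e f o3).
have := (B1 o0 o1 o2, B1 o0 o1 o3, B1 o0 o2 o3, B1 o1 o2 o3).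
pose sk u (au : forall c d : 'I_4, u d c = - u c d :> R) :=
  (diag u au, (au o0 o1, au o0 o2, au o0 o3, au o1 o2, au o1 o3, au o2 o3)).
rewrite !mxE /= !(sk x ax, sk y ay, sk z az) => -[[[]]].
move=> [[[h1 h2] h3] h4] [[[h5 h6] h7] h8] [[[h9 h10] h11] h12] [[[h13 h14] h15] h16].
rewrite sum4 !mxE; elim/ord4_ind: b; elim/ord4_ind: d => /=;
rewrite ?(sk x ax, sk y ay, sk z az) {sk B B1}; clear ax ay az diag; lra.
Qed.

(** The Bianchi identity is given in coordinates while [sl2_bianchi_ricci] speaks of the frame; the
    identity is carried to the frame and the vanishing trace back. *)
Lemma sl2_ricci_flat (E F : 'M[R]_4) (W : 'I_4 -> 'I_4 -> 'M[R]_4) :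
  E *m F = 1%:M -> F *m E = 1%:M -> (forall i j, is_sl2 (W i j)) ->
  (forall i j, W j i = - W i j) ->
  (forall l k i j, (F *m W i j *m E) l k + (F *m W j k *m E) l i + (F *m W k i *m E) l j = 0) ->
  forall k j, \sum_i (F *m W i j *m E) i k = 0.
Proof.
move=> EF FE sW aW B k0 j0.
(* The two form indices are contracted with the frame vectors, which are the columns of [F]. *)
pose Wh c d : 'M[R]_4 := \sum_i \sum_j (F i c * F j d) *: W i j.
have sWh c d : is_sl2 (Wh c d).
  by apply: is_sl2_sum => i; apply: is_sl2_sum => j; exact: is_sl2Z.
have aWh c d : Wh d c = - Wh c d.
  rewrite /Wh exchange_big /= -sumrN; apply: eq_bigr => i _; rewrite -sumrN.
  by apply: eq_bigr => j _; rewrite aW scalerN mulrC.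
have WhE c d a e : Wh c d a e = \sum_i \sum_j F i c * F j d * W i j a e.
  by rewrite summxE; apply: eq_bigr => i _; rewrite summxE; apply: eq_bigr => j _; rewrite mxE.
have contract c d a e : \sum_i \sum_j \sum_k F i c * F j d * F k e * (W i j *m E) a k = Wh c d a e.
  rewrite WhE; apply: eq_bigr => i _; apply: eq_bigr => j _.
  rewrite -[W i j in RHS]mulmx1 -EF mulmxA mxE mulr_sumr; apply: eq_bigr => k _.
  by ring.
have BE a i j k : (W i j *m E) a k + (W j k *m E) a i + (W k i *m E) a j = 0.
  have e M b c : (E *m (F *m M *m E)) b c = (M *m E) b c :> R by rewrite !mulmxA EF mul1mx.
  rewrite -!e !mxE -!big_split big1 // => l _ /=; rewrite -!mulrDr B mulr0 //.
have cyc (f : 'I_4 -> 'I_4 -> 'I_4 -> R) :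
    \sum_i \sum_j \sum_k f i j k = \sum_i \sum_j \sum_k f j k i.
  by rewrite [RHS]exchange_big /=; apply: eq_bigr => j _; rewrite [RHS]exchange_big.
have Bh c d e a : Wh c d a e + Wh d e a c + Wh e c a d = 0.
  rewrite -(contract c d a e) -(contract d e a c) -(contract e c a d).
  rewrite [X in _ + X + _]cyc [X in _ + _ + X]cyc [X in _ + _ + X]cyc -!big_split big1 // => i _ /=.
  rewrite -!big_split big1 // => j _ /=; rewrite -!big_split big1 // => k _ /=.
  apply: etrans (_ : F i c * F j d * F k e * ((W i j *m E) a k + (W j k *m E) a i + (W k i *m E) a j) = 0).
    by ring.
  by rewrite BE mulr0.
have fr b d : \sum_a Wh a d a b = 0.
  have H := @sl2_bianchi_ricci (fun c d => Wh c d o0 o0) (fun c d => Wh c d o0 o3)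
    (fun c d => Wh c d o3 o0).
  rewrite -[RHS](H _ _ _ _ b d); first by apply: eq_bigr => a _; rewrite {1}(is_sl2E (sWh a d)).
  - by move=> c e; rewrite aWh oppmxE.
  - by move=> c e; rewrite aWh oppmxE.
  - by move=> c e; rewrite aWh oppmxE.
  - by move=> c e f a; rewrite -!(is_sl2E (sWh _ _)).
(* A row of the Ricci tensor in coordinates; it vanishes if its product with the invertible matrix
   [F] does. *)
pose r : 'rV[R]_4 := \row_j \sum_i (F *m W i j *m E) i k0.
suff r0 : r *m F = 0.
  by have /rowP/(_ j0) : r = 0 by [rewrite -[r]mulmx1 -FE mulmxA r0 mul0mx]; rewrite !mxE.
apply/rowP => d; rewrite mxE [RHS]mxE.
transitivity (\sum_j \sum_i \sum_b \sum_a E b k0 * F i a * F j d * W i j a b).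
  apply: eq_bigr => j _; rewrite mxE mulr_suml; apply: eq_bigr => i _.
  rewrite mxE mulr_suml; apply: eq_bigr => b _; rewrite mxE !mulr_suml; apply: eq_bigr => a _.
  by ring.
transitivity (\sum_b \sum_a \sum_i \sum_j E b k0 * F i a * F j d * W i j a b).
  rewrite exchange_big /=.
  transitivity (\sum_i \sum_b \sum_a \sum_j E b k0 * F i a * F j d * W i j a b).
    apply: eq_bigr => i _; rewrite exchange_big /=; apply: eq_bigr => b _.
    by rewrite exchange_big.
  by rewrite exchange_big /=; apply: eq_bigr => b _; rewrite exchange_big.
rewrite big1 // => b _; transitivity (E b k0 * \sum_a Wh a d a b); last by rewrite fr mulr0.
rewrite mulr_sumr; apply: eq_bigr => a _; rewrite WhE mulr_sumr; apply: eq_bigr => i _.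
by rewrite mulr_sumr; apply: eq_bigr => j _; ring.
Qed.

End SelfDualConnection.

Section SelfDualFrame.
Context {R : realType}.
Local Opaque partial.

Lemma Dm_sl2 i (M : 'rV[R]_4 -> 'M[R]_4) x : smx M -> (forall x, is_sl2 (M x)) -> is_sl2 (Dm i M x).
Proof.
move=> sM hM; pose p a b := partial i (fun y => M y a b) x.
exists (p o0 o0), (p o0 o3), (p o3 o0).
have d a b := partial_isd i x (sM a b).
have z : partial i (fun=> 0) x = 0 :> R by exact: (isd_partial (isd_cst _ _ _)).
have n a b : partial i (fun y => - M y a b) x = - p a b by exact: (isd_partial (isdN (d a b))).
have e a b : Dm i M x a b = partial i (fun y => sl2m (M y o0 o0) (M y o0 o3) (M y o3 o0) a b) x.
  by rewrite DmE; apply: partial_ext => y; rewrite -(is_sl2E (hM y)).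
apply/matrixP => a b; rewrite e.
have {}e : (fun y => sl2m (M y o0 o0) (M y o0 o3) (M y o3 o0) a b) =
  (fun y => nth 0 (nth [::] [:: [:: M y o0 o0; 0; 0; M y o0 o3]; [:: 0; - M y o0 o0; - M y o3 o0; 0];
     [:: 0; - M y o0 o3; M y o0 o0; 0]; [:: M y o3 o0; 0; 0; - M y o0 o0]] a) b).
  by apply/funext => y; rewrite mxE.
rewrite e mxE {e}; elim/ord4_ind: a; elim/ord4_ind: b => /=.
- by []. - exact: z. - exact: z. - by [].
- exact: z. - exact: n. - exact: n. - exact: z.
- exact: z. - exact: n. - by []. - exact: z.
- by []. - exact: z. - exact: z. - exact: n.
Qed.

Variables (g E F : 'rV[R]_4 -> 'M[R]_4) (om : 'I_4 -> 'rV[R]_4 -> 'M[R]_4) (eta : 'M[R]_4).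
Hypotheses (gE : forall x, g x = (E x)^T *m eta *m E x) (eta_sym : eta^T = eta).
Hypotheses (gunit : forall x, g x \in unitmx).
Hypotheses (EF : forall x, E x *m F x = 1%:M) (FE : forall x, F x *m E x = 1%:M).
Hypotheses (sE : smx E) (sF : smx F) (som : forall i, smx (om i)).
Hypothesis om_skew : forall i x, (om i x)^T *m eta + eta *m om i x = 0.
Hypothesis torsion_free : forall i j x,
  col j (Dm i E x + om i x *m E x) = col i (Dm j E x + om j x *m E x).
Hypothesis om_sl2 : forall i x, is_sl2 (om i x).
Hypothesis hodge_sl2 : forall x M, is_sl2 M ->
  hodge (g x) ((E x)^T *m (eta *m M) *m E x) = (E x)^T *m (eta *m M) *m E x.

Let gam := frame_gamma E F om.
Let Om := frame_curvature om.

Lemma frame_curvature_sl2 i j x : is_sl2 (Om i j x).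
Proof.
by apply: is_sl2D; [apply: is_sl2B; exact: Dm_sl2|exact: is_sl2_bracket].
Qed.

Lemma frame_riemann_up l k i j x : riemann_up g l k i j x = (F x *m Om i j x *m E x) l k.
Proof.
rewrite (riemann_up_mx (frame_gsym gE eta_sym) gunit (frame_compatible gE EF sE om_skew)
  (frame_gamma_sym F torsion_free)).
by rewrite (frame_curvatureE EF FE sE sF som).
Qed.

Lemma frame_ricci k j x : ricci g k j x = 0.
Proof.
rewrite /ricci; under eq_bigr => i _ do rewrite frame_riemann_up.
apply: (sl2_ricci_flat (EF x) (FE x) (W := fun i j => Om i j x)).
- by move=> a b; exact: frame_curvature_sl2.
- move=> a b; rewrite /Om /frame_curvature.
  by apply/matrixP => c d; rewrite !(addmxE, oppmxE); ring.
- move=> l k' a b; have := bianchi (frame_gamma_sym F torsion_free) l k' a b x.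
  by rewrite !(frame_curvatureE EF FE sE sF som).
Qed.

(** The Ricci tensor vanishes, so the Weyl tensor is the Riemann tensor; lowering its first index
    with g = E^T eta E cancels the factor [F]. *)
Lemma frame_weyl a b i j x : weyl g a b i j x = ((E x)^T *m (eta *m Om i j x) *m E x) a b.
Proof.
have s0 : scalar_curvature g x = 0.
  by rewrite /scalar_curvature big1 // => c _; rewrite big1 // => d _; rewrite frame_ricci mulr0.
rewrite /weyl s0 !frame_ricci !mulr0 !subr0 !addr0 !mul0r mulr0 subr0 addr0.
have -> : (E x)^T *m (eta *m Om i j x) *m E x = g x *m (F x *m Om i j x *m E x).
  by rewrite gE !mulmxA -[_ *m E x *m F x]mulmxA EF mulmx1.
by rewrite /riemann [RHS]mxE; apply: eq_bigr => m _; rewrite frame_riemann_up.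
Qed.

Lemma frame_self_dual : self_dual_metric g.
Proof.
move=> l k i j x; rewrite /weyl_asd.
have -> : \matrix_(a < 4, b < 4) weyl g a b i j x = (E x)^T *m (eta *m Om i j x) *m E x.
  by apply/matrixP => a b; rewrite mxE frame_weyl.
rewrite hodge_sl2; last exact: frame_curvature_sl2.
by rewrite frame_weyl subrr mulr0.
Qed.

End SelfDualFrame.

Ltac mx4 := apply/matrixP; elim/ord4_ind; elim/ord4_ind; rewrite !mxE ?sum4 ?mxE ?sum4 ?mxE /=.

(* The null coframe l = V (dx1 - dt), n = dx1 + dt, m = V dx2 - sigma,
   q = dx2 + sigma / V, where sigma = ds + A1 dx1 + A2 dx2; the metric is
   l n + m q and [monopole_frame] lists the dual vector fields. *)
Section MonopoleFrame.
Context {R : realType}.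

Definition monopole_metric (V A1 A2 : R) : 'M[R]_4 := tab
  [:: [:: - V; 0; 0; 0];
      [:: 0; - V^-1; - V^-1 * A1; - V^-1 * A2];
      [:: 0; - V^-1 * A1; V - V^-1 * A1 ^+ 2; - V^-1 * A1 * A2];
      [:: 0; - V^-1 * A2; - V^-1 * A1 * A2; V - V^-1 * A2 ^+ 2]].

Definition monopole_coframe (V A1 A2 : R) : 'M[R]_4 := tab
  [:: [:: - V; 0; V; 0]; [:: 1; 0; 1; 0]; [:: 0; - 1; - A1; V - A2];
      [:: 0; V^-1; V^-1 * A1; 1 + V^-1 * A2]].

Definition monopole_frame (V A1 A2 : R) : 'M[R]_4 := tab
  [:: [:: - (2 * V)^-1; 2^-1; 0; 0];
      [:: - A1 / (2 * V); - A1 / 2; - 2^-1 - A2 / (2 * V); (V - A2) / 2];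
      [:: (2 * V)^-1; 2^-1; 0; 0];
      [:: 0; 0; (2 * V)^-1; 2^-1]].

Definition null_form : 'M[R]_4 := tab
  [:: [:: 0; 2^-1; 0; 0]; [:: 2^-1; 0; 0; 0]; [:: 0; 0; 0; 2^-1]; [:: 0; 0; 2^-1; 0]].

Lemma monopole_metricE (V A1 A2 : R) : V != 0 ->
  monopole_metric V A1 A2 = (monopole_coframe V A1 A2)^T *m null_form *m monopole_coframe V A1 A2.
Proof. by move=> V0; mx4; field. Qed.

Lemma monopole_coframeK (V A1 A2 : R) : V != 0 ->
  monopole_coframe V A1 A2 *m monopole_frame V A1 A2 = 1%:M.
Proof. by move=> V0; mx4; field. Qed.

Lemma monopole_frameK (V A1 A2 : R) : V != 0 ->
  monopole_frame V A1 A2 *m monopole_coframe V A1 A2 = 1%:M.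
Proof. by move=> V0; apply: mulmx1C; exact: monopole_coframeK. Qed.

End MonopoleFrame.

(** * Self-duality of the monopole metrics *)

Section MonopoleSelfDual.
Context {R : realType}.

Lemma monopole_metric_sym (V A1 A2 : R) : (monopole_metric V A1 A2)^T = monopole_metric V A1 A2.
Proof. by mx4; ring. Qed.

Lemma det_monopole_metric (V A1 A2 : R) : V != 0 -> \det (monopole_metric V A1 A2) = V ^+ 2.
Proof.
move=> V0.
(* The unipotent change to the coframe dt, sigma, dx1, dx2, in which the metric is diagonal. *)
pose S : 'M[R]_4 := tab [:: [:: 1; 0; 0; 0]; [:: 0; 1; A1; A2]; [:: 0; 0; 1; 0]; [:: 0; 0; 0; 1]].
have -> : monopole_metric V A1 A2 = S^T *m diag_mx (row4 (- V) (- V^-1) V V) *m S.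
  by rewrite mul_mx_diag; mx4; field.
have dS : \det S = 1.
  rewrite -det_tr det_trig.
    by rewrite !big_ord_recl big_ord0 !mxE /= !mulr1.
  by apply/is_trig_mxP; elim/ord4_ind; elim/ord4_ind => // _; rewrite !mxE.
rewrite !det_mulmx det_tr dS det_diag !big_ord_recl big_ord0 !mxE /= mul1r !mulr1.
by field.
Qed.

Lemma monopole_metric_unit (V A1 A2 : R) : V != 0 -> monopole_metric V A1 A2 \in unitmx.
Proof. by move=> V0; rewrite unitmxE det_monopole_metric // unitfE expf_neq0. Qed.

Definition null_form_inv : 'M[R]_4 := tab
  [:: [:: 0; 2; 0; 0]; [:: 2; 0; 0; 0]; [:: 0; 0; 0; 2]; [:: 0; 0; 2; 0]].

Lemma null_formK : null_form *m null_form_inv = 1%:M.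
Proof. by mx4; field. Qed.

(** An expansion in the three bivectors F0^F1 + F2^F3, F0^F2 and F1^F3 of the frame. The next lemma
    is its counterpart for the 2-forms l^n + m^q, l^m and n^q; the Hodge star is then compared entry
    by entry. *)
Lemma sl2_raise_conj (F : 'M[R]_4) x y z a b :
  (F *m (sl2m x y z *m null_form_inv) *m F^T) a b =
  2 * x * (F a o0 * F b o1 - F a o1 * F b o0) + 2 * y * (F a o0 * F b o2 - F a o2 * F b o0) -
  2 * z * (F a o1 * F b o3 - F a o3 * F b o1) + 2 * x * (F a o2 * F b o3 - F a o3 * F b o2).
Proof.
have -> : sl2m x y z *m null_form_inv = tab [:: [:: 0; 2 * x; 2 * y; 0]; [:: - 2 * x; 0; 0; - 2 * z];
  [:: - 2 * y; 0; 0; 2 * x]; [:: 0; 2 * z; - 2 * x; 0]] by mx4; ring.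
by rewrite !mxE sum4 !mxE !sum4 !mxE /=; ring.
Qed.

Lemma sl2_lower_conj (E : 'M[R]_4) x y z a b :
  (E^T *m (null_form *m sl2m x y z) *m E) a b =
  - (x / 2) * (E o0 a * E o1 b - E o1 a * E o0 b) - z / 2 * (E o0 a * E o2 b - E o2 a * E o0 b) +
  y / 2 * (E o1 a * E o3 b - E o3 a * E o1 b) - x / 2 * (E o2 a * E o3 b - E o3 a * E o2 b).
Proof.
have -> : null_form *m sl2m x y z = tab [:: [:: 0; - (x / 2); - (z / 2); 0]; [:: x / 2; 0; 0; y / 2];
  [:: z / 2; 0; 0; - (x / 2)]; [:: 0; - (y / 2); x / 2; 0]] by mx4; field.
by rewrite !mxE sum4 !mxE !sum4 !mxE /=; ring.
Qed.

(** Since V > 0, the square root of |det g| is V; what is left is an identity of rational functions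
    of V, A1 and A2, because lowering by the metric and raising again only changes the coframe
    matrix into the frame matrix. *)
Lemma hodge_monopole (V A1 A2 : R) (M : 'M[R]_4) : 0 < V -> is_sl2 M ->
  let E := monopole_coframe V A1 A2 in
  hodge (monopole_metric V A1 A2) (E^T *m (null_form *m M) *m E) = E^T *m (null_form *m M) *m E.
Proof.
move=> V0 [x [y [z ->]]] E; have Vn : V != 0 by rewrite gt_eqF.
have nM : (null_form *m sl2m x y z)^T = - (null_form *m sl2m x y z) by mx4; field.
rewrite hodge_dual4 ?monopole_metric_sym //; last first.
  by rewrite !trmx_mul trmxK -trmx_mul nM mulNmx mulmxN mulmxA.
rewrite det_monopole_metric // normrX (gtr0_norm V0) sqrtr_sqr (gtr0_norm V0).
set F := monopole_frame V A1 A2.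
have EF : E *m F = 1%:M by exact: monopole_coframeK.
have FE : F *m E = 1%:M by exact: monopole_frameK.
have hh := null_formK; have hh' : null_form_inv *m null_form = 1%:M := mulmx1C hh.
have gi : invmx (monopole_metric V A1 A2) = F *m null_form_inv *m F^T.
  have gH : monopole_metric V A1 A2 *m (F *m null_form_inv *m F^T) = 1%:M.
    rewrite monopole_metricE // -/E !mulmxA -[_ *m E *m F]mulmxA EF mulmx1.
    by rewrite -[_ *m null_form *m _]mulmxA hh mulmx1 -trmx_mul FE trmx1.
  by rewrite -[RHS](mulKmx (monopole_metric_unit A1 A2 Vn)) gH mulmx1.
have -> : invmx (monopole_metric V A1 A2) *m (E^T *m (null_form *m sl2m x y z) *m E) *m
    invmx (monopole_metric V A1 A2) = F *m (sl2m x y z *m null_form_inv) *m F^T.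
  rewrite gi !mulmxA -[_ *m F^T *m E^T]mulmxA -trmx_mul EF trmx1 mulmx1.
  rewrite -[_ *m null_form_inv *m null_form]mulmxA hh' mulmx1.
  by rewrite -[_ *m E *m F]mulmxA EF mulmx1.
apply/matrixP => a b; rewrite sl2_lower_conj mxE /dual4.
elim/ord4_ind: a; elim/ord4_ind: b; rewrite mxE /= ?sl2_raise_conj /F /E !mxE /=; by field.
Qed.

Definition monopole_dcoframe (V A1 A2 dV dA1 dA2 : R) : 'M[R]_4 := tab
  [:: [:: - dV; 0; dV; 0]; [:: 0; 0; 0; 0]; [:: 0; 0; - dA1; dV - dA2];
      [:: 0; - V ^- 2 * dV; V^-1 * dA1 + A1 * (- V ^- 2 * dV); V^-1 * dA2 + A2 * (- V ^- 2 * dV)]].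

(* The forms a = -(P/V) n - (V2/2V^2) m, b = -P q + (V2/2V) l and
   c = -(V2/2V^2) n + (Q/V^3) m, for P = (V1 + Vt)/2 and Q = (V1 - Vt)/2. *)
Definition connection_mx (V A1 A2 Vt V1 V2 : R) (i : 'I_4) : 'M[R]_4 :=
  let P := (V1 + Vt) / 2 in let Q := (V1 - Vt) / 2 in let S := V2 / (2 * V ^+ 2) in
  sl2m
    (nth 0 [:: - (P / V); S; S * A1 - P / V; - S * (V - A2)] i)
    (nth 0 [:: - (V2 / 2); - (P / V); V2 / 2 - P * A1 / V; - P * (1 + A2 / V)] i)
    (nth 0 [:: - S; - (Q / V ^+ 3); - S - Q * A1 / V ^+ 3; Q / V ^+ 3 * (V - A2)] i).

Lemma sl2m_mul (x y z : R) (E : 'M[R]_4) b :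
  ((sl2m x y z *m E) o0 b = x * E o0 b + y * E o3 b) *
  ((sl2m x y z *m E) o1 b = - x * E o1 b - z * E o2 b) *
  ((sl2m x y z *m E) o2 b = - y * E o1 b + x * E o2 b) *
  ((sl2m x y z *m E) o3 b = z * E o0 b - x * E o3 b).
Proof. by do ! split; rewrite mxE sum4 !tabE /=; ring. Qed.

(** The first structure equation. The hypotheses are invariance along d_s and the three components
    of the monopole equation between dA and dV. The condition is symmetric in i and j and trivial
    for i = j. *)
Lemma connection_torsion_free (V A1 A2 : R) (dV dA1 dA2 : 'I_4 -> R) : V != 0 ->
  dV o1 = 0 -> dA1 o1 = 0 -> dA2 o1 = 0 -> dA1 o0 = dV o3 -> dA2 o0 = - dV o2 ->
  dA2 o2 = dA1 o3 - dV o0 ->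
  let T i := monopole_dcoframe V A1 A2 (dV i) (dA1 i) (dA2 i) +
    connection_mx V A1 A2 (dV o0) (dV o2) (dV o3) i *m monopole_coframe V A1 A2 in
  forall i j, col j (T i) = col i (T j).
Proof.
move=> V0 v1 a1 b1 a0 b0 b2 T.
suff h (i j : 'I_4) : (i < j)%N -> col j (T i) = col i (T j).
  by move=> i j; case: (ltngtP i j) => [/h|/h|/val_inj ->].
move=> ij; apply/colP => a; rewrite [LHS]mxE [RHS]mxE /T !addmxE.
move: ij; elim/ord4_ind: i; elim/ord4_ind: j => // _; elim/ord4_ind: a.
all: rewrite /connection_mx !sl2m_mul !tabE.
all: move=> /=.
all: rewrite ?(v1, a1, b1, a0, b0, b2).
all: field.
all: by [].
Qed.

Section Potentials.
Variables V A1 A2 : 'rV[R]_4 -> R.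
Hypotheses (sV : smooth V) (sA1 : smooth A1) (sA2 : smooth A2).
Hypothesis V_gt0 : forall x, 0 < V x.
Hypotheses (V_s : forall x, partial o1 V x = 0) (A1_s : forall x, partial o1 A1 x = 0)
  (A2_s : forall x, partial o1 A2 x = 0).
Hypotheses (A1_t : forall x, partial o0 A1 x = partial o3 V x)
  (A2_t : forall x, partial o0 A2 x = - partial o2 V x)
  (A_12 : forall x, partial o2 A2 x - partial o3 A1 x = - partial o0 V x).
Local Opaque partial.

Let Vn x : V x != 0. Proof. by rewrite gt_eqF. Qed.
Let E x := monopole_coframe (V x) (A1 x) (A2 x).
Let F x := monopole_frame (V x) (A1 x) (A2 x).
Definition monopole_connection (i : 'I_4) x : 'M[R]_4 :=
  connection_mx (V x) (A1 x) (A2 x) (partial o0 V x) (partial o2 V x) (partial o3 V x) i.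

Lemma smooth_V_inv : smooth (fun x => (V x)^-1).
Proof. exact: smoothV. Qed.

Lemma smx_monopole_coframe : smx E.
Proof.
move=> a b; have sVi := smooth_V_inv.
elim/ord4_ind: a; elim/ord4_ind: b; rewrite /E /monopole_coframe;
 (under eq_fun do rewrite mxE /=);
 by do ! [exact: smooth_cst|exact: sV|exact: sA1|exact: sA2|exact: sVi|apply: smoothN|
   apply: smoothD|apply: smoothM].
Qed.

Lemma smx_monopole_frame : smx F.
Proof.
move=> a b; have sVi := smooth_V_inv.
have s2 : smooth (fun x => (2 * V x)^-1).
  by apply: smoothV => [x|]; [rewrite mulf_neq0 // pnatr_eq0|apply: smoothM => //; exact: smooth_cst].
elim/ord4_ind: a; elim/ord4_ind: b; rewrite /F /monopole_frame;
 (under eq_fun do rewrite mxE /=);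
 by do ! [exact: smooth_cst|exact: sV|exact: sA1|exact: sA2|exact: sVi|exact: s2|apply: smoothN|
   apply: smoothD|apply: smoothM].
Qed.

Lemma smx_monopole_connection i : smx (monopole_connection i).
Proof.
have sVi := smooth_V_inv; have sE := smx_monopole_coframe.
have sP j : smooth (partial j V) by exact: smooth_partial.
have sVn n : smooth (fun x => (V x ^+ n)^-1).
  elim: n => [|n IH]; first by under eq_fun do rewrite expr0; exact: smooth_cst.
  by under eq_fun do rewrite exprS invfM; apply: smoothM.
have s2n n : smooth (fun x => (2 * V x ^+ n)^-1).
  by under eq_fun do rewrite invfM; apply: smoothM => //; exact: smooth_cst.
have s2 : smooth (fun x => (2 * V x)^-1) by exact: (s2n 1%N).
move=> a b; rewrite /monopole_connection /connection_mx /sl2m.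
under eq_fun do rewrite tabE.
elim/ord4_ind: i; elim/ord4_ind: a; elim/ord4_ind: b => /=;
 by do ! [exact: smooth_cst|exact: sV|exact: sA1|exact: sA2|exact: sP|exact: sVi|exact: sVn|
   exact: s2|exact: s2n|apply: smoothN|apply: smoothD|apply: smoothM].
Qed.

Lemma Dm_monopole_coframe i x : Dm i E x =
  monopole_dcoframe (V x) (A1 x) (A2 x) (partial i V x) (partial i A1 x) (partial i A2 x).
Proof.
have dV := partial_isd i x sV; have d1 := partial_isd i x sA1; have d2 := partial_isd i x sA2.
have dVi := isdV dV (Vn x).
have z c : partial i (fun=> c) x = 0 :> R by exact: (isd_partial (isd_cst _ _ _)).
apply/matrixP => a b; rewrite DmE [RHS]mxE.
have {}e : (fun y => E y a b) = (fun y => nth 0 (nth [::] [:: [:: - V y; 0; V y; 0]; [:: 1; 0; 1; 0];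
   [:: 0; - 1; - A1 y; V y - A2 y];
   [:: 0; (V y)^-1; (V y)^-1 * A1 y; 1 + (V y)^-1 * A2 y]] a) b).
  by apply/funext => y; rewrite mxE.
rewrite e {e}; elim/ord4_ind: a; elim/ord4_ind: b => /=.
- exact: (isd_partial (isdN dV)). - exact: z. - by []. - exact: z.
- exact: z. - exact: z. - exact: z. - exact: z.
- exact: z. - exact: z. - exact: (isd_partial (isdN d1)). - exact: (isd_partial (isdB dV d2)).
- exact: z. - exact: (isd_partial dVi). - exact: (isd_partial (isdM dVi d1)).
- by rewrite (isd_partial (isdD (isd_cst _ _ _) (isdM dVi d2))) add0r.
Qed.

Lemma self_dual_monopole : self_dual_metric (fun x => monopole_metric (V x) (A1 x) (A2 x)).
Proof.
have nsym : (@null_form R)^T = null_form by mx4.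
have sl2 i x : is_sl2 (monopole_connection i x).
  by rewrite /monopole_connection /connection_mx; do 3 eexists.
apply: (@frame_self_dual _ _ E F monopole_connection null_form).
- by move=> x; exact: monopole_metricE.
- exact: nsym.
- by move=> x; exact: monopole_metric_unit.
- by move=> x; exact: monopole_coframeK.
- by move=> x; exact: monopole_frameK.
- exact: smx_monopole_coframe.
- exact: smx_monopole_frame.
- exact: smx_monopole_connection.
- move=> i x; have [a [b [c ->]]] := sl2 i x; by mx4; field.
- move=> i j x; rewrite !Dm_monopole_coframe.
  apply: (@connection_torsion_free (V x) (A1 x) (A2 x) (fun i => partial i V x)
    (fun i => partial i A1 x) (fun i => partial i A2 x)) => //.
  have := A_12 x; move: (partial o2 A2 x) (partial o3 A1 x) (partial o0 V x) => u v w h.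
  by rewrite -h addrC subrK.
- exact: sl2.
- by move=> x M hM; exact: hodge_monopole.
Qed.

End Potentials.

End MonopoleSelfDual.

(** * The transform R *)

Section CylinderLift.
Context {R : realType}.
Implicit Types (F : 'rV[R]_2 -> R) (p v : 'rV[R]_3) (t : R).

Definition row2 (a b : R) : 'rV[R]_2 := \row_(i < 2) [:: a; b]`_i.

(** The number t + Re(z e^(-i theta)) at which h is evaluated; here the angle theta is called [t]
    and the time coordinate is [p 0 0]. *)
Definition phase t p : R := p 0 0 + p 0 1 * cos t + p 0 2 * sin t.

Definition cyl_lift F t p : R := F (row2 t (phase t p)).

Definition periodic_cyl F : Prop := smooth F /\ forall a b, F (row2 (a + 2 * pi) b) = F (row2 a b).

Definition fiber_derive F : 'rV[R]_2 -> R := 'D_(delta_mx 0 1) (F : _ -> R^o).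

Lemma row2_shift a b (h : R) : h *: delta_mx 0 1 + row2 a b = row2 a (h + b).
Proof.
apply/rowP => i; rewrite !mxE eqxx /=.
by case: i => -[|[|//]] hi /=; rewrite ?mulr0 ?add0r ?mulr1.
Qed.

Lemma periodic_fiber_derive F : periodic_cyl F -> periodic_cyl (fiber_derive F).
Proof.
move=> [sF pF]; split; first exact: smooth_derive.
move=> a b.
have E : (fun h : R => h^-1 *: ((F (h *: delta_mx 0 1 + row2 (a + 2 * pi) b) : R^o) - F (row2 (a + 2 * pi) b))) =
   (fun h : R => h^-1 *: ((F (h *: delta_mx 0 1 + row2 a b) : R^o) - F (row2 a b))).
  by apply/funext => h; rewrite !row2_shift !pF.
by rewrite /fiber_derive [LHS]/derive /= E.
Qed.

Lemma is_derive_sin_cos : (forall t : R, is_derive (t : R^o) (1 : R^o) (sin : R^o -> R^o) (cos t)) /\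
  (forall t : R, is_derive (t : R^o) (1 : R^o) (cos : R^o -> R^o) (- sin t)).
Proof. by split => t; [exact: is_derive_sin|exact: is_derive_cos]. Qed.

Lemma smooth_sin_cos : smooth (sin : R^o -> R) /\ smooth (cos : R^o -> R).
Proof.
have [ds dc] := is_derive_sin_cos.
have dsv (t v : R) : is_derive (t : R^o) (v : R^o) (sin : R^o -> R^o) (v * cos t).
  have := is_derive_scale v (@ex_derive _ _ _ _ _ _ _ (ds t)).
  by have [_ ->] := ds t; rewrite /GRing.scale /= mulr1.
have dcv (t v : R) : is_derive (t : R^o) (v : R^o) (cos : R^o -> R^o) (v * - sin t).
  have := is_derive_scale v (@ex_derive _ _ _ _ _ _ _ (dc t)).
  by have [_ ->] := dc t; rewrite /GRing.scale /= mulr1.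
have H n : Ck_on n setT (sin : R^o -> R^o) /\ Ck_on n setT (cos : R^o -> R^o).
  elim: n => [|n [IH1 IH2]].
    by split; split => // x _; [exact: continuous_sin|exact: continuous_cos].
  split.
    split; first by move=> x _; exact: continuous_sin.
    move=> v; split; first by move=> x _; have [] := dsv x v.
    rewrite (_ : 'D_v _ = fun t : R^o => v * cos t).
      by apply: Ck_onM => //; exact: Ck_on_cst.
    by apply/funext => t; have [_ ->] := dsv t v.
  split; first by move=> x _; exact: continuous_cos.
  move=> v; split; first by move=> x _; have [] := dcv x v.
  rewrite (_ : 'D_v _ = fun t : R^o => (- v) * sin t).
    by apply: Ck_onM => //; exact: Ck_on_cst.
  by apply/funext => t; have [_ ->] := dcv t v; rewrite mulrN mulNr.
by split => n; have [] := H n.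
Qed.

Lemma periodic_cyl_lift F : periodic_cyl F -> periodic_smooth (cyl_lift F).
Proof.
move=> [sF pF]; have [ss sc] := smooth_sin_cos; split; last first.
  move=> t p; rewrite /cyl_lift /phase pF.
  have -> : t + 2 * pi = t + pi *+ 2 by rewrite mulr_natl.
  by rewrite sinD2pi cosD2pi.
have s1 : smooth (fun q : (R^o * 'rV[R]_3)%type => q.1).
  apply: (@smooth_affine _ _ R^o fst fst id) => //; last exact: smooth_id.
  by move=> q; exact: cvg_fst.
have s2 i : smooth (fun q : (R^o * 'rV[R]_3)%type => q.2 0 i).
  apply: (@smooth_affine _ _ 'rV[R]_3 snd snd (fun r => r 0 i)) => //; last exact: smooth_coord.
  by move=> q; exact: cvg_snd.
rewrite /joint /cyl_lift; apply: (@smooth_comp_row _ _ 2 F) => // i.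
case: i => -[|[|//]] hi; under eq_fun do rewrite mxE /=; first exact: s1.
by apply: smoothD; [apply: smoothD => //|]; apply: smoothM => //;
  [exact: (@smooth_comp1 _ _ cos)|exact: (@smooth_comp1 _ _ sin)].
Qed.

(** The lift depends on p only through [phase], which is linear in p. All derivatives in p are thus
    trigonometric polynomials times lifts of derivatives along the fibre, and this is what makes the
    conjugate series computable. *)
Lemma ddir_cyl_lift F v t p : smooth F ->
  is_derive p v (cyl_lift F t : 'rV[R]_3 -> R^o) (phase t v * cyl_lift (fiber_derive F) t p).
Proof.
move=> sF; apply: is_derive_alongP.
have E : (fun h : R^o => cyl_lift F t (h *: v + p) : R^o) =
   (fun h : R^o => F (h *: (phase t v *: delta_mx 0 1) + row2 t (phase t p)) : R^o).
  apply/funext => h; rewrite scalerA row2_shift /cyl_lift; congr (F (row2 _ _)).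
  by rewrite /phase !mxE; ring.
rewrite E.
have := @is_derive_scale R _ F (row2 t (phase t p)) (delta_mx 0 1) (phase t v)
  (smooth_derivable sF).
have E0 : 0 *: (phase t v *: delta_mx 0 1) + row2 t (phase t p) = row2 t (phase t p) :> 'rV[R]_2.
  by rewrite scale0r add0r.
move=> [d1 d2]; have := @is_derive_line _ _ _ (F : _ -> R^o) (row2 t (phase t p))
   (phase t v *: delta_mx 0 1) 0; rewrite E0 d2; apply; exact: d1.
Qed.

Lemma ddir_cyl_liftE F v : smooth F ->
  ddir v (cyl_lift F) = fun t p => phase t v * cyl_lift (fiber_derive F) t p.
Proof.
by move=> sF; apply/funext => t; apply/funext => p; have [_ <-] := ddir_cyl_lift v t p sF.
Qed.

Definition lift_mean F p : R := circle_mean (fun t => cyl_lift F t p).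

Lemma coef00 (V : normedModType R) (K : R -> V -> R) (p : V) : coef 0 0 K p = circle_mean (fun t => K t p).
Proof. by congr circle_mean; apply/funext => t; rewrite mul0r addr0 cos0 mulr1. Qed.

Lemma is_derive_circle_mean (V : normedModType R) (K : R -> V -> R) (p v : V) : periodic_smooth K ->
  is_derive p v (fun q : V => circle_mean (fun t => K t q) : R^o) (circle_mean (fun t => ddir v K t p)).
Proof.
move=> pK; have /is_derive_cast := is_derive_coef 0 0 p v pK; apply => [q|]; exact: coef00.
Qed.

Lemma smooth_circle_mean (V : normedModType R) (K : R -> V -> R) : periodic_smooth K ->
  smooth (fun p : V => circle_mean (fun t => K t p)).
Proof.
move=> pK n; apply/Ck_onE.
(* The mean is the coefficient of index 0, a member of the family in [equiC_coef]. *)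
have := @equiC_reindex _ V nat unit setT setT setT setT (fun=> 0%N) n _ (fun _ _ => I) (fun _ _ => I)
  (equiC_coef n 0 0 pK).
rewrite (_ : _ \o _ = fun (_ : unit) (p : V) => circle_mean (fun t => K t p)) //.
by apply/funext => -[]; apply/funext => p /=; rewrite expr0 mul1r coef00.
Qed.

Lemma smooth_lift_mean F : periodic_cyl F -> smooth (lift_mean F).
Proof. by move=> pF; apply: smooth_circle_mean; exact: periodic_cyl_lift. Qed.

Lemma is_derive_lift_mean F p v : periodic_cyl F ->
  is_derive p v (lift_mean F : _ -> R^o)
    (circle_mean (fun t => phase t v * cyl_lift (fiber_derive F) t p)).
Proof.
move=> pF; have /is_derive_cast := is_derive_circle_mean p v (periodic_cyl_lift pF).
by apply => //; rewrite ddir_cyl_liftE //; exact: pF.1.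
Qed.

Lemma is_derive_lift_mean2 F p v w : periodic_cyl F ->
  'D_w ('D_v (lift_mean F : _ -> R^o)) p =
  circle_mean (fun t => phase t v * phase t w * cyl_lift (fiber_derive (fiber_derive F)) t p).
Proof.
move=> pF; have pF1 := periodic_fiber_derive pF.
have pK := periodic_ddir v (periodic_cyl_lift pF).
have -> : 'D_v (lift_mean F : _ -> R^o) = fun p => circle_mean (fun t => ddir v (cyl_lift F) t p).
  by apply/funext => q; have [_ ->] := is_derive_lift_mean q v pF; rewrite ddir_cyl_liftE //; exact: pF.1.
have [_ ->] := is_derive_circle_mean p w pK.
congr circle_mean; apply/funext => t; rewrite /ddir.
have E : 'D_v (cyl_lift F t : _ -> R^o) = fun p => phase t v * cyl_lift (fiber_derive F) t p.
  by rewrite -[LHS]/(ddir v (cyl_lift F) t) ddir_cyl_liftE //; exact: pF.1.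
rewrite E.
have [_ ->] := isdZ (ddir_cyl_lift w t p pF1.1) (phase t v).
by rewrite mulrA.
Qed.

End CylinderLift.

Section WaveEquation.
Context {R : realType}.
Implicit Types (F : 'rV[R]_2 -> R) (p : 'rV[R]_3).

Lemma phase_delta (t : R) : [/\ phase t (delta_mx 0 0) = 1, phase t (delta_mx 0 1) = cos t &
  phase t (delta_mx 0 2) = sin t].
Proof. by split; rewrite /phase !mxE /=; ring. Qed.

Lemma contf_sin_cos : contf (sin : R -> R) /\ contf (cos : R -> R).
Proof. by split; [exact: continuous_sin|exact: continuous_cos]. Qed.

Lemma contf_cyl_lift F p : periodic_cyl F -> contf (fun t => cyl_lift F t p).
Proof. by move=> /periodic_cyl_lift; exact: periodic_contf. Qed.

Lemma partial_lift_mean F p : periodic_cyl F ->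
  [/\ partial 0 (lift_mean F) p = circle_mean (fun t => cyl_lift (fiber_derive F) t p),
      partial 1 (lift_mean F) p = circle_mean (fun t => cos t * cyl_lift (fiber_derive F) t p) &
      partial 2 (lift_mean F) p = circle_mean (fun t => sin t * cyl_lift (fiber_derive F) t p)].
Proof.
move=> pF.
have D i : partial i (lift_mean F) p =
    circle_mean (fun t => phase t (delta_mx 0 i) * cyl_lift (fiber_derive F) t p).
  by have [_ E] := is_derive_lift_mean p (delta_mx 0 i) pF; exact: E.
split; apply: etrans (D _) _; apply: (f_equal circle_mean); apply/funext => t;
  by have [E0 E1 E2] := phase_delta t; rewrite ?E0 ?E1 ?E2 ?mul1r.
Qed.

(** The means that the telescoping leaves over have this form; they are thereby first derivatives of
    the transform. *)
Lemma circle_mean_phase F p (a b c : R) : periodic_cyl F ->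
  circle_mean (fun t => cyl_lift (fiber_derive F) t p * (a + b * cos t + c * sin t)) =
  a * partial 0 (lift_mean F) p + b * partial 1 (lift_mean F) p + c * partial 2 (lift_mean F) p.
Proof.
move=> pF; have [-> -> ->] := partial_lift_mean p pF.
have cG := @contf_cyl_lift _ p (periodic_fiber_derive pF).
have [cs cc] := contf_sin_cos; have L := @circle_mean_functional R.
rewrite -!(functionalZ L) //; try exact: contfM.
rewrite -!(functionalD L) //; do ?[exact: contfM|exact: contf_cst|apply: contfM => //|apply: contfD => //].
by congr circle_mean; apply/funext => t; ring.
Qed.

(** The transform is a mean of plane waves F(theta, t + x1 cos theta + x2 sin theta), each a
    solution because cos^2 + sin^2 = 1. *)
Lemma lift_mean_wave F p : periodic_cyl F ->
  partial 0 (partial 0 (lift_mean F)) p =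
  partial 1 (partial 1 (lift_mean F)) p + partial 2 (partial 2 (lift_mean F)) p.
Proof.
move=> pF; have D i := is_derive_lift_mean2 p (delta_mx 0 i) (delta_mx 0 i) pF.
have cG := @contf_cyl_lift _ p (periodic_fiber_derive (periodic_fiber_derive pF)).
have [cs cc] := contf_sin_cos; have L := @circle_mean_functional R.
have {}D i : partial i (partial i (lift_mean F)) p = circle_mean (fun t =>
    phase t (delta_mx 0 i) * phase t (delta_mx 0 i) * cyl_lift (fiber_derive (fiber_derive F)) t p).
  exact: D.
apply: etrans (D 0) _; apply: esym; apply: etrans (f_equal2 _ (D 1) (D 2)) _.
have c1 t : [/\ phase t (delta_mx 0 0) = 1, phase t (delta_mx 0 1) = cos t &
  phase t (delta_mx 0 2) = sin t] := phase_delta t.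
rewrite (_ : (fun t => phase t (delta_mx 0 1) * _ * _) =
   fun t => cos t * cos t * cyl_lift (fiber_derive (fiber_derive F)) t p); last first.
  by apply/funext => t; have [_ -> _] := c1 t.
rewrite (_ : (fun t => phase t (delta_mx 0 2) * _ * _) =
   fun t => sin t * sin t * cyl_lift (fiber_derive (fiber_derive F)) t p); last first.
  by apply/funext => t; have [_ _ ->] := c1 t.
rewrite -(functionalD L); try by apply: contfM => //; exact: contfM.
apply: (f_equal circle_mean); apply/funext => t; have [-> _ _] := c1 t.
by rewrite -mulrDl -!expr2 cos2Dsin2 expr1n.
Qed.

End WaveEquation.

Section Pullback.
Context {R : realType}.
Implicit Types (h : R[i] -> R -> R).

Definition pullback h (q : 'rV[R]_2) : R := h (expi (q 0 0)) (q 0 1).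

Lemma expiD2pi (a : R) : expi (a + 2 * pi) = expi a.
Proof.
rewrite /expi (_ : 2 * pi = pi *+ 2 :> R); last by rewrite mulr_natl.
by rewrite sinD2pi cosD2pi.
Qed.

Lemma pullback_row2 h a b : pullback h (row2 a b) = h (expi a) b.
Proof. by rewrite /pullback !mxE. Qed.

Lemma periodic_pullback h : smooth_cylinder h -> periodic_cyl (pullback h).
Proof. by move=> sh; split => // a b; rewrite !pullback_row2 expiD2pi. Qed.

Lemma transformRE h : transformR h = lift_mean (pullback h).
Proof.
apply/funext => p; rewrite /transformR /lift_mean /circle_mean; congr (_ * Rintegral _ _ _).
apply/funext => t; rewrite /cyl_lift pullback_row2; congr h.
by rewrite /phase /expi /= cosN sinN -addrA; congr (_ + _); ring.
Qed.

End Pullback.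

(** * The monopole on M *)

Section BasePoint.
Context {R : realType}.
Implicit Types (f : 'rV[R]_3 -> R) (x y : 'rV[R]_4).

Lemma base_pointD (t : R) x y : base_point (t *: x + y) = t *: base_point x + base_point y.
Proof. by apply/rowP => i; rewrite !mxE; case: i => -[|[|[|//]]] hi /=; rewrite ?mxE. Qed.

Lemma base_point_delta : [/\ base_point (delta_mx 0 o0) = delta_mx 0 0 :> 'rV[R]_3,
  base_point (delta_mx 0 o1) = 0 :> 'rV[R]_3, base_point (delta_mx 0 o2) = delta_mx 0 1 :> 'rV[R]_3 &
  base_point (delta_mx 0 o3) = delta_mx 0 2 :> 'rV[R]_3].
Proof. by split; apply/rowP => i; rewrite !mxE; case: i => -[|[|[|//]]] hi /=. Qed.

Lemma is_derive_base_point f x v : smooth f ->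
  is_derive x v (fun y => f (base_point y) : R^o) ('D_(base_point v) (f : _ -> R^o) (base_point x)).
Proof.
move=> sf; apply: is_derive_alongP.
have E : (fun t : R^o => f (base_point (t *: v + x)) : R^o) =
   (fun t : R^o => f (t *: base_point v + base_point x) : R^o).
  by apply/funext => t; rewrite base_pointD.
rewrite E; have E0 : 0 *: base_point v + base_point x = base_point x by rewrite scale0r add0r.
have := @is_derive_line _ _ _ (f : _ -> R^o) (base_point x) (base_point v) 0.
by rewrite E0; apply; exact: smooth_derivable.
Qed.

Lemma smooth_base_point f : smooth f -> smooth (fun x => f (base_point x)).
Proof.
move=> sf; apply: (@smooth_comp_row _ _ 3) => // i.
by case: i => -[|[|[|//]]] hi; under eq_fun do rewrite mxE /=; exact: smooth_coord.
Qed.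

Lemma partial_base_point i j f x : smooth f -> base_point (delta_mx 0 i) = delta_mx 0 j :> 'rV[R]_3 ->
  partial i (fun y => f (base_point y)) x = partial j f (base_point x).
Proof.
move=> sf E; apply: etrans (_ : 'D_(base_point (delta_mx 0 i)) (f : _ -> R^o) (base_point x) = _).
  by have [_ D] := is_derive_base_point x (delta_mx 0 i) sf; exact: D.
by rewrite E.
Qed.

Lemma partial1_base_point f x : smooth f -> partial o1 (fun y => f (base_point y)) x = 0.
Proof.
move=> sf; have [_ E1 _ _] := base_point_delta.
apply: etrans (_ : 'D_(base_point (delta_mx 0 o1)) (f : _ -> R^o) (base_point x) = _).
  by have [_ D] := is_derive_base_point x (delta_mx 0 o1) sf; exact: D.
rewrite E1; apply: derive_val; rewrite -[X in is_derive _ X](scale0r (0 : 'rV[R]_3)).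
have := @is_derive_scale _ _ f (base_point x) 0 0 (@smooth_derivable _ _ f _ _ sf).
by rewrite mul0r.
Qed.

Local Opaque partial.

(** Two of the monopole equations are the symmetry of second derivatives of u; the third, d_1 A2 -
    d_2 A1 = -d_t V, is the wave equation. *)
Lemma monopole_equations (u : 'rV[R]_3 -> R) (i0 i1 i2 : 'I_3) x : smooth u ->
  [/\ base_point (delta_mx 0 o0) = delta_mx 0 i0 :> 'rV[R]_3,
      base_point (delta_mx 0 o2) = delta_mx 0 i1 :> 'rV[R]_3 &
      base_point (delta_mx 0 o3) = delta_mx 0 i2 :> 'rV[R]_3] ->
  partial i0 (partial i0 u) (base_point x) =
    partial i1 (partial i1 u) (base_point x) + partial i2 (partial i2 u) (base_point x) ->
  let V y := 1 - partial i0 u (base_point y) in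
  let A1 y := - partial i2 u (base_point y) in
  let A2 y := partial i1 u (base_point y) in
  [/\ partial o1 V x = 0, partial o1 A1 x = 0 & partial o1 A2 x = 0] /\
  [/\ partial o0 A1 x = partial o3 V x, partial o0 A2 x = - partial o2 V x &
      partial o2 A2 x - partial o3 A1 x = - partial o0 V x].
Proof.
move=> su [E0 E1 E2] w V A1 A2.
have su1 j : smooth (partial j u) by exact: (smooth_derive (delta_mx 0 j) su).
have s j := smooth_base_point (su1 j).
have DV i : partial i V x = - partial i (fun y => partial i0 u (base_point y)) x.
  have h := isdB (isd_cst x (delta_mx 0 i) (1 : R)) (partial_isd i x (s i0)).
  by apply: etrans (isd_partial h) _; rewrite sub0r.
have D1 i : partial i A1 x = - partial i (fun y => partial i2 u (base_point y)) x.
  exact: (isd_partial (isdN (partial_isd i x (s i2)))).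
have sch i j : partial i (partial j u) (base_point x) = partial j (partial i u) (base_point x).
  exact: (@schwarz _ _ u (base_point x) (delta_mx 0 i) (delta_mx 0 j) (su 2)).
have b0 j := partial_base_point x (su1 j) E0.
have b1 j := partial_base_point x (su1 j) E1.
have b2 j := partial_base_point x (su1 j) E2.
have z j := partial1_base_point x (su1 j).
split; split.
- by rewrite DV z oppr0.
- by rewrite D1 z oppr0.
- exact: z.
- by rewrite D1 DV b0 b2 sch.
- rewrite DV b1 opprK; apply: etrans (b0 _) _; exact: sch.
- have c2 : partial o2 A2 x = partial i1 (partial i1 u) (base_point x) := b1 _.
  by rewrite c2 D1 DV b2 b0 w !opprK.
Qed.

End BasePoint.

Section Potentials.
Context {R : realType} (F : 'rV[R]_2 -> R) (pF : periodic_cyl F).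
Implicit Types (x : 'rV[R]_4) (p : 'rV[R]_3).

Let u := lift_mean F.

Definition potV x : R := 1 - partial 0 u (base_point x).
Definition potA1 x : R := - partial 2 u (base_point x).
Definition potA2 x : R := partial 1 u (base_point x).

Lemma smooth_partial_lift_mean i : smooth (partial i u).
Proof. exact: (smooth_derive (delta_mx 0 i) (smooth_lift_mean pF)). Qed.

Lemma smooth_potentials : [/\ smooth potV, smooth potA1 & smooth potA2].
Proof.
have s i := smooth_base_point (smooth_partial_lift_mean i).
by split; [apply: smoothB; [exact: smooth_cst|exact: s]|apply: smoothN; exact: s|exact: s].
Qed.

Lemma potential_equations x :
  [/\ partial o1 potV x = 0, partial o1 potA1 x = 0 & partial o1 potA2 x = 0] /\
  [/\ partial o0 potA1 x = partial o3 potV x, partial o0 potA2 x = - partial o2 potV x &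
      partial o2 potA2 x - partial o3 potA1 x = - partial o0 potV x].
Proof.
have [E0 _ E1 E2] := @base_point_delta R.
exact: (monopole_equations (smooth_lift_mean pF) (And3 E0 E1 E2) (lift_mean_wave (base_point x) pF)).
Qed.

Lemma metric_VA_monopole x :
  metric_VA (fun q => 1 - partial 0 u q) (fun q => check_star (check_d u q)) x =
  monopole_metric (potV x) (potA1 x) (potA2 x).
Proof.
rewrite /metric_VA /potV /potA1 /potA2 /check_star /check_d.
move: (partial 0 u _) (partial 1 u _) (partial 2 u _) => a b c.
apply/matrixP; elim/ord4_ind; elim/ord4_ind; rewrite tabE /= !(mxE, big_ord1) /=; ring.
Qed.

Lemma self_dual_potentials : (forall p, partial 0 u p < 1) ->
  self_dual_metric (fun x => monopole_metric (potV x) (potA1 x) (potA2 x)).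
Proof.
move=> u1; have [sV s1 s2] := smooth_potentials.
apply: self_dual_monopole => // x; first by rewrite subr_gt0.
all: by have [[]] := potential_equations x; move=> ? ? ? [].
Qed.

End Potentials.

(** * Holomorphic disks *)

Section Disks.
Context {R : realType}.
Implicit Types (x : 'rV[R]_4) (w : R[i]) (y : 'rV[R[i]]_4).

Lemma vpick_line y : y != 0 -> exists2 c : R[i], c != 0 & vpick <[y]>%VS = c *: y.
Proof.
move=> y0; have /vlineP[c E] := memv_pick <[y]>%VS; exists c => //.
apply/negP => /eqP c0; move: E; rewrite c0 scale0r => /eqP; rewrite vpick0.
rewrite -subv0 -memvE memv0; exact/negP.
Qed.

Lemma chart_line y i : y 0 i != 0 ->
  chart_dom i <[y]>%VS /\ forall j, chart i j <[y]>%VS = y 0 j / y 0 i.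
Proof.
move=> yi; have y0 : y != 0 by apply/negP => /eqP E; rewrite E mxE eqxx in yi.
have [c c0 E] := vpick_line y0; split; first by rewrite /chart_dom /= E mxE mulf_neq0.
by move=> j; rewrite /chart E !mxE -mulf_div divff // mul1r.
Qed.

Variable F : 'rV[R]_2 -> R.

(* On |w| = 1 this is the incidence of the point of twistor space with x, the term in Phi
   moving Im nu from 0 to h. *)
Definition disk_vec x w : 'rV[R[i]]_4 :=
  let z := x 0 2 +i* x 0 3 in
  let Phi := conj_fun (cyl_lift F) (base_point x) w in
  row4 1 w (z + (x 0 0 -i* x 0 1) * w + w * Phi) (x 0 0 +i* x 0 1 + z^* * w - Phi).

Definition disk x w : {vspace 'rV[R[i]]_4} := <[disk_vec x w]>%VS.

Lemma disk_vec0 x w : disk_vec x w 0 0 = 1. Proof. by rewrite mxE. Qed.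

Lemma disk_chart x w : chart_dom 0 (disk x w) /\ forall j, chart 0 j (disk x w) = disk_vec x w 0 j.
Proof.
have y0 : disk_vec x w 0 0 != 0 by rewrite disk_vec0 oner_eq0.
by have [d E] := chart_line y0; split => // j; rewrite E disk_vec0 divr1.
Qed.

Lemma twistor_space_disk x w : twistor_space (disk x w).
Proof.
have y0 : disk_vec x w != 0.
  by apply/negP => /eqP E; have := disk_vec0 x w; rewrite E mxE => /eqP; rewrite eq_sym oner_eq0.
split; first by rewrite /CP3 /= dim_vline y0.
exists (disk_vec x w); first exact: memv_line.
by rewrite disk_vec0 xpair_eqE oner_eq0.
Qed.

Hypothesis pF : periodic_cyl F.

Lemma holomorphic_disk x : holomorphic_in_disk (disk x).
Proof.
move=> w0 w1; exists 0; split.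
  by exists 1; [exact: ltr01|move=> w _; have [] := disk_chart x w].
have {}w1 : sqnorm w0 < 1.
  have : (sqnorm w0)%:C < 1 by rewrite -normC_sqr expr_lt1.
  by rewrite -[1](rmorph1 (real_complex R)) ltcR.
have dP := @derivable_conj_fun _ _ _ (base_point x) _ (periodic_cyl_lift pF) w1.
have dI : derivable (id : R[i]^o -> R[i]^o) w0 1 by exact: derivable_id.
have dC (c : R[i]) : derivable (cst c : R[i]^o -> R[i]^o) w0 1 by exact: derivable_cst.
move=> j; rewrite (_ : (fun w => _) = fun w => disk_vec x w 0 j); last first.
  by apply/funext => w; have [_ ->] := disk_chart x w.
elim/ord4_ind: j; under eq_fun do rewrite mxE /=.
- exact: dC.
- exact: dI.
- exact: (derivableD (derivableD (dC _) (derivableM (dC _) dI)) (derivableM dI dP)).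
- exact: (derivableB (derivableD (dC _) (derivableM (dC _) dI)) dP).
Qed.

(** Thanks to the cutoffs, [disk_vec] is smooth on all of M x R^2 and serves as its own extension
    beyond the boundary; as its first coordinate is 1, one chart suffices. *)
Lemma smooth_family_disk : smooth_family disk.
Proof.
move=> x0 w0 _; exists 0, setT, (fun j q => disk_vec q.1 (plane q.2) 0 j).
split => //; first exact: openT; last by move=> x w _ _; exact: disk_chart.
have s1 i : smooth (fun q : ('rV[R]_4 * 'rV[R]_2)%type => q.1 0 i).
  apply: (@smooth_affine _ _ 'rV[R]_4 fst fst (fun r => r 0 i)) => //; last exact: smooth_coord.
  by move=> q; exact: cvg_fst.
have s2 i : smooth (fun q : ('rV[R]_4 * 'rV[R]_2)%type => q.2 0 i).
  apply: (@smooth_affine _ _ 'rV[R]_2 snd snd (fun r => r 0 i)) => //; last exact: smooth_coord.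
  by move=> q; exact: cvg_snd.
have sP c : smooth (fun q : ('rV[R]_4 * 'rV[R]_2)%type =>
    conj_series c (cyl_lift F) (base_point q.1, q.2)).
  apply: (@smooth_affine _ _ _ (fun q : ('rV[R]_4 * 'rV[R]_2)%type => (base_point q.1, q.2))
    (fun q => (base_point q.1, q.2))); last by apply: smooth_conj_series; exact: periodic_cyl_lift.
    by move=> t v q; rewrite /= base_pointD.
  move=> q.
  suff c1 : (fun q : ('rV[R]_4 * 'rV[R]_2)%type => base_point q.1) @ q --> base_point q.1.
    exact: (cvg_pair c1 cvg_snd).
  apply: cvg_mx => i j; rewrite !mxE.
  by case: j => -[|[|[|//]]] hj; under eq_fun do rewrite mxE /=; exact: smooth_continuous (s1 _) q.
have E j : (forall q : ('rV[R]_4 * 'rV[R]_2)%type,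
   complex.Re (disk_vec q.1 (plane q.2) 0 j) = nth 0 [:: 1; q.2 0 0;
      q.1 0 2 + (q.1 0 0 * q.2 0 0 + q.1 0 1 * q.2 0 1) +
        (q.2 0 0 * conj_series 1 (cyl_lift F) (base_point q.1, q.2)
         - q.2 0 1 * conj_series (- 'i) (cyl_lift F) (base_point q.1, q.2));
      q.1 0 0 + (q.1 0 2 * q.2 0 0 + q.1 0 3 * q.2 0 1)
        - conj_series 1 (cyl_lift F) (base_point q.1, q.2)] j) /\
   (forall q : ('rV[R]_4 * 'rV[R]_2)%type,
   complex.Im (disk_vec q.1 (plane q.2) 0 j) = nth 0 [:: 0; q.2 0 1;
      q.1 0 3 + (q.1 0 0 * q.2 0 1 - q.1 0 1 * q.2 0 0) +
        (q.2 0 0 * conj_series (- 'i) (cyl_lift F) (base_point q.1, q.2)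
         + q.2 0 1 * conj_series 1 (cyl_lift F) (base_point q.1, q.2));
      q.1 0 1 + (q.1 0 2 * q.2 0 1 - q.1 0 3 * q.2 0 0)
        - conj_series (- 'i) (cyl_lift F) (base_point q.1, q.2)] j).
  split => q; rewrite mxE /conj_fun complex_row_plane;
  move: (conj_series 1 (cyl_lift F) (base_point q.1, q.2)) => P;
  move: (conj_series (- 'i) (cyl_lift F) (base_point q.1, q.2)) => Q;
  by elim/ord4_ind: j => /=; ring.
move=> j; have [E1 E2] := E j.
split; [under eq_fun do rewrite E1|under eq_fun do rewrite E2]; elim/ord4_ind: j {E1 E2} => /=;
  by do ?[exact: smooth_cst|exact: s1|exact: s2|exact: sP|apply: smoothB|apply: smoothD|apply: smoothM].
Qed.

End Disks.

(** * Incidence of points of P_h with disk boundaries *)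

Section Incidence.
Context {R : realType}.
Implicit Types (x : 'rV[R]_4) (w nu : R[i]) (theta v : R).

Lemma norm_expi theta : `|expi theta| = 1 :> R[i].
Proof.
have : `|expi theta| ^+ 2 = 1 :> R[i].
  by rewrite normC_sqr /sqnorm /expi /= cos2Dsin2.
by move/eqP; rewrite sqrp_eq1 // => /eqP.
Qed.

Lemma expiD a b : expi (a + b) = expi a * expi b :> R[i].
Proof. by rewrite /expi cosD sinD; apply/eqP; rewrite eq_complex /= [X in _ && (_ == X)]addrC !eqxx. Qed.

Lemma expi_neq0 theta : expi theta != 0 :> R[i].
Proof. by rewrite -normr_eq0 norm_expi oner_eq0. Qed.

Lemma unit_complex_expi w : `|w| = 1 -> exists theta, w = expi theta.
Proof.
move=> w1; have : sqnorm w = 1.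
  have : (sqnorm w)%:C = 1%:C :> R[i] by rewrite -normC_sqr w1 expr1n.
  by case.
case: w {w1} => a b; rewrite /sqnorm /= => ab.
have a1 : -1 <= a <= 1.
  by have b2 := sqr_ge0 b; apply/andP; split; nra.
have ca : cos (acos a) = a by rewrite acosK.
have sa : sin (acos a) = `|b|.
  by rewrite sin_acos // -(sqrtr_sqr b); congr Num.sqrt; rewrite -ab addrAC subrr add0r.
have [b0|b0] := leP 0 b; first by exists (acos a); rewrite /expi ca sa ger0_norm.
by exists (- acos a); rewrite /expi cosN sinN ca sa ltr0_norm // opprK.
Qed.

(** The homogeneous coordinates of [twistor_point] multiplied by e^(i theta/2): the first one
    becomes 1, as in [disk_vec], and the half angles disappear. *)
Definition incidence_vec theta v nu : 'rV[R[i]]_4 :=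
  row4 1 (expi theta) (expi theta * (v%:C - 'i * nu)) (v%:C + 'i * nu).

Lemma twistor_pointE theta v nu : twistor_point theta v nu = <[incidence_vec theta v nu]>%VS.
Proof.
have e2 : expi (theta / 2) * expi (theta / 2) = expi theta :> R[i].
  by rewrite -expiD; congr expi; field.
have e0 : expi (- (theta / 2)) * expi (theta / 2) = 1 :> R[i].
  by rewrite -expiD addNr /expi cos0 sin0.
have E : row4 (expi (- (theta / 2))) (expi (theta / 2)) (expi (theta / 2) * (v%:C - 'i * nu))
      (expi (- (theta / 2)) * (v%:C + 'i * nu)) = expi (- (theta / 2)) *: incidence_vec theta v nu.
  by apply/rowP => i; rewrite !mxE -e2; elim/ord4_ind: i => /=; rewrite ?mulr1 ?mulrA ?e0 ?mul1r.
rewrite /twistor_point E; apply/eqP; rewrite eqEsubv -!memvE; apply/andP; split.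
  exact: memvZ (memv_line _).
apply/vlineP; exists (expi (- (theta / 2)))^-1.
by rewrite scalerA mulVf ?expi_neq0 // scale1r.
Qed.

Lemma line_inj (y y' : 'rV[R[i]]_4) : y 0 0 = 1 -> y' 0 0 = 1 -> <[y]>%VS = <[y']>%VS -> y = y'.
Proof.
move=> y0 y0' E; have : y \in <[y']>%VS by rewrite -E memv_line.
by move=> /vlineP[c Ec]; move: y0; rewrite Ec mxE y0' mulr1 => ->; rewrite scale1r.
Qed.

Definition conj_im F theta (p : 'rV[R]_3) : R :=
  conj_series (- 'i) (cyl_lift F) (p, unit_row theta).

(** The number s - Im(z conj(w)) - Im Phi, which is Re nu at the boundary point of angle theta. *)
Definition height F theta x : R :=
  x 0 1 - (x 0 3 * cos theta - x 0 2 * sin theta) - conj_im F theta (base_point x).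

Lemma disk_vec_expi F x theta : periodic_cyl F ->
  disk_vec F x (expi theta) =
  incidence_vec theta (phase theta (base_point x))
    (height F theta x +i* cyl_lift F theta (base_point x)).
Proof.
move=> pF; have E : complex_row (expi theta) = unit_row theta by [].
rewrite /disk_vec /conj_fun E conj_series_inversion; last exact: periodic_cyl_lift.
rewrite -/(conj_im F theta (base_point x)) /height /phase !mxE /=.
move: (conj_im _ _ _) (cyl_lift _ _ _) => Q P.
have cs := cos2Dsin2 theta.
apply/rowP; elim/ord4_ind; rewrite !mxE //=; apply/eqP; rewrite eq_complex /=;
  apply/andP; split; apply/eqP; move: cs; move: (cos theta) (sin theta) => c s cs.
(* In the third coordinate z has to be read as w conj(w) z. *)
- have E1 : x 0 2 = (c ^+ 2 + s ^+ 2) * x 0 2 by rewrite cs mul1r.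
  by rewrite [X in X + _ + _ = _]E1; ring.
- have E1 : x 0 3 = (c ^+ 2 + s ^+ 2) * x 0 3 by rewrite cs mul1r.
  by rewrite [X in X + _ + _ = _]E1; ring.
- ring.
- ring.
Qed.

Lemma incidence_vec_inj theta v nu v' nu' :
  incidence_vec theta v nu = incidence_vec theta v' nu' -> v = v' /\ nu = nu'.
Proof.
move=> /rowP E; have := E o2; have := E o3; rewrite !mxE /= => E3 /(mulfI (expi_neq0 _)) E2.
case: nu nu' {E} E2 E3 => a b [a' b'] [e1 e2] [e3 e4].
move: e1 e2 e3 e4 => /= e1 e2 e3 e4.
by split; [lra|congr (_ +i* _); lra].
Qed.

(** The coordinate w fixes the angle, and Im nu agrees automatically since both points lie over the
    same value of the function [F]. Two real equations remain, which is why the incidence sets are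
    surfaces. *)
Lemma disk_boundaryP F x theta v nu : periodic_cyl F ->
  complex.Im nu = F (row2 theta v) ->
  disk_boundary (disk F x) (twistor_point theta v nu) <->
  phase theta (base_point x) = v /\ height F theta x = complex.Re nu.
Proof.
move=> pF hnu; split.
  case=> w /unit_complex_expi[theta' ->]; rewrite twistor_pointE /disk => /line_inj.
  rewrite disk_vec0 mxE => /(_ erefl erefl) E.
  have e1 : expi theta' = expi theta by have /rowP/(_ o1) := E; rewrite !mxE.
  move: E; rewrite e1 disk_vec_expi // => /incidence_vec_inj[-> <-]; by [].
move=> [e1 e2]; exists (expi theta); first exact: norm_expi.
rewrite twistor_pointE /disk disk_vec_expi // e1 e2 /cyl_lift e1 -hnu.
by case: nu {hnu e2}.
Qed.

Lemma twistor_P_disk (h : R[i] -> R -> R) x w : smooth_cylinder h -> `|w| = 1 -> twistor_P h (disk (pullback h) x w).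
Proof.
move=> /periodic_pullback pF /unit_complex_expi[theta ->].
rewrite /disk disk_vec_expi // -twistor_pointE; do 3 eexists; split; last by [].
by rewrite /cyl_lift pullback_row2.
Qed.

Lemma smooth_disk_family_disk (h : R[i] -> R -> R) : smooth_cylinder h -> smooth_disk_family h (disk (pullback h)).
Proof.
move=> sh; have pF := periodic_pullback sh; split.
- by move=> x w _; exact: twistor_space_disk.
- by move=> x w; exact: twistor_P_disk.
- exact: holomorphic_disk.
- exact: smooth_family_disk.
Qed.

End Incidence.

(** * Null planes and beta-surfaces *)

Section NullPlanes.
Context {R : realType}.
Implicit Types (V A c s : R).

(* They span the beta-plane at angle theta, for c = cos theta and s = sin theta. *)
Definition null1 A1 A2 c s : 'rV[R]_4 := row4 (- 1) (- (A1 * c + A2 * s)) c s.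
Definition null2 V A1 A2 c s : 'rV[R]_4 := row4 0 (V + s * A1 - c * A2) (- s) c.

(* Rows: d_t, V d_s, d_1 - A1 d_s and d_2 - A2 d_s. *)
Definition orthoframe V A1 A2 : 'M[R]_4 := tab
  [:: [:: 1; 0; 0; 0]; [:: 0; V; 0; 0]; [:: 0; - A1; 1; 0]; [:: 0; - A2; 0; 1]].

Lemma orthoframe_unit V A1 A2 : V != 0 -> orthoframe V A1 A2 \in unitmx.
Proof.
move=> V0; pose Q : 'M[R]_4 := tab
  [:: [:: 1; 0; 0; 0]; [:: 0; V^-1; 0; 0]; [:: 0; V^-1 * A1; 1; 0]; [:: 0; V^-1 * A2; 0; 1]].
have E : orthoframe V A1 A2 *m Q = 1%:M.
  by apply/matrixP; elim/ord4_ind; elim/ord4_ind; rewrite !mxE ?sum4 !tabE /=; field.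
by have [] := mulmx1_unit E.
Qed.

Definition neutral_form : 'M[R]_4 := diag_mx (row4 (- 1) (- 1) 1 1).

Lemma monopole_orthoframe V A1 A2 : V != 0 ->
  orthoframe V A1 A2 *m monopole_metric V A1 A2 *m (orthoframe V A1 A2)^T = V *: neutral_form.
Proof.
have trE (M : 'M[R]_4) i j : M^T i j = M j i by rewrite mxE.
move=> V0; pose G : 'M[R]_4 := tab
  [:: [:: - V; 0; 0; 0]; [:: 0; - 1; - A1; - A2]; [:: 0; 0; V; 0]; [:: 0; 0; 0; V]].
have -> : orthoframe V A1 A2 *m monopole_metric V A1 A2 = G.
  by apply/matrixP; elim/ord4_ind; elim/ord4_ind; rewrite !mxE ?sum4 !tabE /=; field.
apply/matrixP; elim/ord4_ind; elim/ord4_ind;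
  rewrite [LHS]mxE sum4 !trE !tabE !mxE /=; ring.
Qed.

Lemma signature_monopole V A1 A2 : 0 < V -> signature_mmpp (monopole_metric V A1 A2).
Proof.
move=> V0; have r0 : Num.sqrt V != 0 by rewrite gt_eqF // sqrtr_gt0.
have Vn : V != 0 by rewrite gt_eqF.
exists ((Num.sqrt V)^-1 *: orthoframe V A1 A2).
  by rewrite unitmxZ ?orthoframe_unit // unitfE invr_eq0.
rewrite linearZ /= -!scalemxAl -!scalemxAr monopole_orthoframe // !scalerA.
rewrite -invfM -expr2 sqr_sqrtr ?ltW // mulVf // scale1r.
by [].
Qed.

(** In the orthoframe the null vectors have coefficients independent of V and A, so questions about
    null planes reduce to the flat form. *)
Lemma null_orthoframe V A1 A2 c s :
  null1 A1 A2 c s = row4 (- 1) 0 c s *m orthoframe V A1 A2 /\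
  null2 V A1 A2 c s = row4 0 1 (- s) c *m orthoframe V A1 A2.
Proof. by split; apply/rowP; elim/ord4_ind; rewrite !mxE sum4 !tabE !mxE /=; ring. Qed.

Definition null_on (g : 'M[R]_4) (n1 n2 : 'rV[R]_4) : Prop :=
  [/\ n1 *m g *m n1^T = 0, n1 *m g *m n2^T = 0 & n2 *m g *m n2^T = 0].

Lemma bilinear4 (q : 'M[R]_4) (a b c d a' b' c' d' : R) :
  row4 a b c d *m q *m (row4 a' b' c' d')^T = 0 ->
  a * (a' * q o0 o0 + b' * q o0 o1 + c' * q o0 o2 + d' * q o0 o3) +
  b * (a' * q o1 o0 + b' * q o1 o1 + c' * q o1 o2 + d' * q o1 o3) +
  c * (a' * q o2 o0 + b' * q o2 o1 + c' * q o2 o2 + d' * q o2 o3) +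
  d * (a' * q o3 o0 + b' * q o3 o1 + c' * q o3 o2 + d' * q o3 o3) = 0.
Proof.
have mE m (u : 'rV[R]_4) (M : 'M[R]_(4, m)) j : (u *m M) 0 j = \sum_k u 0 k * M k j by rewrite mxE.
have trE (u : 'rV[R]_4) i : u^T i 0 = u 0 i by rewrite mxE.
move=> /matrixP/(_ 0 0); rewrite mE [X in _ = X]mxE sum4 !mE !sum4 !trE !mxE /= => <-.
ring.
Qed.

(* The five directions (1, 0), (-1, 0), (0, 1), (0, -1), (3/5, 4/5) already determine the form. *)
Lemma null_form_determined (q : 'M[R]_4) : q^T = q ->
  (forall c s, c ^+ 2 + s ^+ 2 = 1 ->
     null_on q (row4 (- 1) 0 c s) (row4 0 1 (- s) c)) ->
  q = - q o0 o0 *: neutral_form.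
Proof.
move=> qT H.
have sym i j : q i j = q j i by rewrite -{1}qT mxE.
have [] := H 1 0 ltac:(ring) => /bilinear4 a1 /bilinear4 a2 /bilinear4 a3.
have [] := H (- 1) 0 ltac:(ring) => /bilinear4 b1 /bilinear4 b2 /bilinear4 b3.
have [] := H 0 1 ltac:(ring) => /bilinear4 c1 /bilinear4 c2 /bilinear4 c3.
have [] := H 0 (- 1) ltac:(ring) => /bilinear4 d1 /bilinear4 d2 /bilinear4 d3.
have cs : (3 / 5) ^+ 2 + (4 / 5) ^+ 2 = 1 :> R by field.
have [] := H _ _ cs => /bilinear4 e1 /bilinear4 e2 /bilinear4 e3.
move: (sym o1 o0) (sym o2 o0) (sym o3 o0) (sym o2 o1) (sym o3 o1) (sym o3 o2) => s1 s2 s3 s4 s5 s6.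
rewrite s1 s2 s3 s4 s5 s6 in a1 a2 a3 b1 b2 b3 c1 c2 c3 d1 d2 d3 e1 e2 e3.
have h02 : q o0 o2 = 0 by clear - a1 b1; lra.
have h22 : q o2 o2 = - q o0 o0 by clear - a1 b1; lra.
have h03 : q o0 o3 = 0 by clear - c1 d1; lra.
have h33 : q o3 o3 = - q o0 o0 by clear - c1 d1; lra.
have h23 : q o2 o3 = 0 by clear - e1 h02 h22 h03 h33; lra.
have h01 : q o0 o1 = 0 by clear - a2 b2 h23; lra.
have h12 : q o1 o2 = 0 by clear - a2 b2 h23 h03; lra.
have h13 : q o1 o3 = 0 by clear - c2 d2 h23 h02; lra.
have h11 : q o1 o1 = q o0 o0 by clear - a3 h33 h13; lra.
apply/matrixP; elim/ord4_ind; elim/ord4_ind;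
  by rewrite ?(s1, s2, s3, s4, s5, s6) !mxE /= ?(h01, h02, h03, h12, h13, h23, h11, h22, h33) /=; ring.
Qed.

(** In the orthoframe the claim is [null_form_determined]. The first frame vector is d_t, so the
    factor can be read off from the entry (d_t, d_t), which is -V in the metric. *)
Lemma null_planes_determine V A1 A2 (g : 'M[R]_4) : V != 0 -> g^T = g ->
  (forall c s, c ^+ 2 + s ^+ 2 = 1 -> null_on g (null1 A1 A2 c s) (null2 V A1 A2 c s)) ->
  g = (- g o0 o0 * V^-1) *: monopole_metric V A1 A2.
Proof.
move=> V0 gT H; pose P := orthoframe V A1 A2; have Pu := orthoframe_unit A1 A2 V0.
have E : P *m g *m P^T = - g o0 o0 *: neutral_form.
  have -> : g o0 o0 = (P *m g *m P^T) o0 o0.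
    have trE (M : 'M[R]_4) i j : M^T i j = M j i by rewrite mxE.
    have mE (M N : 'M[R]_4) i j : (M *m N) i j = \sum_k M i k * N k j by rewrite mxE.
    by rewrite mE sum4 !mE !sum4 !trE !tabE /=; ring.
  apply: null_form_determined; first by rewrite !trmx_mul trmxK gT mulmxA.
  move=> c s cs; have [] := H c s cs; have [-> ->] := null_orthoframe V A1 A2 c s.
  by rewrite !trmx_mul !mulmxA => h1 h2 h3; split; rewrite !mulmxA.
have E2 : P *m g *m P^T = P *m ((- g o0 o0 * V^-1) *: monopole_metric V A1 A2) *m P^T.
  by rewrite -scalemxAr -scalemxAl monopole_orthoframe // scalerA mulfVK.
have PTu : P^T \in unitmx by rewrite unitmx_tr.
by have /(can_inj (mulKmx Pu)) := can_inj (mulmxK PTu) E2.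
Qed.

Lemma null_monopole V A1 A2 c s : V != 0 -> c ^+ 2 + s ^+ 2 = 1 ->
  null_on (monopole_metric V A1 A2) (null1 A1 A2 c s) (null2 V A1 A2 c s).
Proof.
move=> V0 cs.
have [-> ->] := null_orthoframe V A1 A2 c s; set P := orthoframe _ _ _.
have E (a b : 'rV[R]_4) : a *m P *m monopole_metric V A1 A2 *m (b *m P)^T =
    V *: (a *m neutral_form *m b^T).
  transitivity (a *m (P *m monopole_metric V A1 A2 *m P^T) *m b^T).
    by rewrite trmx_mul !mulmxA.
  by rewrite monopole_orthoframe // -scalemxAr -scalemxAl.
have mE m (u : 'rV[R]_4) (M : 'M[R]_(4, m)) j : (u *m M) 0 j = \sum_k u 0 k * M k j by rewrite mxE.
have trE (u : 'rV[R]_4) i : u^T i 0 = u 0 i by rewrite mxE.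
split; rewrite E; apply/matrixP => i j; rewrite !ord1 [LHS]mxE mE sum4 !mE !sum4 !trE !mxE /=.
- by transitivity (V * (c ^+ 2 + s ^+ 2 - 1)); [ring|rewrite cs; ring].
- ring.
- by transitivity (V * (c ^+ 2 + s ^+ 2 - 1)); [ring|rewrite cs; ring].
Qed.

Lemma lower_null V A1 A2 c s : V != 0 ->
  null1 A1 A2 c s *m monopole_metric V A1 A2 = row4 V 0 (c * V) (s * V) /\
  null2 V A1 A2 c s *m monopole_metric V A1 A2 = row4 0 (- 1) (- A1 - s * V) (c * V - A2).
Proof.
by move=> V0; split; apply/rowP; elim/ord4_ind; rewrite [LHS]mxE sum4 !tabE !mxE /=; field.
Qed.

Lemma dual4Z (k : R) (B : 'M[R]_4) : dual4 (k *: B) = k *: dual4 B.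
Proof.
by apply/matrixP; elim/ord4_ind; elim/ord4_ind; rewrite tabE [RHS]mxE tabE /= ?mxE; ring.
Qed.

(** Any two vectors of the plane have a bivector proportional to that of [null1] and [null2]. The
    star raises the indices that [bivector_flat] has lowered, so the claim becomes an identity
    between V times the dual of this bivector and its lowered form. *)
Lemma hodge_null_plane V A1 A2 c s (u w : 'rV[R]_4) (a b a' b' : R) :
  0 < V -> c ^+ 2 + s ^+ 2 = 1 ->
  u = a *: null1 A1 A2 c s + b *: null2 V A1 A2 c s ->
  w = a' *: null1 A1 A2 c s + b' *: null2 V A1 A2 c s ->
  hodge (monopole_metric V A1 A2) (bivector_flat (monopole_metric V A1 A2) u w) =
  - bivector_flat (monopole_metric V A1 A2) u w.
Proof.
move=> V_gt0 cs Eu Ew; have V0 : V != 0 by rewrite gt_eqF.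
set g := monopole_metric V A1 A2; set n1 := null1 A1 A2 c s; set n2 := null2 V A1 A2 c s.
have gT : g^T = g := monopole_metric_sym V A1 A2.
have gu : g \in unitmx := monopole_metric_unit A1 A2 V0.
pose B := n1^T *m n2 - n2^T *m n1.
have EB : u^T *m w - w^T *m u = (a * b' - b * a') *: B.
  have wedge (m1 m2 : 'rV[R]_4) : (a *: m1 + b *: m2)^T *m (a' *: m1 + b' *: m2) -
      (a' *: m1 + b' *: m2)^T *m (a *: m1 + b *: m2) = (a * b' - b * a') *: (m1^T *m m2 - m2^T *m m1).
    by apply/matrixP => i j; rewrite !mxE !big_ord1 !mxE; ring.
  by rewrite Eu Ew wedge.
have bT : (bivector_flat g u w)^T = - bivector_flat g u w.
  have wT : (u^T *m w - w^T *m u)^T = - (u^T *m w - w^T *m u).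
    by rewrite linearB /= !trmx_mul !trmxK opprB.
  by rewrite /bivector_flat trmx_mul (trmx_mul g) wT trmxK mulNmx mulmxN mulmxA gT.
rewrite hodge_dual4 // det_monopole_metric // ger0_norm ?sqr_ge0 // sqrtr_sqr gtr0_norm //.
rewrite {1}/bivector_flat gT mulmxA mulKmx // mulmxK //= /bivector_flat EB.
rewrite dual4Z.
suff E : V *: dual4 B = - (g *m B *m g^T).
  by rewrite scalerA mulrC -scalerA E scalerN -scalemxAr -scalemxAl.
(* The identity holds modulo c^2 + s^2 = 1; [T] is the explicit cofactor of c^2 + s^2 - 1. *)
pose T : 'M[R]_4 := tab [:: [:: 0; V; V * A1; V * A2]; [:: - V; 0; 0; 0];
   [:: - (V * A1); 0; 0; V ^+ 2]; [:: - (V * A2); 0; - V ^+ 2; 0]].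
have [l1 l2] := lower_null A1 A2 c s V0.
have E : V *: dual4 B + g *m B *m g^T = (c ^+ 2 + s ^+ 2 - 1) *: T.
  have -> : g *m B *m g^T = (n1 *m g)^T *m (n2 *m g) - (n2 *m g)^T *m (n1 *m g).
    by rewrite /B gT !trmx_mul gT mulmxBr mulmxBl !mulmxA.
  have BE i j : B i j = n1 0 i * n2 0 j - n2 0 i * n1 0 j by rewrite !mxE !big_ord1 !mxE.
  have WE (m1 m2 : 'rV[R]_4) i j : (m1^T *m m2 - m2^T *m m1) i j = m1 0 i * m2 0 j - m2 0 i * m1 0 j.
    by rewrite !mxE !big_ord1 !mxE.
  have ZE k (X : 'M[R]_4) i j : (k *: X) i j = k * X i j by rewrite mxE.
  have SE (X Y : 'M[R]_4) i j : (X + Y) i j = X i j + Y i j by rewrite mxE.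
  rewrite l1 l2; apply/matrixP; elim/ord4_ind; elim/ord4_ind;
  rewrite SE WE !ZE /dual4 /T !tabE /= ?BE /n1 /n2 !mxE /=; ring.
by apply/eqP; rewrite -subr_eq0 opprK E cs subrr scale0r.
Qed.

End NullPlanes.

(** * Tangent planes of the incidence surfaces *)

Section IncidenceSurfaces.
Context {R : realType} {F : 'rV[R]_2 -> R} (pF : periodic_cyl F).
Implicit Types (x u : 'rV[R]_4) (p q : 'rV[R]_3) (theta v r : R).

Let U := lift_mean F.

Lemma is_derive_conj_im theta p q : is_derive p q (conj_im F theta : _ -> R^o)
  (conj_series (- 'i) (ddir q (cyl_lift F)) (p, unit_row theta)).
Proof.
apply: is_derive_alongP.
have d := is_derive_conj_series (- 'i) (p, unit_row theta) q (periodic_cyl_lift pF).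
have E : (fun t : R^o => conj_im F theta (t *: q + p) : R^o) =
   (fun t : R^o => conj_series (- 'i) (cyl_lift F) (t *: ((q, 0) : ('rV[R]_3 * 'rV[R]_2)%type)
      + (p, unit_row theta)) : R^o).
  apply/funext => t; rewrite /conj_im; congr (conj_series _ _ _).
  by rewrite [RHS]surjective_pairing /= scaler0 add0r.
rewrite E; have [d1 d2] := d.
have E0 : 0 *: ((q, 0) : ('rV[R]_3 * 'rV[R]_2)%type) + (p, unit_row theta) = (p, unit_row theta).
  by rewrite scale0r add0r.
have := @is_derive_line _ _ _ (conj_series (- 'i) (cyl_lift F) : _ -> R^o) (p, unit_row theta) (q, 0) 0.
by rewrite E0 d2; apply.
Qed.

Lemma smooth_conj_im theta : smooth (conj_im F theta).
Proof.
apply: (@smooth_affine _ _ ('rV[R]_3 * 'rV[R]_2)%type (fun p => (p, unit_row theta))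
  (fun p => (p, 0)) (conj_series (- 'i) (cyl_lift F))).
- by move=> t p q; rewrite [RHS]surjective_pairing /= scaler0 add0r.
- move=> p; exact: (cvg_pair (@cvg_id _ (nbhs p)) (@cst_continuous _ _ (unit_row theta) p)).
- by apply: smooth_conj_series; exact: periodic_cyl_lift.
Qed.

(** In this direction the lift is differentiated to the lift of the fibre derivative times cos(t -
    theta) - 1, the factor of [conj_series_radial]; sin(t - theta) is then expanded. *)
Lemma conj_im_radial theta p :
  'D_(row3 (- 1) (cos theta) (sin theta)) (conj_im F theta : _ -> R^o) p =
  cos theta * partial 2 U p - sin theta * partial 1 U p.
Proof.
have [_ ->] := is_derive_conj_im theta p (row3 (- 1) (cos theta) (sin theta)).
have pK := periodic_ddir (row3 (- 1) (cos theta) (sin theta)) (periodic_cyl_lift pF).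
rewrite (@conj_series_radial _ _ _ (cyl_lift (fiber_derive F)) p theta pK); last first.
- move=> t; rewrite ddir_cyl_liftE; last exact: pF.1.
  by rewrite /phase !mxE /= cosB; ring.
- by apply: periodic_cyl_lift; exact: periodic_fiber_derive.
have := circle_mean_phase p 0 (- sin theta) (cos theta) pF; rewrite -/U => E.
transitivity (circle_mean (fun t => cyl_lift (fiber_derive F) t p *
    (0 + - sin theta * cos t + cos theta * sin t))).
  by apply: (f_equal circle_mean); apply/funext => t; rewrite sinB; ring.
by apply: etrans E _; move: (partial 0 U p) (partial 1 U p) (partial 2 U p) => a b c; ring.
Qed.

(** In this direction the factor is sin(t - theta), that of [conj_series_angular]; the term 1 in 1 +
    cos(t - theta) brings in the time derivative of the transform. *)
Lemma conj_im_angular theta p :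
  'D_(row3 0 (- sin theta) (cos theta)) (conj_im F theta : _ -> R^o) p =
  - (partial 0 U p + cos theta * partial 1 U p + sin theta * partial 2 U p).
Proof.
have [_ ->] := is_derive_conj_im theta p (row3 0 (- sin theta) (cos theta)).
have pK := periodic_ddir (row3 0 (- sin theta) (cos theta)) (periodic_cyl_lift pF).
rewrite (@conj_series_angular _ _ _ (cyl_lift (fiber_derive F)) p theta pK); last first.
- move=> t; rewrite ddir_cyl_liftE; last exact: pF.1.
  by rewrite /phase !mxE /= sinB; ring.
- by apply: periodic_cyl_lift; exact: periodic_fiber_derive.
have := circle_mean_phase p 1 (cos theta) (sin theta) pF; rewrite -/U => E.
transitivity (- circle_mean (fun t => cyl_lift (fiber_derive F) t p *
    (1 + cos theta * cos t + sin theta * sin t))).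
  by congr (- circle_mean _); apply/funext => t; rewrite cosB; ring.
by rewrite E mul1r.
Qed.

Definition dheight theta x u : R :=
  u 0 1 - (u 0 3 * cos theta - u 0 2 * sin theta)
  - 'D_(base_point u) (conj_im F theta : _ -> R^o) (base_point x).

Lemma is_derive_phase theta x u :
  is_derive x u (fun y => phase theta (base_point y) : R^o) (phase theta (base_point u)).
Proof.
apply: (@is_derive_linear _ _ _ (fun u => phase theta (base_point u))) => t.
by rewrite base_pointD /phase !mxE; ring.
Qed.

Lemma smooth_phase theta : smooth (fun y : 'rV[R]_4 => phase theta (base_point y)).
Proof.
rewrite (_ : (fun y => _) = fun y : 'rV[R]_4 => y 0 0 + y 0 2 * cos theta + y 0 3 * sin theta).
  by do ?[exact: smooth_coord|exact: smooth_cst|apply: smoothD|apply: smoothM].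
by apply/funext => y; rewrite /phase !mxE.
Qed.

Lemma is_derive_height theta x u :
  is_derive x u (height F theta : _ -> R^o) (dheight theta x u).
Proof.
have d := is_derive_base_point x u (smooth_conj_im theta).
pose L (y : 'rV[R]_4) : R := y 0 1 - (y 0 3 * cos theta - y 0 2 * sin theta).
have dL : is_derive x u (L : _ -> R^o) (L u).
  by apply: is_derive_linear => t; rewrite /L !mxE; ring.
exact: (isdB dL d).
Qed.

Lemma smooth_height theta : smooth (height F theta).
Proof.
apply: smoothB; last by apply: smooth_base_point; exact: smooth_conj_im.
by do ?[exact: smooth_coord|exact: smooth_cst|apply: smoothB|apply: smoothM].
Qed.

Lemma derive_comb theta p q1 q2 (a b : R) :
  'D_(a *: q1 + b *: q2) (conj_im F theta : _ -> R^o) p =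
  a * 'D_q1 (conj_im F theta : _ -> R^o) p + b * 'D_q2 (conj_im F theta : _ -> R^o) p.
Proof.
have s := smooth_conj_im theta.
have d q (t : R) := @derive_val _ _ _ _ _ _ _ (@is_derive_scale _ _ _ p q t (@smooth_derivable _ _ _ p q s)).
by rewrite (@derive_dirD _ _ _ p _ _ (s 1)) !d.
Qed.

Let n1 theta x := null1 (potA1 F x) (potA2 F x) (cos theta) (sin theta).
Let n2 theta x := null2 (potV F x) (potA1 F x) (potA2 F x) (cos theta) (sin theta).

(** This is where V and A get their form: the ds components of the null vectors have to compensate
    the derivatives of Im Phi and of Im(z conj(w)). The latter is constant along [null1] and
    contributes the 1 of V along [null2]. *)
Lemma null_tangent theta x (a b : R) :
  phase theta (base_point (a *: n1 theta x + b *: n2 theta x)) = 0 /\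
  dheight theta x (a *: n1 theta x + b *: n2 theta x) = 0.
Proof.
have cs := cos2Dsin2 theta.
have E1 : base_point (n1 theta x) = row3 (- 1) (cos theta) (sin theta).
  by apply/rowP => i; rewrite !mxE; case: i => -[|[|[|//]]] hi /=; rewrite ?mxE.
have E2 : base_point (n2 theta x) = row3 0 (- sin theta) (cos theta).
  by apply/rowP => i; rewrite !mxE; case: i => -[|[|[|//]]] hi /=; rewrite ?mxE.
have E : base_point (a *: n1 theta x + b *: n2 theta x) =
    a *: row3 (- 1) (cos theta) (sin theta) + b *: row3 0 (- sin theta) (cos theta).
  rewrite base_pointD E1; congr (_ + _).
  by have := base_pointD b (n2 theta x) 0; rewrite E2 !addr0 => ->; rewrite (_ : base_point 0 = 0) ?addr0 //;
    apply/rowP => i; rewrite !mxE; case: i => -[|[|[|//]]] hi /=; rewrite ?mxE.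
split.
  rewrite E /phase !mxE /=.
  transitivity (a * (cos theta ^+ 2 + sin theta ^+ 2 - 1)); first by ring.
  by rewrite cs subrr mulr0.
rewrite /dheight E derive_comb conj_im_radial conj_im_angular.
rewrite !mxE /= /potV /potA1 /potA2 -/U.
move: (partial 0 U _) (partial 1 U _) (partial 2 U _) => u0 u1 u2.
transitivity (- b * (cos theta ^+ 2 + sin theta ^+ 2 - 1)); first by ring.
by rewrite cs subrr mulr0.
Qed.

Lemma tangent_null theta x u : phase theta (base_point u) = 0 -> dheight theta x u = 0 ->
  exists a b, u = a *: n1 theta x + b *: n2 theta x.
Proof.
move=> hp hd; have cs := cos2Dsin2 theta.
(* The coefficients are read off from the dt component and the angular component. The ds component
   then agrees because [dheight] is injective in it. *)
pose a := - u 0 0; pose b := - sin theta * u 0 2 + cos theta * u 0 3.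
exists a, b; move: hp; rewrite /phase !mxE /= => hp.
have u00 : u 0 0 = - (u 0 2 * cos theta + u 0 3 * sin theta).
  by apply/eqP; rewrite -addr_eq0 addrA hp.
have [_ h0] := null_tangent theta x a b.
pose z := a *: n1 theta x + b *: n2 theta x; rewrite -/z in h0 *.
have z0 : z 0 0 = u 0 0 by rewrite /z /n1 /n2 /a !mxE /=; ring.
have z2 : z 0 2 = u 0 2.
  rewrite /z /n1 /n2 /a /b !mxE /=.
  rewrite u00.
  transitivity (u 0 2 * (cos theta ^+ 2 + sin theta ^+ 2)); [ring|by rewrite cs mulr1].
have z3 : z 0 3 = u 0 3.
  rewrite /z /n1 /n2 /a /b !mxE /=.
  rewrite u00.
  transitivity (u 0 3 * (cos theta ^+ 2 + sin theta ^+ 2)); [ring|by rewrite cs mulr1].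
have zb : base_point z = base_point u.
  by rewrite /base_point z0 z2 z3.
move: h0 hd; rewrite /dheight z2 z3 zb => h0 hd.
have z1 : z 0 1 = u 0 1 by apply: (addIr (- (u 0 3 * cos theta - u 0 2 * sin theta))); apply: (addIr (- 'D_(base_point u) (conj_im F theta : _ -> R^o) (base_point x))); rewrite h0 hd.
have zE i j : i = j -> z 0 i = u 0 i -> u 0 j = z 0 j by move=> -> ->.
by apply/rowP; elim/ord4_ind; [apply: zE z0|apply: zE z1|apply: zE z2|apply: zE z3]; exact: val_inj.
Qed.

End IncidenceSurfaces.

(** * The incidence sets are embedded surfaces *)

Section BetaSurfaces.
Context {R : realType} {F : 'rV[R]_2 -> R} (pF : periodic_cyl F).
Implicit Types (x u w : 'rV[R]_4) (theta v r : R).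

Definition incidence_surface theta v r : set 'rV[R]_4 :=
  [set x | phase theta (base_point x) = v /\ height F theta x = r].

Lemma base_point_row4 (a b c d : R) : base_point (row4 a b c d) = row3 a c d.
Proof. by rewrite /base_point !mxE. Qed.

Lemma surface_incidence theta v r : surface (incidence_surface theta v r).
Proof.
split.
  (* With z = 0 the equations give t = v and are solved for s. *)
  exists (row4 v (r + conj_im F theta (row3 v 0 0)) 0 0); split.
    by rewrite base_point_row4 /phase !mxE /= !mul0r !addr0.
  by rewrite /height base_point_row4 !mxE /= !mul0r subrr subr0 addrK.
move=> x _.
pose G (y : 'rV[R]_4) : 'rV[R]_2 := row2 (phase theta (base_point y) - v) (height F theta y - r).
have G0 y : G y 0 0 = phase theta (base_point y) - v by rewrite mxE.
have G1 y : G y 0 1 = height F theta y - r by rewrite mxE.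
have sG : smooth_on setT G.
  apply/smooth_mxP => i j; rewrite (ord1 i); case: j => -[|[|//]] hj; under eq_fun do rewrite mxE /=.
    by apply: smoothB; [exact: smooth_phase|exact: smooth_cst].
  by apply: smoothB; [exact: smooth_height|exact: smooth_cst].
exists setT, G; split => //; first exact: openT; last first.
  move=> y _; split=> [[e1 e2]|E].
    apply/rowP => i; rewrite [RHS]mxE; case: i => -[|[|//]] hi; rewrite mxE /=.
      by rewrite e1 subrr.
    by rewrite e2 subrr.
  split; apply/eqP; rewrite -subr_eq0; apply/eqP.
    by rewrite -G0 E mxE.
  by rewrite -G1 E mxE.
move=> z.
(* Moving in the (t, s) plane suffices: the phase sees only t, and [k] corrects s for the change of
   Im Phi caused by t. *)
pose k := 'D_(row3 (z 0 0) 0 0) (conj_im F theta : _ -> R^o) (base_point x).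
pose u := row4 (z 0 0) (z 0 1 + k) 0 0.
exists u; have dG : derivable G x u by exact: (Ck_on_derivable (sG 1)).
have d1 := isdB (is_derive_phase theta x u) (isd_cst x u v).
have d2 := isdB (is_derive_height pF theta x u) (isd_cst x u r).
have c0 : 'D_u G x 0 0 = z 0 0.
  rewrite derive_mx // mxE; apply: derive_val; apply: is_derive_cast d1 _ _ => [y|].
    by rewrite G0.
  by rewrite base_point_row4 /phase !mxE /=; ring.
have c1 : 'D_u G x 0 1 = z 0 1.
  rewrite derive_mx // mxE; apply: derive_val; apply: is_derive_cast d2 _ _ => [y|].
    by rewrite G1.
  by rewrite /dheight base_point_row4 -/k !mxE /=; ring.
apply/rowP => i; case: i => -[|[|//]] hi.
  by rewrite (_ : Ordinal hi = 0) //; exact: val_inj.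
by rewrite (_ : Ordinal hi = 1) //; exact: val_inj.
Qed.

(** One direction differentiates the two equations along a curve. For the converse a straight line
    already keeps the affine phase constant, and it is corrected in the s direction to keep the
    height constant too. *)
Lemma tangentP theta v r x u : incidence_surface theta v r x ->
  tangent (incidence_surface theta v r) x u <->
  phase theta (base_point u) = 0 /\ @dheight R F theta x u = 0.
Proof.
move=> [xv xr]; split.
  move=> [gam [sgam g0 gS gu]].
  have dg : is_derive (0 : R^o) (1 : R^o) (gam : R^o -> _) u.
    split; first exact: (Ck_on_derivable (sgam 1)).
    by rewrite -gu derive1E.
  have z (f : 'rV[R]_4 -> R) a b : smooth f -> (forall t, f (gam t) = a) ->
      is_derive x u (f : _ -> R^o) b -> b = 0.
    move=> sf fa [_ <-]; have [_ E] := is_derive_curve (sf 1) dg; rewrite g0 in E; rewrite -E.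
    have -> : (fun t : R^o => f (gam t) : R^o) = cst a by apply/funext => t; rewrite fa.
    exact: derive_cst.
  split.
    by apply: (z _ v _ (smooth_phase theta)) (is_derive_phase theta x u) => t; have [] := gS t.
  by apply: (z _ r _ (smooth_height pF theta)) (is_derive_height pF theta x u) => t; have [] := gS t.
move=> [up uh].
(* The height contains s with coefficient 1, so adding this defect to s restores its value; the
   defect has derivative 0 at 0 as [dheight] vanishes on u, so the tangent vector remains u. *)
pose k t := height F theta x - height F theta (t *: u + x).
pose gam t : 'rV[R]_4 := k t *: delta_mx 0 1 + (t *: u + x).
have E0 : 0 *: u + x = x by rewrite scale0r add0r.
have sk : smooth (k : R^o -> R).
  apply: smoothB; first exact: smooth_cst.
  apply: (@smooth_affine _ R^o _ (fun t => t *: u + x) (fun t => t *: u)); last exact: smooth_height.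
    by move=> t a b; rewrite scalerDl -scalerA addrA.
  by move=> t; apply: cvgD; [apply: cvgZr_tmp; exact: cvg_id|exact: cvg_cst].
pose e1 : 'rV[R]_4 := delta_mx 0 1.
have gamE i t : gam t 0 i = k t * e1 0 i + (t * u 0 i + x 0 i) by rewrite /gam !mxE.
have sgam : smooth_on setT (gam : R^o -> _).
  apply/smooth_mxP => i j; rewrite (ord1 i).
  have -> : (fun t : R^o => gam t 0 j) = fun t : R^o => k t * e1 0 j + (t * u 0 j + x 0 j).
    by apply/funext => t; rewrite gamE.
  by do ?[exact: smooth_id|exact: smooth_cst|exact: sk|apply: smoothD|apply: smoothM].
have k0 : k 0 = 0 by rewrite /k E0 subrr.
have dk : is_derive (0 : R^o) (1 : R^o) (k : R^o -> R^o) 0.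
  have [h1 h2] := is_derive_height pF theta x u.
  have := @is_derive_line _ _ _ (height F theta : _ -> R^o) x u 0; rewrite E0 h2 uh => /(_ h1) h.
  by have := isdB (isd_cst (0 : R^o) (1 : R^o) (height F theta x)) h; rewrite subr0.
have gam0 : gam 0 = x by rewrite /gam k0 E0 scale0r add0r.
exists gam; split; [exact: sgam|exact: gam0| |].
- move=> t; split.
    rewrite /gam !base_pointD; move: up xv; rewrite /phase !mxE /= => up <-.
    transitivity (x 0 0 + x 0 2 * cos theta + x 0 3 * sin theta +
      t * (u 0 0 + u 0 2 * cos theta + u 0 3 * sin theta)); first by ring.
    by rewrite up mulr0 addr0.
  have -> : height F theta (gam t) = height F theta (t *: u + x) + k t.
    rewrite /height (_ : base_point (gam t) = base_point (t *: u + x)); last first.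
      by apply/rowP => i; rewrite /gam !mxE; case: i => -[|[|[|//]]] hi /=; rewrite ?mxE /=; ring.
    rewrite /gam !mxE /=; move: (conj_im _ _ _) (k t) => a b; ring.
  by rewrite /k addrC subrK.
- rewrite derive1E; apply/rowP => j.
  rewrite derive_mx ?mxE; last exact: (Ck_on_derivable (sgam 1)).
  apply: derive_val.
  have dt : is_derive (0 : R^o) (1 : R^o) (fun t : R^o => t * u 0 j + x 0 j : R^o) (u 0 j).
    have := isdD (isdM (is_derive_id (0 : R^o) (1 : R^o)) (isd_cst _ _ (u 0 j))) (isd_cst _ _ (x 0 j)).
    by move/is_derive_cast; apply => //; rewrite /=; ring.
  have := isdD (isdM dk (isd_cst _ _ (e1 0 j))) dt.
  by move/is_derive_cast; apply => [t|]; [rewrite gamE|rewrite k0; ring].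
Qed.

End BetaSurfaces.

(** * Conformal classes *)

Section ConformalStructures.
Context {R : realType}.
Implicit Types g : 'rV[R]_4 -> 'M[R]_4.

Lemma conformal_refl g : conformal g g.
Proof.
exists (fun=> 1); split; [exact: smooth_cst|by move=> x; exact: oner_neq0|].
by move=> x; rewrite scale1r.
Qed.

Lemma conformal_sym g g' : conformal g g' -> conformal g' g.
Proof.
move=> [l [sl l0 E]]; exists (fun x => (l x)^-1); split.
- exact: smoothV.
- by move=> x; rewrite invr_eq0.
- by move=> x; rewrite E scalerA mulVf // scale1r.
Qed.

Lemma conformal_trans g1 g2 g3 : conformal g1 g2 -> conformal g2 g3 -> conformal g1 g3.
Proof.
move=> [l [sl l0 E]] [m [sm m0 E']]; exists (fun x => m x * l x); split.
- exact: smoothM.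
- by move=> x; rewrite mulf_neq0.
- by move=> x; rewrite E' E scalerA.
Qed.

Lemma conformal_class g1 g2 : conformal g1 g2 ->
  [set g | conformal g1 g] = [set g | conformal g2 g].
Proof.
move=> h; apply/seteqP; split => g /=; last exact: conformal_trans.
by apply: conformal_trans; exact: conformal_sym.
Qed.

Lemma null_on_span (g : 'M[R]_4) (n1 n2 u w : 'rV[R]_4) (a b a' b' : R) :
  g^T = g -> null_on g n1 n2 -> u = a *: n1 + b *: n2 -> w = a' *: n1 + b' *: n2 ->
  u *m g *m w^T = 0.
Proof.
move=> gT [h11 h12 h22] -> ->.
have h21 : n2 *m g *m n1^T = 0.
  have : (n1 *m g *m n2^T)^T = 0 by rewrite h12 trmx0.
  by rewrite !trmx_mul trmxK gT mulmxA.
have -> : (a' *: n1 + b' *: n2)^T = a' *: n1^T + b' *: n2^T by rewrite linearD !linearZ.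
rewrite 2!mulmxDl mulmxDr mulmxDr -!scalemxAl -!scalemxAr.
by rewrite h11 h12 h21 h22 !scaler0 !addr0.
Qed.

Lemma signature_neq0 (g : 'M[R]_4) : signature_mmpp g -> g != 0.
Proof.
move=> [P _ E]; apply/negP => /eqP g0; move: E; rewrite g0 mulmx0 mul0mx.
by move=> /matrixP/(_ o0 o0); rewrite !mxE /= => /eqP; rewrite eq_sym mulr1n oppr_eq0 oner_eq0.
Qed.

Lemma smooth_monopole_metric (V A1 A2 : 'rV[R]_4 -> R) : (forall x, V x != 0) ->
  smooth V -> smooth A1 -> smooth A2 ->
  smooth_on setT (fun x => monopole_metric (V x) (A1 x) (A2 x)).
Proof.
move=> V0 sV s1 s2; have sVi := smoothV V0 sV.
apply/smooth_mxP => i j; rewrite /monopole_metric; under eq_fun do rewrite tabE.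
elim/ord4_ind: i; elim/ord4_ind: j => /=;
by do ?[exact: smooth_cst|exact: sV|exact: s1|exact: s2|exact: sVi|apply: smoothB|apply: smoothN|apply: smoothM].
Qed.

End ConformalStructures.

(** * The induced conformal structure and its uniqueness *)

Section InducedStructure.
Context {R : realType} {h : R[i] -> R -> R} (smooth_h : smooth_cylinder h).
Implicit Types (x u w : 'rV[R]_4).

Let F := pullback h.
Let pF : periodic_cyl F := periodic_pullback smooth_h.

Hypothesis V_gt0 : forall p, partial 0 (lift_mean F) p < 1.

Definition induced_metric x : 'M[R]_4 := monopole_metric (potV F x) (potA1 F x) (potA2 F x).

Lemma potV_gt0 x : 0 < potV F x.
Proof. by rewrite subr_gt0. Qed.

Lemma potV_neq0 x : potV F x != 0.
Proof. by rewrite gt_eqF // potV_gt0. Qed.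

Lemma neutral_induced_metric : neutral_metric induced_metric.
Proof.
have [sV s1 s2] := smooth_potentials pF.
split.
- exact: (smooth_monopole_metric potV_neq0 sV s1 s2).
- by move=> x; exact: monopole_metric_sym.
- by move=> x; apply: signature_monopole; exact: potV_gt0.
Qed.

Lemma boundary_incidence theta v nu : complex.Im nu = h (expi theta) v ->
  [set x | disk_boundary (disk F x) (twistor_point theta v nu)] =
  @incidence_surface R F theta v (complex.Re nu).
Proof.
move=> hnu; apply/funext => x; apply/propext.
by apply: disk_boundaryP => //; rewrite /F pullback_row2.
Qed.

Lemma beta_surface_induced p : twistor_P h p ->
  beta_surface [set g | conformal induced_metric g] [set x | disk_boundary (disk F x) p].
Proof.
move=> [theta [v [nu [hnu ->]]]]; rewrite boundary_incidence //.
split; first exact: surface_incidence.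
exists induced_metric; first exact: conformal_refl.
move=> x u w Sx /(tangentP pF _ Sx)[u1 u2] /(tangentP pF _ Sx)[w1 w2].
have [a [b Eu]] := tangent_null pF u1 u2; have [a' [b' Ew]] := tangent_null pF w1 w2.
have cs := cos2Dsin2 theta; split.
  apply: null_on_span Eu Ew; first exact: monopole_metric_sym.
  by apply: null_monopole => //; exact: potV_neq0.
by apply: hodge_null_plane cs Eu Ew; exact: potV_gt0.
Qed.

(** Through every x and for every angle there passes an incidence surface, so all null planes of the
    induced metric at x are null for [g1]. The explicit factor -g1_00 / V in [null_planes_determine]
    shows that the conformal factor is smooth. *)
Lemma beta_surfaces_determine g1 : neutral_metric g1 ->
  (forall p, twistor_P h p ->
     beta_surface [set g | conformal g1 g] [set x | disk_boundary (disk F x) p]) ->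
  conformal induced_metric g1.
Proof.
move=> [sg gT sig] H.
have null theta x : null_on (g1 x)
    (null1 (potA1 F x) (potA2 F x) (cos theta) (sin theta))
    (null2 (potV F x) (potA1 F x) (potA2 F x) (cos theta) (sin theta)).
  pose v := phase theta (base_point x).
  (* Chosen so that the point lies in P_h and its incidence surface passes through x. *)
  pose nu := height F theta x +i* h (expi theta) v.
  have [_ [g2 [l [_ l0 E]]]] := H (twistor_point theta v nu)
    (ex_intro _ theta (ex_intro _ v (ex_intro _ nu (conj erefl erefl)))).
  rewrite boundary_incidence // => N.
  have Sx : @incidence_surface R F theta v (complex.Re nu) x by [].
  set n1 := null1 _ _ _ _; set n2 := null2 _ _ _ _ _.
  have t1 : tangent (@incidence_surface R F theta v (complex.Re nu)) x n1.
    apply/(tangentP pF _ Sx); have := null_tangent pF theta x 1 0.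
    by rewrite scale1r scale0r addr0.
  have t2 : tangent (@incidence_surface R F theta v (complex.Re nu)) x n2.
    apply/(tangentP pF _ Sx); have := null_tangent pF theta x 0 1.
    by rewrite scale1r scale0r add0r.
  have N1 u w : tangent (@incidence_surface R F theta v (complex.Re nu)) x u ->
      tangent (@incidence_surface R F theta v (complex.Re nu)) x w -> u *m g1 x *m w^T = 0.
    move=> tu tw; have [] := N x u w Sx tu tw; rewrite E -scalemxAr -scalemxAl => /eqP.
    by rewrite scaler_eq0 (negbTE (l0 x)) /= => /eqP.
  by split; apply: N1.
have [sV _ _] := smooth_potentials pF.
have det x : g1 x = (- g1 x o0 o0 * (potV F x)^-1) *: induced_metric x.
  apply: null_planes_determine; [exact: potV_neq0|exact: gT|move=> c s cs].
  have /unit_complex_expi[theta E] : `|c +i* s| = 1 :> R[i].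
    have : `|c +i* s| ^+ 2 = 1 :> R[i] by rewrite normC_sqr /sqnorm /= cs.
    by move/eqP; rewrite sqrp_eq1 // => /eqP.
  by have [-> ->] : c = cos theta /\ s = sin theta by case: E.
exists (fun x => - g1 x o0 o0 * (potV F x)^-1); split; last exact: det.
  have /smooth_mxP s := sg.
  apply: smoothM; first by apply: smoothN; exact: s.
  by apply: smoothV => // x; exact: potV_neq0.
(* A zero of the factor would make [g1 x] vanish, against its signature. *)
move=> x; apply/negP => /eqP z; have := signature_neq0 (sig x).
by rewrite det z scale0r eqxx.
Qed.

End InducedStructure.

Theorem theorem5p1 (R : realType) (h : R[i] -> R -> R)
    (smooth_h : smooth_cylinder h) :
  exists2 f : 'rV[R]_4 -> R[i] -> {vspace 'rV[R[i]]_4},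
    smooth_disk_family h f &
    (forall p : 'rV[R]_3, partial 0 (transformR h) p < 1) ->
    exists2 c : set ('rV[R]_4 -> 'M[R]_4),
      unique (fun c' : set ('rV[R]_4 -> 'M[R]_4) =>
        [/\ neutral_conformal_structure c', self_dual c' &
            forall p, twistor_P h p ->
              beta_surface c' [set x | disk_boundary (f x) p]]) c &
      c (metric_VA (fun q => 1 - partial 0 (transformR h) q)
                   (fun q => check_star (check_d (transformR h) q))).
Proof.
exists (disk (pullback h)); first exact: smooth_disk_family_disk.
rewrite transformRE => V_gt0.
exists [set g | conformal (@induced_metric R h) g]; last first.
  rewrite (_ : metric_VA _ _ = @induced_metric R h); first exact: conformal_refl.
  by apply/funext => x; exact: metric_VA_monopole.
split.
  split; first by exists (@induced_metric R h) => //; exact: neutral_induced_metric.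
    exists (@induced_metric R h); first exact: conformal_refl.
    exact: (self_dual_potentials (periodic_pullback smooth_h)).
  by move=> p; exact: beta_surface_induced.
move=> c' [[g1 ng1 ->] _ H]; apply: conformal_class.
exact: (beta_surfaces_determine smooth_h).
Qed.
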